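(* Let a wedge be given by $\langle\eta,p,\alpha\rangle=\langle\nu,q,\beta\rangle$, where $p\neq q$ are its two generating points, and suppose that this wedge tiles the disk around either $p$ or $q$. Then $\alpha=\beta=\pi/n$, where $n\ge 3$ is an odd integer.
   Context: Tile: if $\gamma$ is a simple closed plane curve bounding an open contractible region $U$, the closure $\overline U=U\cup\gamma$ is called a tile, with boundary $\gamma$. A tile has a fixed position in the plane. Rotation: for an angle $\alpha$ and a point $p$, $\alpha_p$ denotes the anticlockwise rotation of the plane by $\alpha$ about $p$. Radial generation: let $\eta$ be a continuous planar curve segment with no self-intersections, $p$ a point on $\eta$, and $\alpha\in(0,2\pi)$. The union of $\eta$, $\eta'=\alpha_p(\eta)$ and the circular arcs centred at $p$ connecting the end-points of $\eta$ with the corresponding end-points of $\eta'$ is a contour $\gamma=[\eta,p,\alpha]$. It is the boundary of a tile if and only if it is simple; in that case the tile $\overline U$ is said to be radially generated by $\eta$, $p$ and $\alpha$, written $\overline U=\langle\eta,p,\alpha\rangle$. (In this case $p$ is an end-point of $\eta$ and exactly one arc is added.) Wedge: a tile is generated by a point $p$ if it equals $\langle\eta,p,\alpha\rangle$ for some $\eta,\alpha$. A wedge is a tile that is radially generated by exactly two points (vertices of its boundary). A tile $\langle\eta,p,\alpha\rangle$ tiles the disk around $p$ if its images under the iterates of $\alpha_p$ form a tiling of a closed disk centred at $p$, i.e. they cover the disk and distinct images meet only along their boundaries. *)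

(* Defs.v *)
From HB Require Import structures.
From mathcomp Require Import all_boot all_order all_algebra.
From mathcomp Require Import all_classical all_reals all_analysis.
Set Implicit Arguments.
Unset Strict Implicit.
Unset Printing Implicit Defensive.
Import Order.TTheory GRing.Theory Num.Theory.
Import numFieldNormedType.Exports.
Local Open Scope classical_set_scope.
Local Open Scope ring_scope.

(* The library puts the max-norm on [R * R]; it is used here only through the
   topology it induces.  Disks are Euclidean. *)

Definition frontier (T : topologicalType) (A : set T) : set T :=
  closure A `\` interior A.

Definition curve_segment (R : realType) (eta : R -> R * R) : Prop :=
  {within `[0, 1], continuous eta} /\ set_inj `[0, 1] eta.

Definition trace (R : realType) (eta : R -> R * R) : set (R * R) :=
  eta @` `[0, 1].

Definition simple_closed_curve (R : realType) (gamma : set (R * R)) : Prop :=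
  exists c : R -> R * R,
    [/\ {within `[0, 1], continuous c}, c 0 = c 1,
        set_inj `[0, 1[ c & gamma = trace c].

Definition contractible (R : realType) (U : set (R * R)) : Prop :=
  exists (x0 : R * R) (H : (R * R) * R -> R * R),
    [/\ U x0,
        {within U `*` `[0, 1], continuous H},
        forall x t, U x -> 0 <= t <= 1 -> U (H (x, t)) &
        forall x, U x -> H (x, 0) = x /\ H (x, 1) = x0].

(* [region] is the open contractible region bounded by the simple closed
   curve [tboundary]; the tile itself, as a subset of the plane, is
   [tile_set] below. *)
Record tile (R : realType) := Tile {
  region : set (R * R);
  tboundary : set (R * R);
  tboundary_simple : simple_closed_curve tboundary;
  region_open : open region;
  region_contractible : contractible region;
  region_frontier : frontier region = tboundary
}.

Definition tile_set (R : realType) (T : tile R) : set (R * R) :=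
  region T `|` tboundary T.

Definition rot (R : realType) (alpha : R) (p z : R * R) : R * R :=
  (p.1 + (cos alpha * (z.1 - p.1) - sin alpha * (z.2 - p.2)),
   p.2 + (sin alpha * (z.1 - p.1) + cos alpha * (z.2 - p.2))).

(* The circular arc centred at [p] run through anticlockwise from [e] to
   [rot alpha p e]; it is the single point [p] when [e = p]. *)
Definition arc (R : realType) (alpha : R) (p e : R * R) : set (R * R) :=
  [set rot theta p e | theta in `[0, alpha]].

Definition contour (R : realType) (eta : R -> R * R) (p : R * R) (alpha : R)
    : set (R * R) :=
  trace eta `|` rot alpha p @` trace eta
    `|` arc alpha p (eta 0) `|` arc alpha p (eta 1).

(* T = <eta, p, alpha> *)
Definition radially_generated (R : realType) (T : tile R)
    (eta : R -> R * R) (p : R * R) (alpha : R) : Prop :=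
  [/\ curve_segment eta, trace eta p, 0 < alpha < 2 * pi &
      tboundary T = contour eta p alpha].

Definition generated_by (R : realType) (T : tile R) (p : R * R) : Prop :=
  exists (eta : R -> R * R) (alpha : R), radially_generated T eta p alpha.

Definition wedge (R : realType) (T : tile R) : Prop :=
  exists p q : R * R,
    p <> q /\ forall x, generated_by T x <-> x = p \/ x = q.

Definition disk (R : realType) (p : R * R) (r : R) : set (R * R) :=
  [set z | (z.1 - p.1) ^+ 2 + (z.2 - p.2) ^+ 2 <= r ^+ 2].

Definition tiles_disk (R : realType) (T : tile R) (p : R * R) (alpha : R)
    : Prop :=
  exists r : R,
    [/\ 0 < r,
        \bigcup_(k in [set: nat]) (iter k (rot alpha p) @` tile_set T)
          = disk p r &
        forall j k : nat,
          iter j (rot alpha p) @` tile_set T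
            <> iter k (rot alpha p) @` tile_set T ->
          iter j (rot alpha p) @` tile_set T
              `&` iter k (rot alpha p) @` tile_set T
            `<=` iter j (rot alpha p) @` tboundary T
              `&` iter k (rot alpha p) @` tboundary T].

(* Main.v *)
(* Rotation about a generating point p exchanges the two copies of the
   generating curve, so it induces an orientation-reversing partial involution
   of the boundary curve that misses only the circular arc about p; likewise at
   q.  Start from the arc about the point with the larger angle, say p, and
   apply alternately the involutions at q and at p.  The images are congruent
   circular arcs with disjoint interiors, so the process stops; it can only stop
   by running into the arc about q, after an even number 2k of steps.  As the
   arc about q cannot be prolonged inside the boundary, the two arcs coincide
   and alpha = beta.  Both involutions reverse the order of the N = 2k + 1 arcs
   along the curve, which forces the sense of the t-th rotation to be the parity
   of the floor of tS/N for some odd S coprime to N.  The product of these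
   rotations maps p to q; in terms of w = - exp(i alpha) this says that iterating
   y |-> w^(+-1) y + 1 along the line of slope S/N leads from 1 to 0.

   On the other hand, a tiling of a disk gives alpha = 2 pi / M: the arc about p
   lies on the rim of the disk (otherwise, by Baire, the tile contains another
   arc of the rim, the tile is invariant under the rotation, and the whole rim
   lies on the boundary curve), and two copies of the tile whose rim arcs overlap
   have a common interior point.  Unless M is twice an odd number n >= 3, w is 1
   or has even order q.  In the second case a Galois conjugation makes
   w = exp(2 i pi / q), and Euclid's algorithm on S/N turns the iteration above
   into a word in the generators of a Hecke group applied to (1, 0), whose first
   coordinate is nonzero by a ping-pong argument. *)
From mathcomp Require Import all_boot all_order all_algebra.
From mathcomp Require Import all_classical all_reals all_analysis.
From mathcomp Require Import algC cyclotomic complex.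
From mathcomp Require Import ring lra zify.
Require Import Defs.
Set Implicit Arguments.
Unset Strict Implicit.
Unset Printing Implicit Defensive.
Import Order.TTheory GRing.Theory Num.Theory.
Import numFieldNormedType.Exports.
Local Open Scope classical_set_scope.
Local Open Scope ring_scope.

(** * Ping-pong for Hecke groups *)

(** The generating curve is only continuous, so no tangents exist. Directions at a generating point
    are compared through first hits of circles about it, and positions through monotone lifts of a
    periodic parametrization; that the generating point is an end-point of its curve also has to be
    proved this way. The arithmetic half rests on a parity. For words in $S$ and $V$ with $S^2$ and
    $V^q$ trivial up to sign, the parity of the length is preserved by the relations because $q$ is
    even. The moves of Euclid's algorithm act by words of even length, while only words of odd
    length carry $(1,0)$ to the vertical axis. When $M=2n$ with $n$ odd, $w$ has odd order $n$ and
    the parity is lost, so this case survives. Ping-pong needs $\sin(ka)/\sin a>0$ for all $0<k<q$;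
    the angle $a=\pi/q$ provides it, whence the conjugation. Euclid's algorithm proceeds by even
    multiples, so that numerators stay odd and neighbouring denominators have opposite parities; the
    parity then tells which value is which coordinate. *)

Definition pm (R : realFieldType) (z w : R * R) : Prop :=
  z = w \/ z = (- w.1, - w.2).

Lemma pm_refl (R : realFieldType) (z : R * R) : pm z z.
Proof. by left. Qed.

Lemma pm_trans (R : realFieldType) (u v w : R * R) : pm u v -> pm v w -> pm u w.
Proof.
case: u => u1 u2; case: v => v1 v2; case: w => w1 w2 [[-> ->]|[-> ->]] [[-> ->]|[-> ->]] /=; rewrite ?opprK.
- by left.
- by right.
- by right.
- by left.
Qed.

(** The quarter turn, an involution once vectors are taken up to sign by [pm], that is, in PSL2. *)
Definition invS (R : realFieldType) (z : R * R) : R * R := (- z.2, z.1).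

(** The Chebyshev polynomials of the second kind $(U_k, U_{k-1})$ at [l / 2]; for $l = 2\cos a$ they
    are $\sin((k+1)a)/\sin a$ and $\sin(ka)/\sin a$. *)
Fixpoint cheb (R : realFieldType) (l : R) (k : nat) : R * R :=
  if k is k'.+1 then let: (a, b) := cheb l k' in (l * a - b, a) else (1, 0).

(** This is $\det V^k = 1$. *)
Lemma cheb_det (R : realFieldType) (l : R) k :
  (cheb l k).1 ^+ 2 - l * (cheb l k).1 * (cheb l k).2 + (cheb l k).2 ^+ 2 = 1.
Proof.
elim: k => [|k] /=; first by ring.
by case: (cheb l k) => a b /= <-; ring.
Qed.

(* The power [V ^ k] of [V = [l, -1; 1, 0]], an elliptic element of order [q] in
   PSL2 when [l = 2 cos (pi / q)]. *)
Definition powV (R : realFieldType) (l : R) k (z : R * R) : R * R :=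
  let: (a, b) := cheb l k in (a * z.1 - b * z.2, b * z.1 - (l * b - a) * z.2).

Section HeckeOrbit.
Variables (R : realFieldType) (l : R) (q : nat).
Hypotheses (q_even : ~~ odd q) (q_gt0 : (0 < q)%N).
Hypothesis cheb_pos : forall k, (0 < k < q)%N -> 0 < (cheb l k).2.
Hypothesis cheb_q : (cheb l q).2 = 0.

Local Notation V := (powV l).
Local Notation e1 := ((1, 0) : R * R).
Implicit Types z w : R * R.

Lemma powV0 z : V 0 z = z.
Proof. by case: z => x y; rewrite /powV /=; congr (_, _); ring. Qed.

Lemma powVS k z : V k.+1 z = (l * (V k z).1 - (V k z).2, (V k z).1).
Proof. by rewrite /powV /=; case: (cheb l k) => a b; congr (_, _) => /=; ring. Qed.

Lemma powVD j k z : V (j + k) z = V j (V k z).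
Proof. by elim: j => [|j IH]; rewrite ?powV0 // addSn !powVS IH. Qed.

Lemma pm_powV k z w : pm z w -> pm (V k z) (V k w).
Proof.
case=> ->; first exact: pm_refl.
by right; rewrite /powV; case: (cheb l k) => a b /=; congr (_, _); ring.
Qed.

Lemma pm_invS z w : pm z w -> pm (invS z) (invS w).
Proof. by case=> ->; [left|right]; rewrite /invS //=. Qed.

Lemma pm_invSS z : pm (invS (invS z)) z.
Proof. by right; rewrite /invS. Qed.

Lemma q_gt1 : (1 < q)%N.
Proof. by case: q q_even q_gt0 => [|[|]]. Qed.

(** The determinant leaves only $(0, \pm 1)$, and positivity just before the zero at [q] selects the
    sign. *)
Lemma cheb_pred : cheb l q.-1 = (0, 1).
Proof.
have q1 := q_gt1.
have h : (cheb l q).2 = (cheb l q.-1).1.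
  by rewrite -[in LHS](prednK q_gt0) /=; case: (cheb l q.-1).
have := cheb_det l q.-1; rewrite -h cheb_q.
have : 0 < (cheb l q.-1).2 by apply: cheb_pos; lia.
case: (cheb l q.-1) h => a b /= <-; rewrite cheb_q => b0 e.
by congr (_, _); nra.
Qed.

Lemma powVq z : pm (V q z) z.
Proof.
right; rewrite -[q](prednK q_gt0) powVS /powV cheb_pred.
by case: z => x y /=; congr (_, _); ring.
Qed.

Lemma powV_mod k z : pm (V k z) (V (k %% q)%N z).
Proof.
rewrite {1}(divn_eq k q); elim: (k %/ q)%N => [|n IH]; first by rewrite mul0n add0n; left.
by rewrite mulSn -addnA powVD; apply: pm_trans IH; apply: powVq.
Qed.

Lemma powV_pred_e1 : pm (invS e1) (V q.-1 e1).
Proof. by left; rewrite /powV cheb_pred /invS /=; congr (_, _); ring. Qed.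

Lemma invS_powV_pred_e1 : pm (invS (V q.-1 e1)) e1.
Proof. by right; rewrite /powV cheb_pred /invS /=; congr (_, _); ring. Qed.

(** The word $V^k S V^{k_1} S \cdots$ applied to [e1]; the leading exponent is kept apart because it
    alone may vanish in a normal form. *)
Fixpoint wval k ks : R * R :=
  V k (if ks is k' :: ks' then invS (wval k' ks') else e1).

(** Length of the word in the letters $V$ and $S$; only its parity is invariant under rewriting. *)
Fixpoint wpar k ks : nat :=
  k + (if ks is k' :: ks' then (wpar k' ks').+1 else 0)%N.

(** The last exponent must also differ from [q.-1], since $S V^{q-1}$ fixes [e1] up to sign and
    would cancel. *)
Fixpoint wred ks : bool :=
  if ks is k :: ks' then
    if ks' is [::] then (0 < k < q.-1)%N else (0 < k < q)%N && wred ks'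
  else true.

Lemma wvalD j k ks : V j (wval k ks) = wval (j + k) ks.
Proof. by case: ks => [|k' ks] /=; rewrite powVD. Qed.

Lemma wparD j k ks : wpar (j + k) ks = (j + wpar k ks)%N.
Proof. by case: ks => [|k' ks] /=; lia. Qed.

Lemma wval_mod k ks : pm (wval k ks) (wval (k %% q)%N ks).
Proof. by case: ks => [|k' ks] /=; apply: powV_mod. Qed.

Lemma wpar_mod k ks : odd (wpar (k %% q)%N ks) = odd (wpar k ks).
Proof.
by rewrite [in RHS](divn_eq k q) wparD oddD oddM (negbTE q_even) andbF.
Qed.

(** The rewritings are $S^2 = 1$, $V^q = 1$ and $S e_1 = V^{q-1} e_1$, all up to sign. Each changes
    the length by an even number because [q] is even. *)
Lemma word_normal ks k : exists k' ks',
  [/\ (k' < q)%N, wred ks', pm (wval k ks) (wval k' ks')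
    & odd (wpar k ks) = odd (wpar k' ks')].
Proof.
have oq1 : odd q.-1 by case: q q_even q_gt0 => //= n; rewrite negbK.
elim: ks k => [|k1 ks IH] k.
  exists (k %% q)%N, [::]; rewrite ltn_mod q_gt0; split => //.
    exact: (wval_mod k [::]).
  by rewrite (wpar_mod k [::]).
have [k1' [ks1 [k1q red1 val1 par1]]] := IH k1.
have step : pm (wval k (k1 :: ks)) (V k (invS (wval k1' ks1))).
  by apply: pm_powV; apply: pm_invS.
have spar : odd (wpar k (k1 :: ks)) = odd (k + (wpar k1' ks1).+1).
  by rewrite /= !oddD /= par1.
case: ks1 => [|k2 ks2] in red1 val1 par1 step spar *.
  have [k10|k1n0] := posnP k1'.
    exists ((k + q.-1) %% q)%N, [::]; rewrite ltn_mod q_gt0; split => //.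
      apply: (pm_trans step); rewrite k10 /= powV0.
      apply: pm_trans (powV_mod _ _); rewrite powVD; apply: pm_powV.
      exact: powV_pred_e1.
    by rewrite (wpar_mod _ [::]) spar k10 /= addn0 !oddD /= oq1 addbF.
  have [k1e|k1ne] := eqVneq k1' q.-1.
    exists (k %% q)%N, [::]; rewrite ltn_mod q_gt0; split => //.
      apply: (pm_trans step); rewrite k1e /=.
      apply: pm_trans (powV_mod _ _); apply: pm_powV; exact: invS_powV_pred_e1.
    by rewrite (wpar_mod _ [::]) spar k1e !oddD /= !oddD /= oq1 !addbF.
  exists (k %% q)%N, [:: k1']; rewrite ltn_mod q_gt0; split => //=.
  - by rewrite k1n0; lia.
  - exact: (pm_trans step (wval_mod k [:: k1'])).
  - by rewrite (wpar_mod k [:: k1']) spar.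
have [k10|k1n0] := posnP k1'.
  exists ((k + k2) %% q)%N, ks2; rewrite ltn_mod q_gt0; split => //.
  - by move: red1 => /=; case: ks2 {val1 par1 step spar} => //= ? ? /andP[].
  - apply: (pm_trans step); rewrite k10 -[wval 0 _]/(V 0 (invS (wval k2 ks2))) powV0.
    apply: pm_trans (wval_mod _ _); rewrite -wvalD; apply: pm_powV; exact: pm_invSS.
  - by rewrite wpar_mod spar k10 wparD !oddD /= ?add0n ?negbK.
exists (k %% q)%N, (k1' :: k2 :: ks2); rewrite ltn_mod q_gt0; split => //.
- by rewrite [wred _]/= k1n0 k1q.
- exact: (pm_trans step (wval_mod k (k1' :: k2 :: ks2))).
- by rewrite (wpar_mod k (_ :: _)) spar.
Qed.

Lemma cheb_fst k : (cheb l k).1 = (cheb l k.+1).2.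
Proof. by rewrite /=; case: (cheb l k). Qed.

Lemma cheb_ge0 k : (k <= q)%N -> 0 <= (cheb l k).2.
Proof.
rewrite leq_eqVlt => /orP[/eqP ->|kq]; first by rewrite cheb_q.
by case: k kq => [|k] kq //; apply/ltW/cheb_pos; rewrite kq.
Qed.

(* The ping-pong step; [pm] identifies the first and third quadrants. *)
Lemma powV_quadrant k x y : (0 < k < q)%N -> x < 0 -> 0 < y ->
  (V k (x, y)).1 < 0 /\ (V k (x, y)).2 < 0.
Proof.
move=> /andP[k0 kq] x0 y0; rewrite /powV.
have := cheb_fst k; have h1 := cheb_ge0 kq.
have h2 : 0 < (cheb l k).2 by apply: cheb_pos; rewrite k0.
have h3 : 0 <= (cheb l k.-1).2 by apply: cheb_ge0; lia.
have e3 : l * (cheb l k).2 - (cheb l k).1 = (cheb l k.-1).2.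
  by rewrite -(prednK k0) /=; case: (cheb l k.-1) => a b /=; ring.
move: h1 h2 e3; case: (cheb l k) => a b /= h1 h2 -> ea; move: h1; rewrite -ea => h1.
by split; nra.
Qed.

Lemma powV_quadrant_prod k z : (0 < k < q)%N -> z.1 * z.2 < 0 ->
  0 < (V k z).1 * (V k z).2.
Proof.
case: z => x y kq /= xy.
have [x0|x0|x0] := ltrgt0P x; last by rewrite x0 mul0r ltxx in xy.
  have x1 : - x < 0 by rewrite oppr_lt0.
  have y1 : 0 < - y by rewrite oppr_gt0; rewrite pmulr_rlt0 in xy.
  have [] := powV_quadrant kq x1 y1.
  rewrite /powV; case: (cheb l k) => a b /= h1 h2.
  by apply: mulr_gt0; lra.
have y0 : 0 < y by rewrite nmulr_rlt0 in xy.
by have [h1 h2] := powV_quadrant kq x0 y0; rewrite nmulr_rgt0.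
Qed.

(** Ping-pong on the sign of the product of the coordinates: $S$ makes it negative and a nontrivial
    power of $V$ makes it positive again. The bound on the last exponent starts the game inside an
    open quadrant. *)
Lemma wval_pos k ks : wred (k :: ks) -> 0 < (wval k ks).1 * (wval k ks).2.
Proof.
elim: ks k => [|k' ks IH] k.
  move=> /= kq; rewrite /powV; have := cheb_fst k.
  have : 0 < (cheb l k).2 by apply: cheb_pos; lia.
  have : 0 < (cheb l k.+1).2 by apply: cheb_pos; lia.
  by case: (cheb l k) => a b; set c := (cheb l k.+1).2; move=> /= c0 b0 ->; nra.
rewrite [wred _]/= => /andP[kq red]; have := IH _ red; rewrite /=.
by move=> h; apply: powV_quadrant_prod => //=; rewrite mulNr oppr_lt0 mulrC.
Qed.

(** A normal form with nonempty tail stays off both axes. What remains is $V^k e_1$, whose first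
    coordinate $U_k$ vanishes for $k<q$ only at the odd number $q-1$. *)
Lemma wval_axis k ks : (wval k ks).1 = 0 -> odd (wpar k ks).
Proof.
move=> v0; have [k' [ks' [kq red val ->]]] := word_normal ks k.
have {}v0 : (wval k' ks').1 = 0.
  by case: val v0 => -> //= /eqP; rewrite oppr_eq0 => /eqP.
case: ks' red v0 {val} => [|k1 ks1] red.
  rewrite /= /powV; have := cheb_fst k'.
  case e : (cheb l k') => [a b] /= h; rewrite mulr1 mulr0 subr0 => a0.
  have [lt|ge] := ltnP k'.+1 q.
    by have := @cheb_pos k'.+1; rewrite lt => /(_ isT) /=; rewrite e a0 ltxx.
  have -> : k' = q.-1 by lia.
  by rewrite addn0; case: q q_even q_gt0 => //= n; rewrite negbK.
move=> v0; exfalso; have := wval_pos red => pos.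
have [k0|kn0] := posnP k'.
  move: v0; rewrite k0 -[wval 0 _]/(V 0 (invS (wval k1 ks1))) powV0 /= => /eqP.
  by rewrite oppr_eq0 => /eqP e; rewrite e mulr0 ltxx in pos.
have : 0 < (wval k' (k1 :: ks1)).1 * (wval k' (k1 :: ks1)).2.
  apply: powV_quadrant_prod; first by rewrite kn0.
  by rewrite /= mulNr oppr_lt0 mulrC.
by rewrite v0 mul0r ltxx.
Qed.

Inductive hecke_orbit : R -> R -> Prop :=
| HeckeBase : hecke_orbit 1 0
| HeckeOppL x y : hecke_orbit x y -> hecke_orbit (- x) y
| HeckeOppR x y : hecke_orbit x y -> hecke_orbit x (- y)
| HeckeL x y : hecke_orbit x y -> hecke_orbit (x + l * y) y
| HeckeR x y : hecke_orbit x y -> hecke_orbit x (y + l * x).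

Definition even_word (z : R * R) : Prop := exists k ks,
  ~~ odd (wpar k ks) /\ pm z (wval k ks).

(** Up to sign the two shears are $VS$ and $V^{q-1}S$, with inverses $SV^{q-1}$ and $SV$; all four
    have even length. *)
Lemma even_word_shear x y : even_word (x, y) ->
  [/\ even_word (x + l * y, y), even_word (x - l * y, y),
      even_word (x, y + l * x) & even_word (x, y - l * x)].
Proof.
have oq1 : odd q.-1 by case: q q_even q_gt0 => //= n; rewrite negbK.
case=> k [ks [par val]]; split.
- exists 1%N, (k :: ks); split; first by rewrite /= negbK.
  rewrite /wval -/wval; apply: pm_trans (pm_powV _ (pm_invS val)).
  by right; rewrite /powV /invS /=; congr (_, _); ring.
- exists 0%N, ((q.-1 + k)%N :: ks); split.
    by rewrite /= wparD ?add0n /= oddD oq1 /= negbK par.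
  rewrite /wval -/wval -wvalD powV0.
  apply: pm_trans (pm_invS (pm_powV _ val)).
  by right; rewrite /powV cheb_pred /invS /=; congr (_, _); ring.
- exists q.-1, (k :: ks); split; first by rewrite /= oddD /= oq1 par.
  rewrite /wval -/wval; apply: pm_trans (pm_powV _ (pm_invS val)).
  by right; rewrite /powV cheb_pred /invS /=; congr (_, _); ring.
- exists 0%N, (k.+1 :: ks); split.
    by rewrite -add1n /= wparD ?add0n /= ?negbK.
  rewrite /wval -/wval -[k.+1]add1n -wvalD powV0.
  apply: pm_trans (pm_invS (pm_powV _ val)).
  by right; rewrite /powV /invS /=; congr (_, _); ring.
Qed.

(** Changing one sign has determinant $-1$ and is no word, but it conjugates each shear to its
    inverse. The orbit is therefore followed up to one such reflection. *)
Lemma hecke_orbit_word x y : hecke_orbit x y ->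
  even_word (x, y) \/ even_word (x, - y).
Proof.
have opp u v : even_word (u, v) -> even_word (- u, - v).
  move=> [k [ks [par val]]]; exists k, ks; split => //.
  by apply: pm_trans val; right.
elim=> {x y} [|x y _ [] h|x y _ [] h|x y _ [] h|x y _ [] h].
- by left; exists 0%N, [::]; split => //; rewrite /= powV0; left.
- by right; apply: opp.
- by left; rewrite -[y]opprK; apply: opp.
- by right; rewrite opprK.
- by left.
- by left; have [] := even_word_shear h.
- by right; have [_] := even_word_shear h; rewrite mulrN opprK.
- by left; have [] := even_word_shear h.
- by right; have [_ _ _] := even_word_shear h; rewrite -opprD.
Qed.

Lemma hecke_orbit_neq0 x y : hecke_orbit x y -> x <> 0.
Proof.
move=> /hecke_orbit_word; case=> -[k [ks [/negP par val]]] x0; apply: par; apply: wval_axis.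
  by case: val => /(congr1 fst) /=; rewrite x0 => h; lra.
by case: val => /(congr1 fst) /=; rewrite x0 => h; lra.
Qed.

End HeckeOrbit.

(** * Affine runs along lines of rational slope *)

Definition affine_step (F : fieldType) (w : F) (e : bool) (y : F) : F :=
  (if e then w else w^-1) * y + 1.

Fixpoint affine_run (F : fieldType) (w : F) (e : nat -> bool) n (y : F) : F :=
  if n is n'.+1 then affine_step w (e n) (affine_run w e n' y) else y.

(** The exponent of [w] in the linear part of the affine map [affine_run]. *)
Fixpoint height (e : nat -> bool) n : int :=
  if n is n'.+1 then height e n' + (if e n then 1 else - 1) else 0.

(* The parity of the floor of [t * S / T]: the sides on which a line of slope
   [T / S] crosses the horizontal lines of the lattice. *)
Definition slope_sign (S T : int) (t : nat) : bool :=
  ~~ odd `|(t%:Z * S %/ T)%Z|%N.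

Section Runs.
Variable F : fieldType.
Implicit Types (w y z : F) (e : nat -> bool).

Lemma affine_runE w e n y z : w != 0 ->
  affine_run w e n y - affine_run w e n z = w ^ height e n * (y - z).
Proof.
move=> w0; elim: n => [|n IH] /=; first by rewrite expr0z mul1r.
rewrite /affine_step opprD addrACA subrr addr0 -mulrBr IH expfzDr //.
by case: (e n.+1); rewrite ?exprN1 ?expr1z mulrCA mulrA.
Qed.

Lemma affine_run_eq w e e' n y :
  (forall t, (0 < t <= n)%N -> e t = e' t) -> affine_run w e n y = affine_run w e' n y.
Proof.
elim: n => //= n IH ee; rewrite ee ?ltnSn // IH // => t /andP[t0 tn].
by apply: ee; rewrite t0 ltnW.
Qed.

Lemma height_eq e e' n :
  (forall t, (0 < t <= n)%N -> e t = e' t) -> height e n = height e' n.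
Proof.
elim: n => //= n IH ee; rewrite ee ?ltnSn // IH // => t /andP[t0 tn].
by apply: ee; rewrite t0 ltnW.
Qed.

Lemma affine_run_cat w e n1 n2 y :
  affine_run w e (n1 + n2) y =
  affine_run w (fun t => e (n1 + t)%N) n2 (affine_run w e n1 y).
Proof. by elim: n2 => [|n2 IH]; rewrite ?addn0 // addnS /= IH addnS. Qed.

Lemma height_cat e n1 n2 :
  height e (n1 + n2) = height e n1 + height (fun t => e (n1 + t)%N) n2.
Proof. by elim: n2 => [|n2 IH]; rewrite ?addn0 ?addr0 // addnS /= IH addnS addrA. Qed.

Lemma affine_runV w e n y :
  affine_run w^-1 e n y = affine_run w (fun t => ~~ e t) n y.
Proof. by elim: n => //= n ->; rewrite /affine_step invrK; case: (e n.+1). Qed.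

Lemma height_neg e n : height (fun t => ~~ e t) n = - height e n.
Proof. by elim: n => [|n IH] /=; rewrite ?oppr0 // IH opprD; case: (e n.+1); rewrite /= ?opprK. Qed.

End Runs.

Lemma slope_signE (S T : int) t q : 0 < T -> q * T <= t%:Z * S < (q + 1) * T ->
  slope_sign S T t = ~~ odd `|q|%N.
Proof.
move=> T0 /andP[lo hi]; rewrite /slope_sign; congr (~~ odd `|_|%N).
have -> : t%:Z * S = q * T + (t%:Z * S - q * T) by ring.
rewrite divzMDl ?gt_eqF // divz_small ?addr0 //; apply/andP; split; lia.
Qed.

Lemma slope_sign_ex (S T : int) t : 0 < T -> exists q, q * T <= t%:Z * S < (q + 1) * T.
Proof.
move=> T0; exists (t%:Z * S %/ T)%Z.
have := divz_eq (t%:Z * S) T; have := modz_ge0 (t%:Z * S) (lt0r_neq0 T0) => ge0.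
by have := ltz_pmod (t%:Z * S) T0 => lt e; nia.
Qed.

Lemma odd_absD (a b : int) : odd `|(a + b)%R|%N = odd `|a|%N (+) odd `|b|%N.
Proof. lia. Qed.

(** * Splitting a line of rational slope at a Farey mediant *)

Section Splitting.
Variables (S1 T1 S2 T2 d : int).
Hypotheses (T1_gt0 : 0 < T1) (T2_gt0 : 0 < T2) (d_unit : d = 1 \/ d = - 1).
Hypothesis detE : S1 * T2 - S2 * T1 = d.

(** The number $tS_1/T_1$ is not an integer, hence at least $1/T_1$ away from the integers. Passing
    to the mediant moves it by $t/(T_1(T_1+T_2))$, which is less. *)
Lemma slope_sign_left t : (0 < t)%N -> t%:Z < T1 ->
  slope_sign (S1 + S2) (T1 + T2) t = slope_sign S1 T1 t.
Proof.
move=> t0 tT1; have [q /andP[lo hi]] := slope_sign_ex S1 t T1_gt0.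
rewrite (@slope_signE S1 T1 t q) ?lo //; apply: slope_signE; first lia.
have ne : t%:Z * S1 - q * T1 != 0.
  apply/eqP => e; have e1 : t%:Z * d = T1 * (q * T2 - t%:Z * S2) by rewrite -detE; nia.
  have : (q * T2 - t%:Z * S2 <= -1) \/ (q * T2 - t%:Z * S2 = 0) \/ (1 <= q * T2 - t%:Z * S2) by lia.
  by case: d_unit e1 => ->; nia.
have r1 : 1 <= t%:Z * S1 - q * T1 <= T1 - 1 by lia.
have e1 : (t%:Z * (S1 + S2) - q * (T1 + T2)) * T1 =
   (t%:Z * S1 - q * T1) * (T1 + T2) - t%:Z * d by rewrite -detE; ring.
case: d_unit e1 => -> e1; apply/andP; split; nia.
Qed.

Lemma slope_sign_right t : (0 < t)%N -> t%:Z < T2 ->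
  slope_sign (S1 + S2) (T1 + T2) (`|T1|%N + t) = slope_sign S2 T2 t (+) odd `|S1|%N.
Proof.
move=> t0 tT2; have [q /andP[lo hi]] := slope_sign_ex S2 t T2_gt0.
rewrite (@slope_signE S2 T2 t q) ?lo // addNb -odd_absD.
have -> : ~~ odd `|(q + S1)%R|%N = ~~ odd `|(S1 + q)%R|%N by rewrite addrC.
apply: slope_signE; first lia.
have ne : t%:Z * S2 - q * T2 != 0.
  apply/eqP => e; have e1 : t%:Z * d = T2 * (t%:Z * S1 - q * T1) by rewrite -detE; nia.
  have : (t%:Z * S1 - q * T1 <= -1) \/ (t%:Z * S1 - q * T1 = 0) \/ (1 <= t%:Z * S1 - q * T1) by lia.
  by case: d_unit e1 => ->; nia.
have r1 : 1 <= t%:Z * S2 - q * T2 <= T2 - 1 by lia.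
have -> : (`|T1|%N + t)%:Z = T1 + t%:Z by lia.
have e1 : ((T1 + t%:Z) * (S1 + S2) - (S1 + q) * (T1 + T2)) * T2 =
   (t%:Z * S2 - q * T2) * (T1 + T2) - d * (T2 - t%:Z) by rewrite -detE; ring.
case: d_unit e1 => -> e1; apply/andP; split; nia.
Qed.

(** At $t=T_1$ the line has height $S_1 - d/(T_1+T_2)$, just below or just above a lattice point
    according to [d]. *)
Lemma slope_sign_mid :
  slope_sign (S1 + S2) (T1 + T2) `|T1|%N = (d == 1) (+) ~~ odd `|S1|%N.
Proof.
have e1 : `|T1|%N%:Z * (S1 + S2) = S1 * (T1 + T2) - d by rewrite -detE; nia.
case: d_unit e1 => dE e1.
  rewrite (@slope_signE _ _ _ (S1 - 1)) ?dE /=; first 1 last.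
  - lia.
  - by rewrite e1 dE; apply/andP; split; lia.
  - by rewrite odd_absD /= addbT.
rewrite (@slope_signE _ _ _ S1) ?dE //=; first lia.
by rewrite e1 dE; apply/andP; split; lia.
Qed.

Variable F : fieldType.

(** Only the crossings strictly between two lattice points of the line count, hence the predecessor
    of [T]. *)
Definition line_run (w : F) (S T : int) (y : F) :=
  affine_run w (slope_sign S T) `|T|.-1 y.
Definition line_height (S T : int) := height (slope_sign S T) `|T|.-1.

(** An odd [S1] shifts the second part by an odd height, which flips all its signs and so inverts
    [w]. The middle sign is given explicitly because later two splittings are compared and must
    share it. *)
Lemma line_split : exists e : bool, e = (d == 1) (+) ~~ odd `|S1|%N /\
  (forall (w y : F), line_run w (S1 + S2) (T1 + T2) y =
     line_run (if odd `|S1|%N then w^-1 else w) S2 T2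
       (affine_step w e (line_run w S1 T1 y))) /\
  line_height (S1 + S2) (T1 + T2) = line_height S1 T1 + (if e then 1 else - 1) +
    (if odd `|S1|%N then - line_height S2 T2 else line_height S2 T2).
Proof.
eexists; split; first by [].
have nE : `|(T1 + T2)%R|%N.-1 = (`|T1|%N.-1 + 1 + `|T2|%N.-1)%N by lia.
have T1E : (`|T1|%N.-1 + 1)%N = `|T1|%N by lia.
split=> [w y|].
  rewrite /line_run nE affine_run_cat T1E -[in affine_run _ _ `|T1| _]T1E.
  rewrite affine_run_cat /= addn1 prednK; last lia.
  rewrite slope_sign_mid.
  have -> : affine_run w (slope_sign (S1 + S2) (T1 + T2)) `|T1|.-1 y =
            affine_run w (slope_sign S1 T1) `|T1|.-1 y.
    by apply: affine_run_eq => t tT; apply: slope_sign_left; lia.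
  set z := affine_step _ _ _.
  have -> : affine_run w (fun t => slope_sign (S1 + S2) (T1 + T2) (`|T1| + t)) `|T2|.-1 z =
     affine_run w (fun t => slope_sign S2 T2 t (+) odd `|S1|) `|T2|.-1 z.
    by apply: affine_run_eq => t tT; apply: slope_sign_right; lia.
  case: (odd `|S1|) z => z; last by apply: affine_run_eq => t _; rewrite addbF.
  by rewrite affine_runV; apply: affine_run_eq => t _; rewrite addbT.
rewrite /line_height nE height_cat T1E -[in height _ `|T1|]T1E height_cat /= addn1 prednK; last lia.
rewrite slope_sign_mid add0r; congr (_ + _ + _).
  by apply: height_eq => t tT; apply: slope_sign_left; lia.
transitivity (height (fun t => slope_sign S2 T2 t (+) odd `|S1|) `|T2|.-1).
  by apply: height_eq => t tT; apply: slope_sign_right; lia.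
case: (odd `|S1|); last by apply: height_eq => t _; rewrite addbF.
by rewrite -height_neg; apply: height_eq => t _; rewrite addbT.
Qed.

End Splitting.

(** * Recurrences for the values of runs along lines *)

Section OneRoot.
Variables (F : fieldType) (t : F).
Hypothesis t_neq0 : t != 0.

(** With [t] a square root of [w], dividing by the power [t ^ line_height] makes the recurrences
    symmetric in [t] and its inverse. *)
Definition line_value (S T : int) (a : F) :=
  line_run (t ^+ 2) S T 1 = t ^ line_height S T * a.

Lemma exprz_sqr (k : int) : (t ^+ 2) ^ k = (t ^ k) ^+ 2.
Proof. by rewrite !exprnP !exprz_exp mulrC. Qed.

Lemma line_runB S T y z : line_run (t ^+ 2) S T y - line_run (t ^+ 2) S T z =
  (t ^ line_height S T) ^+ 2 * (y - z).
Proof. by rewrite /line_run affine_runE ?expf_neq0 // exprz_sqr. Qed.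

Lemma exprz_unit_sum (c : int) : c = 1 \/ c = - 1 -> t ^ c + (t ^ c)^-1 = t + t^-1.
Proof. by case=> ->; rewrite ?expr1z ?exprN1 ?invrK // addrC. Qed.

(** Both $S/T$ and $(2S-S')/(2T-T')$ begin with $(S-S')/(T-T')$, followed by $S'/T'$ and by $S/T$
    respectively. The even numerator $S-S'$ causes no inversion of [w], and eliminating the common
    value [x] gives the recurrence. *)
Lemma line_value_reflect S T S' T' a b : 0 < T' -> T' < T ->
  odd `|S|%N -> odd `|S'|%N ->
  S' * T - S * T' = 1 \/ S' * T - S * T' = - 1 ->
  line_height S T - line_height S' T' = 1 \/ line_height S T - line_height S' T' = - 1 ->
  line_value S' T' a -> line_value S T b ->
  line_height (2 * S - S') (2 * T - T') = 2 * line_height S T - line_height S' T' /\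
  line_value (2 * S - S') (2 * T - T') ((t + t^-1) * b - a).
Proof.
move=> T'0 T'T oS oS' det hh va vb.
have oX : odd `|(S - S')%R|%N = false by lia.
have X0 : 0 < T - T' by lia.
have T0 : 0 < T by lia.
have dX : (S - S') * T' - S' * (T - T') = - (S' * T - S * T') by ring.
have dX' : (S - S') * T - S * (T - T') = - (S' * T - S * T') by ring.
have du : - (S' * T - S * T') = 1 \/ - (S' * T - S * T') = - 1 by lia.
have [e [eE [run1 h1]]] := line_split X0 T'0 du dX F.
have [e' [eE' [run2 h2]]] := line_split X0 T0 du dX' F.
rewrite -eE in eE'; rewrite {e'}eE' in run2 h2; rewrite oX in run1 run2 h1 h2.
rewrite subrK in run1 h1.
have hE : line_height (2 * S - S') (2 * T - T') = 2 * line_height S T - line_height S' T'.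
  have -> : 2 * S - S' = S - S' + S by ring.
  have -> : 2 * T - T' = T - T' + T by ring.
  by rewrite h2; move: h1; rewrite subrK; lia.
split=> //; rewrite /line_value hE.
have -> : 2 * S - S' = S - S' + S by ring.
have -> : 2 * T - T' = T - T' + T by ring.
rewrite run2; move: (run1 (t ^+ 2) 1); rewrite subrK.
set x := affine_step _ _ _ => eqx.
have e1 := line_runB S T x 1; have e2 := line_runB S' T' x 1.
rewrite -eqx vb va in e2; rewrite vb in e1.
have [k kE] : exists k, line_height S T = line_height S' T' + k.
  by exists (line_height S T - line_height S' T'); ring.
have := @exprz_unit_sum k; rewrite kE addrAC subrr add0r in hh.
move=> /(_ hh); move: hE e1 e2; rewrite !kE.
have -> : 2 * (line_height S' T' + k) - line_height S' T' = line_height S' T' + k + k by ring.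
rewrite !(expfzDr _ _ t_neq0) => _; move: (expfz_neq0 k t_neq0).
move: (expfz_neq0 (line_height S' T') t_neq0).
move: (t ^ line_height S' T') (t ^ k) => p s p0 s0 e1 e2 <-.
have {}e2 : p ^+ 2 * (x - 1) = p * s * b - p * a by rewrite e2.
have -> : line_run (t ^+ 2) S T x = (p * s) ^+ 2 * (x - 1) + p * s * b by rewrite -e1; ring.
by rewrite exprMn mulrAC e2; field.
Qed.

End OneRoot.

Section OneRootShift.
Variables (F : fieldType) (t : F).
Hypothesis t_neq0 : t != 0.

(** The line splits into $S'/T'$, $S/T$, $S'/T'$. Since $S'$ is odd, the middle part runs with [w]
    inverted, hence the value at [t^-1] in the hypothesis; after the even height $S'+S$ the last
    part is unchanged. *)
Lemma line_value_shift S T S' T' a b : 0 < T -> 0 < T' ->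
  odd `|S|%N -> odd `|S'|%N ->
  S * T' - S' * T = 1 \/ S * T' - S' * T = - 1 ->
  line_height S' T' - line_height S T = S * T' - S' * T ->
  line_value t^-1 S T a -> line_value t S' T' b ->
  line_height (S + 2 * S') (T + 2 * T') - line_height S' T' = S' * T - S * T' /\
  line_value t (S + 2 * S') (T + 2 * T') ((t + t^-1) * b + a).
Proof.
move=> T0 T'0 oS oS' det hh va vb.
have oX : odd `|(S' + S)%R|%N = false by lia.
have X0 : 0 < T' + T by lia.
have dX : S' * T - S * T' = - (S * T' - S' * T) by ring.
have dX' : (S' + S) * T' - S' * (T' + T) = S * T' - S' * T by ring.
have du : - (S * T' - S' * T) = 1 \/ - (S * T' - S' * T) = - 1 by lia.
have [e [eE [run1 h1]]] := line_split T'0 T0 du dX F.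
have [e' [eE' [run2 h2]]] := line_split X0 T'0 det dX' F.
have {}eE : e = (S' * T - S * T' == 1) by rewrite eE oS' addbF; lia.
have {}eE' : e' = e by rewrite eE' oX eE; lia.
rewrite {e'}eE' in run2 h2; rewrite oX in run2 h2; rewrite oS' in run1 h1.
have SE : S + 2 * S' = S' + S + S' by ring.
have TE : T + 2 * T' = T' + T + T' by ring.
have hE : line_height (S + 2 * S') (T + 2 * T') - line_height S' T' = S' * T - S * T'.
  have sE : (if e then 1 else - 1 : int) = S' * T - S * T' by rewrite eE; case: eqP; lia.
  by rewrite SE TE h2 h1 sE; lia.
split=> //; rewrite /line_value.
have -> : line_height (S + 2 * S') (T + 2 * T') = line_height S' T' + (S' * T - S * T') by lia.
rewrite SE TE run2 run1.
set x := affine_step _ e (line_run (t ^+ 2) S' T' 1).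
set y := line_run (t ^+ 2)^-1 S T x.
have e1 := line_runB t_neq0 S' T' (affine_step (t ^+ 2) e y) 1.
have e2 := line_runB (invr_neq0 t_neq0) S T x 1.
rewrite va exprVn -/y in e2; rewrite vb in e1.
have -> : line_run (t ^+ 2) S' T' (affine_step (t ^+ 2) e y) =
  (t ^ line_height S' T') ^+ 2 * (affine_step (t ^+ 2) e y - 1) + t ^ line_height S' T' * b.
  by rewrite -e1; ring.
have h3 : line_height S' T' = line_height S T - (S' * T - S * T') by lia.
have := exprz_unit_sum t (c := S' * T - S * T').
rewrite exprz_inv in e2.
have xE : x - 1 = (if e then t ^+ 2 else (t ^+ 2)^-1) * (t ^ line_height S' T' * b).
  by rewrite /x /affine_step addrK vb.
rewrite xE in e2.
have -> : affine_step (t ^+ 2) e y - 1 = (if e then t ^+ 2 else (t ^+ 2)^-1) * y by rewrite /affine_step addrK.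
have -> : (if e then t ^+ 2 else (t ^+ 2)^-1) = (t ^ (S' * T - S * T')) ^+ 2.
  rewrite eE; have [->|->] : S' * T - S * T' = 1 \/ S' * T - S * T' = -1 by lia.
    by rewrite expr1z.
  by rewrite exprN1 exprVn.
move: e2; have -> : (if e then t ^+ 2 else (t ^+ 2)^-1) = (t ^ (S' * T - S * T')) ^+ 2.
  rewrite eE; have [->|->] : S' * T - S * T' = 1 \/ S' * T - S * T' = -1 by lia.
    by rewrite expr1z.
  by rewrite exprN1 exprVn.
move=> e2 /(_ ltac:(lia)).
move: e2; rewrite h3; move: (S' * T - S * T') => d.
rewrite !expfzDr // -!invr_expz.
move: (expfz_neq0 (line_height S T) t_neq0) (expfz_neq0 d t_neq0).
move: (t ^ line_height S T) (t ^ d) => p s p0 s0 e2 <-.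
have -> : y = p^-1 ^+ 2 * (s ^+ 2 * (p * s^-1 * b)) + p^-1 * a by rewrite -e2; ring.
by field; rewrite p0 s0.
Qed.

End OneRootShift.

(** * Euclid's algorithm on the slope *)

Section Euclid.
Variables (R : realFieldType) (F : fieldType) (iota : {rmorphism R -> F}) (l : R) (t : F).
Hypotheses (t_neq0 : t != 0) (tE : t + t^-1 = iota l).

(** Both square roots must give one value in the real subfield, because the shift recurrence mixes
    the values at [t] and at [t^-1]. *)
Definition line_real S T (a : R) : Prop :=
  line_value t S T (iota a) /\ line_value t^-1 S T (iota a).

(** The value for the odd denominator is the first coordinate of the Hecke orbit. Exactly one of the
    two denominators is odd when the numerators are odd and the determinant is $\pm1$. *)
Definition line_pair S T S' T' : Prop :=
  line_height S' T' - line_height S T = S * T' - S' * T /\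
  exists a b, [/\ line_real S T a, line_real S' T' b &
    if odd `|T|%N then hecke_orbit l a b else hecke_orbit l b a].

Lemma line_pair_sym S T S' T' : odd `|T|%N != odd `|T'|%N ->
  line_pair S T S' T' -> line_pair S' T' S T.
Proof.
move=> par [h [a [b [va vb o]]]]; split; first by lia.
exists b, a; split=> //; move: par o.
by case: (odd `|T|); case: (odd `|T'|).
Qed.

Lemma euclid_parity S T S' T' : odd `|S|%N -> odd `|S'|%N ->
  S * T' - S' * T = 1 \/ S * T' - S' * T = - 1 -> odd `|T|%N != odd `|T'|%N.
Proof.
move=> oS oS' det.
have : odd `|(S * T' - S' * T)%R|%N by case: det => ->.
by rewrite odd_absD abszN !abszM !oddM oS oS' /=; case: (odd `|T|); case: (odd `|T'|).
Qed.

Lemma line_base S : odd `|S|%N -> line_height S 1 = 0 /\ line_real S 1 1.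
Proof. by move=> oS; split=> //; split; rewrite /line_value /= expr0z rmorph1 mulr1. Qed.

Lemma line_pair_base S S' : odd `|S|%N -> odd `|S'|%N ->
  S - S' * 2 = 1 \/ S - S' * 2 = - 1 -> line_pair S 2 S' 1.
Proof.
move=> oS oS' det.
have [h1 v1] := line_base oS'.
have sE : slope_sign S 2 1 = (S - S' * 2 == - 1).
  case: det => dE; rewrite dE.
    by rewrite (@slope_signE _ _ _ S') ?oS' //; apply/andP; split; lia.
  by rewrite (@slope_signE _ _ _ (S' - 1)) ?odd_absD ?oS' //; apply/andP; split; lia.
have hE : line_height S 2 = - (S - S' * 2).
  by rewrite /line_height /= sE add0r; case: det => ->.
split; first by rewrite h1 hE; lia.
exists l, 1; split=> //; last by have := HeckeR (HeckeBase l); rewrite add0r mulr1.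
have e2 (u : F) : u != 0 -> u ^+ 2 + 1 = u * (u + u^-1) by move=> u0; rewrite mulrDr divff // expr2.
split; rewrite /line_value hE -tE /line_run /= sE /affine_step mulr1.
  case: det => ->; rewrite /= ?opprK ?exprN1 ?expr1z.
    by rewrite -exprVn e2 ?invr_neq0 // invrK [t^-1 + t]addrC.
  by rewrite e2.
rewrite -exprVn invrK; case: det => ->; rewrite /= ?opprK ?exprN1 ?expr1z ?invrK.
  by rewrite e2.
by rewrite e2 ?invr_neq0 // invrK [t^-1 + t]addrC.
Qed.

Lemma line_real_reflect S T S' T' a b : 0 < T' -> T' < T ->
  odd `|S|%N -> odd `|S'|%N ->
  S' * T - S * T' = 1 \/ S' * T - S * T' = - 1 ->
  line_height S T - line_height S' T' = 1 \/ line_height S T - line_height S' T' = - 1 ->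
  line_real S' T' a -> line_real S T b ->
  line_height (2 * S - S') (2 * T - T') = 2 * line_height S T - line_height S' T' /\
  line_real (2 * S - S') (2 * T - T') (l * b - a).
Proof.
move=> h1 h2 h3 h4 h5 h6 [v1 w1] [v2 w2].
have [hE v] := line_value_reflect t_neq0 h1 h2 h3 h4 h5 h6 v1 v2.
have [_ w] := line_value_reflect (invr_neq0 t_neq0) h1 h2 h3 h4 h5 h6 w1 w2.
split=> //; split; rewrite rmorphB rmorphM -tE //.
by rewrite invrK [t^-1 + t]addrC in w.
Qed.

Lemma line_real_shift S T S' T' a b : 0 < T -> 0 < T' ->
  odd `|S|%N -> odd `|S'|%N ->
  S * T' - S' * T = 1 \/ S * T' - S' * T = - 1 ->
  line_height S' T' - line_height S T = S * T' - S' * T ->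
  line_real S T a -> line_real S' T' b ->
  line_height (S + 2 * S') (T + 2 * T') - line_height S' T' = S' * T - S * T' /\
  line_real (S + 2 * S') (T + 2 * T') (l * b + a).
Proof.
move=> h1 h2 h3 h4 h5 h6 [v1 w1] [v2 w2].
have [hE v] := line_value_shift t_neq0 h1 h2 h3 h4 h5 h6 w1 v2.
have w1' : line_value t^-1^-1 S T (iota a) by rewrite invrK.
have [_ w] := line_value_shift (invr_neq0 t_neq0) h1 h2 h3 h4 h5 h6 w1' w2.
split=> //; split; rewrite rmorphD rmorphM -tE //.
by rewrite invrK [t^-1 + t]addrC in w.
Qed.

(** For $T>2T'$ the larger denominator drops by $2T'$, which [line_real_shift] undoes; for
    $T'<T<2T'$ it becomes $2T'-T$, which [line_real_reflect] undoes. Equality $T=2T'$ forces $T'=1$.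
    All numerators stay odd. *)
Lemma euclid n S T S' T' : (`|T| + `|T'| <= n)%N -> 0 < T -> 0 < T' ->
  odd `|S|%N -> odd `|S'|%N ->
  S * T' - S' * T = 1 \/ S * T' - S' * T = - 1 -> line_pair S T S' T'.
Proof.
elim: n S T S' T' => [|n IH] S T S' T' le T0 T'0 oS oS' det; first by lia.
wlog T'T : S T S' T' le T0 T'0 oS oS' det / T' < T.
  have par := euclid_parity oS oS' det.
  have [lt|gt|eq] := ltrgtP T' T; [exact| |by rewrite eq eqxx in par].
  by move/(_ S' T' S T) => w; apply: line_pair_sym; [rewrite eq_sym|apply: w => //; lia].
have par := euclid_parity oS oS' det.
have [lt|gt|eq] := ltrgtP T (2 * T'); last first.
- have T'1 : T' = 1.
    have e : (S - 2 * S') * T' = S * T' - S' * T by rewrite eq; ring.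
    have /eqP : (`|(S - 2 * S')%R| * `|T'|)%N = 1%N by rewrite -abszM e; case: det => ->.
    by rewrite muln_eq1 => /andP[_ /eqP]; lia.
  rewrite eq T'1; apply: line_pair_base => //; move: det; rewrite eq T'1; lia.
- have T20 : 0 < T - 2 * T' by lia.
  have oS2 : odd `|(S - 2 * S')%R|%N by lia.
  have det2 : (S - 2 * S') * T' - S' * (T - 2 * T') = S * T' - S' * T by ring.
  have [hE [a [b [va vb o]]]] : line_pair (S - 2 * S') (T - 2 * T') S' T'.
    by apply: IH => //; [lia|rewrite det2].
  have [|hE' va'] := line_real_shift T20 T'0 oS2 oS' _ hE va vb; first by rewrite det2.
  rewrite !subrK in hE' va'; split; first by lia.
  exists (l * b + a), b; split=> //.
  have -> : odd `|T| = odd `|(T - 2 * T')%R| by lia.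
  by case: (odd _) o => o; rewrite addrC; [apply: HeckeL|apply: HeckeR].
have T20 : 0 < 2 * T' - T by lia.
have T2T : 2 * T' - T < T' by lia.
have oS2 : odd `|(2 * S' - S)%R|%N by lia.
have det2 : S' * (2 * T' - T) - (2 * S' - S) * T' = S * T' - S' * T by ring.
have [hE [b [a [vb va o]]]] : line_pair S' T' (2 * S' - S) (2 * T' - T).
  by apply: IH => //; [lia|rewrite det2].
rewrite det2 in hE.
have d3 : (2 * S' - S) * T' - S' * (2 * T' - T) = - (S * T' - S' * T) by ring.
have [||hE' va'] := line_real_reflect T20 T2T oS' oS2 _ _ va vb; [by lia|by lia|].
have SE : 2 * S' - (2 * S' - S) = S by ring.
have TE : 2 * T' - (2 * T' - T) = T by ring.
rewrite SE TE in hE' va'; split; first by lia.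
exists (l * b - a), b; split=> //; rewrite addrC.
have -> : odd `|T| = ~~ odd `|T'| by move: par; case: (odd `|T|); case: (odd `|T'|).
case: (odd `|T'|) o => /= o; first exact/HeckeR/HeckeOppR.
exact/HeckeL/HeckeOppL.
Qed.

Variable q : nat.
Hypotheses (q_even : ~~ odd q) (q_gt0 : (0 < q)%N).
Hypothesis cheb_pos : forall k, (0 < k < q)%N -> 0 < (cheb l k).2.
Hypothesis cheb_q : (cheb l q).2 = 0.

(** Some Farey neighbour of $S/T$ has an odd numerator; since [T] is odd, the value of $S/T$ is then
    the first coordinate of a vector in the Hecke orbit. *)
Lemma line_run_neq0 S T : 1 < T -> odd `|S|%N -> odd `|T|%N -> coprimez S T ->
  line_run (t ^+ 2) S T 1 != 0.
Proof.
move=> T1 oS oT /coprimezP [[u v] /= uv].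
suff [S' [T' [T'0 oS' det]]] : exists S' T', [/\ 0 < T', odd `|S'|%N &
   S * T' - S' * T = 1 \/ S * T' - S' * T = - 1].
  have T0 : 0 < T by lia.
  have [_ [a [b [[va _] _]]]] := euclid (leqnn _) T0 T'0 oS oS' det.
  rewrite oT => /(hecke_orbit_neq0 q_even q_gt0 cheb_pos cheb_q) a0.
  rewrite va mulf_neq0 ?expfz_neq0 // fmorph_eq0; exact/eqP.
have uE := divz_eq u T; set k := (u %/ T)%Z in uE; set m := (u %% T)%Z in uE.
have m0 : 0 <= m by apply: modz_ge0; lia.
have mT : m < T by apply: ltz_pmod; lia.
have e1 : S * m - (- v - k * S) * T = 1 by rewrite -uv uE; ring.
have mn0 : m != 0.
  apply/eqP => mz; have /eqP : (`|(v + k * S)%R| * `|T|)%N = 1%N.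
    by rewrite -abszM; have -> : (v + k * S) * T = 1 by rewrite -e1 mz; ring.
  by rewrite muln_eq1 => /andP[_ /eqP]; lia.
(* The neighbour found by Bezout has an odd numerator when its denominator [m] is even; otherwise
   the complementary fraction with denominator $T-m$ has one. *)
have [om|em] := boolP (odd `|m|%N); last first.
  exists (- v - k * S), m; split; [lia| |by left].
  have : odd `|(S * m - (- v - k * S) * T)%R|%N by rewrite e1.
  by rewrite odd_absD abszN !abszM !oddM oS oT (negbTE em) /= andbT.
exists (S - (- v - k * S)), (T - m); split; first by lia.
  have h : odd `|(S * m - (- v - k * S) * T)%R|%N by rewrite e1.
  rewrite odd_absD abszN !abszM !oddM oS oT om /= andbT in h.
  by rewrite odd_absD abszN oS; case: (odd _) h.
by right; rewrite -e1; ring.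
Qed.

End Euclid.

(** * Galois conjugation and the angle *)

Section Conjugation.
Variables (F : numFieldType) (n : nat).

Lemma map_ratr_int (p : {poly int}) :
  map_poly (ratr : rat -> F) (map_poly intr p) = map_poly intr p.
Proof. by rewrite -map_poly_comp; apply: eq_map_poly => a /=; rewrite ratr_int. Qed.

Lemma root_Cyclotomic (z : F) :
  n.-primitive_root z -> root (map_poly intr (Cyclotomic n)) z.
Proof.
move=> prim_z; have n0 := prim_order_gt0 prim_z.
have : root (map_poly intr (\prod_(d <- divisors n) Cyclotomic d)) z.
  rewrite prod_Cyclotomic // rmorphB rmorph1 /= map_polyXn rootE !hornerE.
  by rewrite ?hornerXn prim_expr_order // subrr.
rewrite rmorph_prod /= rootE horner_prod prodf_seq_eq0 => /hasP[d d_dv /= rd].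
move: d_dv; rewrite -dvdn_divisors // => d_dv.
suff <- : d = n by [].
have d0 := dvdn_gt0 n0 d_dv.
have : root (map_poly intr ('X^d - 1 : {poly int})) z.
  rewrite -prod_Cyclotomic // (big_rem d) /=; last by rewrite -dvdn_divisors.
  by rewrite rmorphM rootE hornerM (eqP rd) mul0r.
rewrite rmorphB rmorph1 /= map_polyXn rootE !hornerE ?hornerXn subr_eq0.
rewrite -(prim_order_dvd prim_z) => n_dv.
by apply/eqP; rewrite eqn_dvd d_dv.
Qed.

(** A factor of positive degree has a root among the algebraic numbers. That root is a primitive
    [n]-th root of unity, so its minimal polynomial is the cyclotomic one and divides the factor. *)
Lemma Cyclotomic_irreducible (g : {poly rat}) : (0 < n)%N ->
  g %| map_poly intr (Cyclotomic n) -> size g != 1%N -> map_poly intr (Cyclotomic n) %| g.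
Proof.
move=> n0 g_dv sg.
have [z prim_z] := C_prim_root_exists n0.
have /closed_rootP[w rw] : size (map_poly (ratr : rat -> algC) g) != 1%N by rewrite size_map_poly.
have QC : map_poly (ratr : rat -> algC) (map_poly intr (Cyclotomic n)) = map_poly intr (Cyclotomic n).
  by rewrite -map_poly_comp; apply: eq_map_poly => a /=; rewrite ratr_int.
have prim_w : n.-primitive_root w.
  rewrite -(root_cyclotomic prim_z) -(Cintr_Cyclotomic prim_z) -QC.
  by move: rw; rewrite -!dvdp_XsubCl => /dvdp_trans; apply; rewrite dvdp_map.
have [p [pE _] p_root] := minCpolyP w.
suff <- : p = map_poly intr (Cyclotomic n) by rewrite -p_root.
apply: (map_poly_inj (ratr : {rmorphism rat -> algC})).
by rewrite -pE QC (minCpoly_cyclotomic prim_w) (Cintr_Cyclotomic prim_w).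
Qed.

(** The rational gcd of [p] with the cyclotomic polynomial vanishes at [z1], so it is not constant
    and irreducibility makes it the whole cyclotomic polynomial. *)
Lemma primitive_root_conj (z1 z2 : F) (p : {poly int}) :
  n.-primitive_root z1 -> n.-primitive_root z2 ->
  root (map_poly intr p) z1 -> root (map_poly intr p) z2.
Proof.
move=> prim1 prim2 r1; have n0 := prim_order_gt0 prim1.
pose pQ : {poly rat} := map_poly intr p.
pose phi : {poly rat} := map_poly intr (Cyclotomic n).
have rg : root (map_poly (ratr : rat -> F) (gcdp pQ phi)) z1.
  by rewrite gcdp_map root_gcd !map_ratr_int r1 root_Cyclotomic.
have phi0 : phi != 0 by rewrite map_poly_eq0_id0 ?(monicP (Cyclotomic_monic n)) ?oner_eq0 ?monic_neq0 ?Cyclotomic_monic.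
have sg : size (gcdp pQ phi) != 1%N.
  apply/eqP => /eqP; rewrite -(size_map_poly (ratr : {rmorphism rat -> F})) => /eqP s1.
  have := root_size_gt1 _ rg; rewrite s1 ltnn => h; suff : false by [].
  by apply: h; rewrite -size_poly_eq0 s1.
have := Cyclotomic_irreducible n0 (dvdp_gcdr pQ phi) sg.
move=> /dvdp_trans /(_ (dvdp_gcdl pQ phi)).
rewrite -(dvdp_map (ratr : {rmorphism rat -> F})) !map_ratr_int => dv.
have := root_Cyclotomic prim2; rewrite -!dvdp_XsubCl => h.
exact: dvdp_trans h dv.
Qed.

End Conjugation.

(** Writing $w^{-1}$ as $w^{q-1}$ turns a run into an integer polynomial in [w], to which Galois
    conjugation applies. *)
Fixpoint run_poly (q : nat) (e : nat -> bool) n : {poly int} :=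
  if n is n'.+1 then (if e n then 'X else 'X^(q.-1)) * run_poly q e n' + 1 else 1.

Lemma run_polyE (F : fieldType) (z : F) q e n : (0 < q)%N -> z ^+ q = 1 ->
  (map_poly intr (run_poly q e n)).[z] = affine_run z e n 1.
Proof.
move=> q0 zq; elim: n => [|n IH] /=; first by rewrite rmorph1 hornerC.
rewrite rmorphD rmorphM rmorph1 /= hornerD hornerM hornerC IH /affine_step.
congr (_ * _ + 1); case: (e n.+1); first by rewrite map_polyX hornerX.
rewrite map_polyXn hornerXn; apply: (mulfI (x := z)).
  by apply: contra_eq_neq zq => ->; rewrite expr0n gtn_eqF // eq_sym oner_eq0.
rewrite -exprS prednK // zq divff //.
by apply: contra_eq_neq zq => ->; rewrite expr0n gtn_eqF // eq_sym oner_eq0.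
Qed.

Section Expi.
Variable R : realType.

Definition expi (a : R) : R[i] := Complex (cos a) (sin a).

Lemma expiD a b : expi (a + b) = expi a * expi b.
Proof. by rewrite /expi cosD sinD; apply/eqP; rewrite eq_complex /= eqxx addrC eqxx. Qed.

Lemma expi0 : expi 0 = 1.
Proof. by rewrite /expi cos0 sin0. Qed.

Lemma expiX a n : expi a ^+ n = expi (a *+ n).
Proof. by elim: n => [|n IH]; rewrite ?expr0 ?mulr0n ?expi0 // exprS IH mulrS expiD. Qed.

Lemma expi_neq0 a : expi a != 0.
Proof.
apply/eqP => e; have := cos2Dsin2 a.
by case: e => -> ->; rewrite expr0n addr0 => /eqP; rewrite eq_sym oner_eq0.
Qed.

Lemma expiN a : expi (- a) = (expi a)^-1.
Proof.
by apply: (mulfI (expi_neq0 a)); rewrite -expiD subrr expi0 divff // expi_neq0.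
Qed.

Lemma expi2pi : expi (pi *+ 2) = 1.
Proof. by rewrite /expi cos2pi sin2pi. Qed.

Lemma expi_neq1 a : 0 < a < pi *+ 2 -> expi a != 1.
Proof.
move=> /andP[a0 a2]; apply/eqP => -[c1 _].
have h : sin (a / 2) > 0.
  by apply: sin_gt0_pi; rewrite divr_gt0 // ltr_pdivrMr // mulr_natr.
have : cos ((a / 2) *+ 2) = 1 by rewrite -mulr_natr divfK ?pnatr_eq0.
rewrite cos_mulr2n cos2sin2 => e; have : sin (a / 2) ^+ 2 = 0 by lra.
by move=> /eqP; rewrite sqrf_eq0 gt_eqF.
Qed.

Lemma expi_primitive q : (0 < q)%N -> q.-primitive_root (expi (pi *+ 2 / q%:R)).
Proof.
move=> q0; have q0' : 0 < q%:R :> R by rewrite ltr0n.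
apply/andP; split=> //; apply/forallP => -[i iq] /=.
rewrite unity_rootE expiX; have [iE|ine] := eqVneq i.+1 q.
  by rewrite iE -[X in expi X]mulr_natr divfK ?lt0r_neq0 // expi2pi eqxx.
have pi2 : 0 < pi *+ 2 :> R by rewrite pmulrn_lgt0 // pi_gt0.
apply/eqP/negbTE/expi_neq1; rewrite -[_ *+ i.+1]mulr_natr mulrAC.
rewrite divr_gt0 ?mulr_gt0 ?ltr0n //=.
by rewrite ltr_pdivrMr // ltr_pM2l // ltr_nat ltn_neqAle ine.
Qed.

Lemma expi_conj_root q j (p : {poly int}) : (0 < q)%N -> coprime j q ->
  root (map_poly intr p) (expi (pi *+ 2 / q%:R) ^+ j) ->
  root (map_poly intr p) (expi (pi *+ 2 / q%:R)).
Proof.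
move=> q0 jq; have prim := expi_primitive q0.
by apply: (primitive_root_conj _ prim); rewrite prim_root_exp_coprime.
Qed.

Lemma cheb_cos (a : R) k :
  (cheb (cos a *+ 2) k).1 * sin a = sin (a *+ k.+1) /\
  (cheb (cos a *+ 2) k).2 * sin a = sin (a *+ k).
Proof.
elim: k => [|k [IH1 IH2]] /=; first by rewrite mul1r mul0r mulr1n mulr0n sin0.
case: (cheb _ k) IH1 IH2 => x y /= IH1 IH2; split=> //.
rewrite mulrBl IH2 -mulrA IH1 [a *+ k.+2]mulrSr sinD.
have -> : a *+ k = a *+ k.+1 - a by rewrite mulrSr addrK.
by rewrite sinB; ring.
Qed.

(** The square root $e^{i\pi/q}$ of [w] has trace $2\cos(\pi/q)$, and $\sin(k\pi/q)>0$ for $0<k<q$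
    is the positivity that ping-pong requires. *)
Lemma line_run_expi_neq0 q S T : (1 < q)%N -> ~~ odd q -> 1 < T ->
  odd `|S|%N -> odd `|T|%N -> coprimez S T ->
  line_run (expi (pi *+ 2 / q%:R)) S T 1 != 0.
Proof.
move=> q1 qe T1 oS oT co; have q0 : (0 < q)%N by lia.
have q0' : 0 < q%:R :> R by rewrite ltr0n.
pose a : R := pi / q%:R.
have -> : expi (pi *+ 2 / q%:R) = expi a ^+ 2 by rewrite expiX /a -mulrnAl.
have sin_pos k : (0 < k < q)%N -> 0 < sin (a *+ k).
  move=> /andP[k0 kq]; apply: sin_gt0_pi; rewrite pmulrn_lgt0 // divr_gt0 ?pi_gt0 //=.
  rewrite -mulr_natr /a mulrAC ltr_pdivrMr // ltr_pM2l ?pi_gt0 //.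
  by rewrite ltr_nat.
have sa : 0 < sin a by have := sin_pos 1%N; rewrite mulr1n; apply; rewrite q1.
apply: (@line_run_neq0 R R[i] (real_complex R) (cos a *+ 2) (expi a) _ _ q) => //.
- exact: expi_neq0.
- rewrite -expiN; apply/eqP; rewrite eq_complex /= cosN sinN.
  by rewrite subrr mulr2n !eqxx.
- move=> k kq; have := (cheb_cos a k).2 => e.
  by have := sin_pos k kq; rewrite -e pmulr_lgt0.
- have := (cheb_cos a q).2; rewrite -[a *+ q]mulr_natr divfK ?gt_eqF // sinpi.
  by move=> /eqP; rewrite mulf_eq0 (gt_eqF sa) orbF => /eqP.
Qed.

Lemma line_run1 (S T : int) : line_run (1 : R[i]) S T 1 != 0.
Proof.
rewrite /line_run; elim: `|T|%N.-1 => [|n IH] /=; rewrite ?oner_eq0 //.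
rewrite /affine_step invr1.
suff : affine_run (1 : R[i]) (slope_sign S T) n 1 = n.+1%:R.
  by case: (slope_sign S T n.+1) => ->; rewrite mul1r natr1 pnatr_eq0.
elim: n {IH} => //= n ->; rewrite /affine_step invr1.
by case: (slope_sign S T n.+1); rewrite mul1r natr1.
Qed.

Theorem line_run_root_of_unity M (S T : int) : (1 < M)%N -> 1 < T ->
  odd `|S|%N -> odd `|T|%N -> coprimez S T ->
  line_run (- expi (pi *+ 2 / M%:R)) S T 1 = 0 ->
  exists2 n, M = n.*2 & (3 <= n)%N && odd n.
Proof.
move=> M1 T1 oS oT co run0.
have M0 : 0 < M%:R :> R by rewrite ltr0n; lia.
have conj q j : (1 < q)%N -> ~~ odd q -> coprime j q ->
    - expi (pi *+ 2 / M%:R) = expi (pi *+ 2 / q%:R) ^+ j -> False.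
  move=> q1 qe jq E.
  have q0 : (0 < q)%N by lia.
  have zq : expi (pi *+ 2 / q%:R) ^+ q = 1 by apply/prim_expr_order/expi_primitive.
  have := @expi_conj_root q j (run_poly q (slope_sign S T) `|T|.-1) q0 jq.
  have zj : (- expi (pi *+ 2 / M%:R)) ^+ q = 1.
    by rewrite E -exprM mulnC exprM zq expr1n.
  rewrite -E !rootE !run_polyE //.
  rewrite -[affine_run _ _ _ _]/(line_run _ S T 1) run0 eqxx => /(_ isT).
  by apply/negP; apply: line_run_expi_neq0.
have expiDpi (a : R) : - expi a = expi (a + pi).
  by rewrite /expi cosDpi sinDpi.
have [oM|eM] := boolP (odd M).
  (* For odd [M], $-e^{2i\pi/M} = e^{2i\pi(M+2)/(2M)}$ has even order $2M$. *)
  exfalso; apply: (@conj M.*2 M.+2) => //; rewrite ?odd_double //; first by lia.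
    rewrite -muln2 coprimeMr coprimen2 /= negbK oM andbT.
    by rewrite -addn2 coprime_sym /coprime gcdnDl -/(coprime _ _) coprimen2.
  rewrite expiDpi expiX; congr expi.
  rewrite -muln2 natrM -[in RHS]mulr_natr -addn2 natrD.
  by field; rewrite gt_eqF.
have [oh|eh] := boolP (odd M./2); last first.
  (* When 4 divides [M], $-e^{2i\pi/M} = e^{2i\pi(M/2+1)/M}$, and $M/2+1$ is coprime to [M]. *)
  exfalso; apply: (@conj M M./2.+1) => //.
    have ME : M = M./2.*2 by rewrite even_halfK.
    rewrite [X in coprime _ X]ME -muln2 coprimeMr coprimen2 /= eh andbT.
    exact: coprimeSn.
  rewrite expiDpi expiX; congr expi.
  have -> : (M%:R : R) = M./2%:R * 2 by rewrite -natrM muln2 even_halfK.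
  rewrite -[in RHS]mulr_natr -addn1 natrD.
  by field; rewrite pnatr_eq0; lia.
exists M./2; first by rewrite even_halfK.
rewrite oh andbT; have [//|lt] := leqP 3 M./2.
(* Only [M = 2] is left to exclude; there [w] equals 1 and every step of the run adds 1. *)
have M2 : M = 2%N by have := even_halfK eM; lia.
have e2 : pi *+ 2 / M%:R + pi = pi *+ 2 :> R by rewrite M2; field.
move: run0; rewrite expiDpi e2.
by rewrite expi2pi => /eqP; rewrite (negbTE (line_run1 S T)).
Qed.

End Expi.

(** * From ranks of arcs to signs along a line *)

Section OrbitSigns.
Variables (k j : nat) (rk rk' : nat -> nat).
Local Notation N := (k.*2.+1).
Hypotheses (rk_lt : forall t, (t < N)%N -> (rk t < N)%N)
  (rk'_lt : forall t, (t < N)%N -> (rk' t < N)%N)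
  (rk_mid : forall t, (t < N)%N -> rk t = k -> t = 0%N)
  (rk'_mid : forall t, (t < N)%N -> rk' t = k -> t = k.*2)
  (rk_shift : forall t, (t < N)%N -> (rk t = rk' t + j \/ rk t + N = rk' t + j)%N)
  (rk0 : rk 0 = k)
  (rk_reflect : forall t, odd t -> (t < k.*2)%N -> (rk t.+1 + rk t = k.*2)%N)
  (rk'_reflect : forall t, ~~ odd t -> (t < k.*2)%N -> (rk' t.+1 + rk' t = k.*2)%N).

Let S : int := N%:Z - 2 * j%:Z.

(** In the coordinate $2\,\mathrm{rank}+1$ modulo $2N$ both reflections become $u \mapsto -u$, and
    passing from ranks counted at one centre to ranks counted at the other translates by $2j$. The
    middle rank [k] has coordinate $N$. *)
Lemma orbit_position t : (t <= k.*2)%N -> exists m : int,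
  if odd t then (2 * (rk t)%:Z + 1 = - (N%:Z - 2 * j%:Z * (t%:Z + 1)) + 2 * N%:Z * m)%R
  else (2 * (rk' t)%:Z + 1 = N%:Z - 2 * j%:Z * (t%:Z + 1) + 2 * N%:Z * m)%R.
Proof.
elim: t => [|t IH] tk /=.
  have [e|e] := @rk_shift 0%N isT; rewrite rk0 in e; [exists 0|exists 1]; lia.
have [m] := IH (ltnW tk).
have [e|e] := @rk_shift t.+1 tk.
  case: (boolP (odd t)) => /= ot h.
    by have r := rk_reflect ot tk; exists (1 - m); lia.
  by have r := rk'_reflect ot tk; exists (1 - m); lia.
case: (boolP (odd t)) => /= ot h.
  by have r := rk_reflect ot tk; exists (2 - m); lia.
by have r := rk'_reflect ot tk; exists (- m); lia.
Qed.

(** The side of the middle rank on which the previous arc lies decides between two consecutive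
    quotients, hence the parity. The remainder is nonzero because only the first arc is in the
    middle seen from one centre and only the last seen from the other. *)
Lemma orbit_offset t : (0 < t <= k.*2)%N -> exists m r : int,
  [/\ t%:Z * S = N%:Z * m + r, 0 < r < N%:Z &
    odd `|m|%N = ~~ (if odd t then rk' t.-1 < k else rk t.-1 < k)%N].
Proof.
case: t => [//|t] /= tk; have [m] := orbit_position (ltnW tk).
have tN : (t < N)%N by lia.
case: (boolP (odd t)) => /= ot e.
  have ne : rk t <> k by move=> /(rk_mid tN) t0; rewrite t0 in ot.
  have lt := rk_lt tN; have tE : exists s : nat, t = s.*2.+1 by exists t./2; lia.
  have [s sE] := tE.
  have expand : t.+1%:Z * S = (2 * s%:Z + 1 + 2 * m) * N%:Z - (2 * (rk t)%:Z + 1).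
    have -> : t.+1%:Z * S = (t%:Z + 1) * N%:Z - 2 * j%:Z * (t%:Z + 1) by rewrite /S -addn1 PoszD; ring.
    have -> : 2 * j%:Z * (t%:Z + 1) = 2 * (rk t)%:Z + 1 + N%:Z - 2 * N%:Z * m by lia.
    by rewrite {1}sE -addn1 -muln2 PoszD PoszM; ring.
  case: (ltnP (rk t) k) => h.
    exists (2 * s%:Z + 2 * m), (N%:Z - (2 * (rk t)%:Z + 1)).
    by rewrite expand; split; [ring|lia|lia].
  exists (2 * s%:Z + 2 * m - 1), (2 * N%:Z - (2 * (rk t)%:Z + 1)).
  by rewrite expand; split; [ring|lia|lia].
have ne : rk' t <> k by move=> /(rk'_mid tN) t0; lia.
have lt := rk'_lt tN; have tE : exists s : nat, t = s.*2 by exists t./2; lia.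
have [s sE] := tE.
have expand : t.+1%:Z * S = (2 * s%:Z - 2 * m) * N%:Z + (2 * (rk' t)%:Z + 1).
  have -> : t.+1%:Z * S = (t%:Z + 1) * N%:Z - 2 * j%:Z * (t%:Z + 1) by rewrite /S -addn1 PoszD; ring.
  have -> : 2 * j%:Z * (t%:Z + 1) = N%:Z - (2 * (rk' t)%:Z + 1) + 2 * N%:Z * m by lia.
  by rewrite sE -muln2 PoszM; ring.
case: (ltnP (rk' t) k) => h.
  exists (2 * s%:Z - 2 * m), (2 * (rk' t)%:Z + 1).
  by rewrite expand; split; [ring|lia|lia].
exists (2 * s%:Z - 2 * m + 1), (2 * (rk' t)%:Z + 1 - N%:Z).
by rewrite expand; split; [ring|lia|lia].
Qed.

Lemma orbit_sign t : (0 < t <= k.*2)%N ->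
  slope_sign S N%:Z t = (if odd t then rk' t.-1 < k else rk t.-1 < k)%N.
Proof.
move=> tk; have [m [r [e rN o]]] := orbit_offset tk.
rewrite (@slope_signE _ _ _ m) ?o ?negbK //; lia.
Qed.

(** A common factor $g>1$ would make $tS$ a multiple of $N$ at $t=N/g$, against the nonzero
    remainder of [orbit_offset]. *)
Lemma orbit_coprime : coprimez S N%:Z.
Proof.
rewrite /coprimez; set g := gcdz S N%:Z.
have gS : (g %| S)%Z by apply: dvdz_gcdl.
have gN : (g %| N%:Z)%Z by apply: dvdz_gcdr.
have [a SE] := dvdzP gS; have [b NE] := dvdzP gN.
have g0 : 0 <= g by rewrite /g /gcdz.
have [//|g1] := eqVneq g 1.
have gb : 1 < g by case: (ltrgtP g 0) => h; [lia|lia|rewrite h mulr0 in NE].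
have b0 : 0 < b by nia.
have bN : b < N%:Z by nia.
have tk : (0 < `|b|%N <= k.*2)%N by lia.
have [m [r [e /andP[r0 rN] _]]] := orbit_offset tk.
exfalso; have e1 : N%:Z * (a - m) = r.
  have -> : r = `|b|%N%:Z * S - N%:Z * m by rewrite e; ring.
  by rewrite gez0_abs ?ltW // SE NE; ring.
have : a - m <= 0 \/ 1 <= a - m by lia.
case=> h.
  have : N%:Z * (a - m) <= 0 by rewrite mulr_ge0_le0.
  by rewrite e1 leNgt r0.
have : N%:Z * 1 <= N%:Z * (a - m) by rewrite ler_pM2l.
by rewrite e1 mulr1 leNgt rN.
Qed.

End OrbitSigns.

(** * Parametrizations of a closed curve *)

Section Clamp.
Variable R : realType.
Implicit Types (a b t : R).

Definition clamp a b t : R := Num.max a (Num.min t b).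

Lemma clamp_in a b t : a <= b -> a <= clamp a b t <= b.
Proof.
by move=> ab; rewrite /clamp le_max lexx /= ge_max ab ge_min lexx orbT.
Qed.

Lemma clamp_id a b t : a <= t <= b -> clamp a b t = t.
Proof. by move=> /andP[at_ tb]; rewrite /clamp (min_idPl tb) (max_idPr at_). Qed.

Lemma clamp_lo a b t : t <= a -> a <= b -> clamp a b t = a.
Proof.
by move=> ta ab; rewrite /clamp (min_idPl (le_trans ta ab)) (max_idPl ta).
Qed.

Lemma clamp_hi a b t : b <= t -> a <= b -> clamp a b t = b.
Proof. by move=> bt ab; rewrite /clamp (min_idPr bt) (max_idPr ab). Qed.

Lemma clamp_continuous a b : continuous (clamp a b).
Proof.
move=> t; apply: (@continuous_max _ _ (cst a) (fun t => Num.min t b)).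
  exact: cst_continuous.
by apply: (@continuous_min _ _ id (cst b)); [exact: cvg_id|exact: cst_continuous].
Qed.

Lemma within_clamp (T : topologicalType) a b (f : R -> T) : a <= b ->
  {within `[a, b], continuous f} -> continuous (f \o clamp a b).
Proof.
move=> ab /subspace_continuousP cf t V.
have h : `[a, b]%classic (clamp a b t) by rewrite /= in_itv /= clamp_in.
move=> /(cf _ h); rewrite /= /within /= => nV.
have := @clamp_continuous a b t _ nV; rewrite /= !nbhs_simpl /=.
apply: filterS => s /=; apply; rewrite in_itv /=; exact: clamp_in.
Qed.

End Clamp.

Section Param.
Variable R : realType.
Local Notation P := (R * R)%type.

(** A parametrization by the circle, unrolled to the real line: paths then have real lifts, and
    orientation along the curve becomes the order of the reals. *)
Definition closed_param (gamma : set P) (c : R -> P) : Prop :=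
  [/\ continuous c, forall s, c (s + 1) = c s,
      forall s t, c s = c t -> exists k : int, s - t = k%:~R & gamma = range c].

Lemma closed_param_exists gamma : simple_closed_curve gamma -> exists c, closed_param gamma c.
Proof.
case=> c0 [cc c01 inj ->].
have le01 : (0 : R) <= 1 by [].
pose g := c0 \o clamp 0 1; have cg : continuous g by apply: within_clamp.
have g0 (s : R) : s <= 0 -> g s = c0 0 by move=> s0; rewrite /g /= clamp_lo.
have g1 s : 1 <= s -> g s = c0 0 by move=> s1; rewrite /g /= clamp_hi.
have gi (s : R) : 0 <= s <= 1 -> g s = c0 s by move=> s1; rewrite /g /= clamp_id.
pose c s := g (s - (Num.floor s)%:~R).
have fl (s : R) : 0 <= s - (Num.floor s)%:~R < 1.
  by have := floor_itv s; rewrite intrD mulr1z => /andP[a b]; apply/andP; split; lra.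
exists c; split.
- move=> s; set n := Num.floor s.
  (* As [g] is constant on each side of [0, 1], one of its two terms equals the base point on either
     side of [n], so [k] expresses [c] continuously across the integer. *)
  pose k x := g (x - n%:~R) + g (x - n%:~R + 1) - c0 0.
  have cshift (u : R) : continuous (fun x => g (x + u)).
    move=> x; apply: (@continuous_comp _ _ _ (fun y : R => y + u) g x _ (cg _)).
    by apply: cvgD; [exact: cvg_id|exact: cvg_cst].
  have ck : continuous k.
    move=> x; apply: cvgB; last exact: cvg_cst.
    apply: cvgD; first exact: (cshift (- n%:~R)).
    by under eq_fun do rewrite -addrA; rewrite -addrA; exact: (cshift (- n%:~R + 1)).
  have eqk (x : R) : n%:~R - 1 < x < n%:~R + 1 -> c x = k x.
    move=> /andP[x1 x2]; rewrite /c /k; have [lt|ge] := ltP x n%:~R.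
      have -> : Num.floor x = n - 1.
        by apply: floor_def; rewrite subrK lt intrB ltW.
      rewrite [g (x - n%:~R)]g0 ?subr_le0 ?ltW // addrAC subrr add0r.
      by rewrite intrB opprB addrA addrAC.
    have -> : Num.floor x = n by apply: floor_def; rewrite ge intrD.
    by rewrite [g (_ + 1)]g1 ?addrK // lerDr subr_ge0.
  have s1 : n%:~R - 1 < s < n%:~R + 1 by have /andP[] := fl s; rewrite -/n; lra.
  rewrite /continuous_at; have -> : c s = k s by apply: eqk.
  apply: cvg_trans (ck s); apply: near_eq_cvg.
  near=> x; apply/esym/eqk; near: x.
  have := near_in_itvoo s1; apply: filterS => x; rewrite in_itv /=; exact.
- move=> s; rewrite /c floorDrz ?intr1 ?rpred1 // floor1 intrD; congr g; lra.
- move=> s t; rewrite /c !gi ?(ltW (proj2 (andP (fl _)))) ?(proj1 (andP (fl _))) //; last first.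
  move=> /inj e; exists (Num.floor s - Num.floor t); rewrite intrB.
  by have := e; rewrite !inE /= !in_itv /= !fl => /(_ isT isT); lra.
- apply/seteqP; split=> [z [s]|z [s _ <-]].
    rewrite /= in_itv /= => s01 <-; have [s1|s1] := eqVneq s 1.
      exists 0 => //; rewrite /c floor0 subr0 gi ?lexx //.
      by rewrite s1.
    exists s => //; rewrite /c.
    have -> : Num.floor s = 0.
      by apply: floor_def; rewrite add0r; case/andP: s01 => -> ?; rewrite lt_neqAle s1.
    by rewrite subr0 gi.
  exists (s - (Num.floor s)%:~R); last by rewrite /c gi //; have /andP[-> /ltW] := fl s.
  by rewrite /= in_itv /=; have /andP[-> /ltW] := fl s.
Unshelve. all: by end_near.
Qed.

End Param.

Section Lifting.
Variable R : realType.
Local Notation P := (R * R)%type.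

(** Continuous induction: the supremum of the points reached from [a] is itself reached, and the
    local clause carries past it unless it is [b]. *)
Lemma interval_gluing (Q : R -> R -> Prop) :
  (forall u v w, u <= v -> v <= w -> Q u v -> Q v w -> Q u w) ->
  (forall t, exists2 e, 0 < e &
     forall u v, t - e < u -> u <= t -> t <= v -> v < t + e -> Q u v) ->
  forall a b, a <= b -> Q a b.
Proof.
move=> glue loc a b ab.
pose E := [set s | a <= s <= b /\ Q a s].
have Qaa t : Q t t by have [e e0 h] := loc t; apply: h; lra.
have Ea : E a by split; rewrite ?lexx.
have sE : has_sup E by split; [exists a|exists b => s [/andP[]]].
have sb : sup E <= b by apply: ge_sup; [exists a|move=> s [/andP[]]].
have sa : a <= sup E by apply: sup_upper_bound.
have [e e0 h] := loc (sup E).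
have [s Es hs] := sup_adherent e0 sE.
have ss := sup_upper_bound sE Es; case: Es => /andP[as_ _] Qs.
have [lt|ge] := ltP (sup E) b; last first.
  have -> : b = sup E by lra.
  by apply: (glue _ s) => //; apply: h; lra.
pose v := Num.min b (sup E + e / 2).
have v1 : sup E < v by rewrite lt_min lt /=; lra.
have v2 : v <= b by rewrite ge_min lexx.
have v3 : v < sup E + e by rewrite gt_min; apply/orP; right; lra.
have : E v.
  split; first by apply/andP; split; lra.
  apply: (glue _ s) => //; [lra|apply: h; lra].
by move=> /(sup_upper_bound sE) => h2; lra.
Qed.

Variables (gamma : set P) (c : R -> P).
Hypothesis cp : closed_param gamma c.

Lemma param_continuous : continuous c. Proof. by case: cp. Qed.

Lemma param_range z : gamma z <-> exists s, c s = z.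
Proof.
case: cp => _ _ _ ->; split; first by case=> s _ <-; exists s.
by case=> s <-; exists s.
Qed.

Lemma param_in s : gamma (c s). Proof. by apply/param_range; exists s. Qed.

Lemma param_period s (k : int) : c (s + k%:~R) = c s.
Proof.
case: cp => _ per _ _.
have pern (n : nat) : forall s, c (s + n%:R) = c s.
  elim: n => [|n IH] u; first by rewrite addr0.
  by rewrite -addn1 natrD addrA per IH.
by case: k => n; [exact: pern|rewrite NegzE mulrNz -{2}[s](subrK n.+1%:R) pern].
Qed.

Lemma param_inj s t : c s = c t -> exists k : int, s = t + k%:~R.
Proof.
by case: cp => _ _ inj _ /inj [k e]; exists k; rewrite -e addrC subrK.
Qed.

Lemma param_inj_lt s t : c s = c t -> `|s - t| < 1 -> s = t.
Proof.
move=> /param_inj [k ->]; rewrite addrAC subrr add0r -intr_norm.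
rewrite -[1]/(1%:~R) ltr_int => k0; have -> : k = 0 by lia.
by rewrite addr0.
Qed.

Lemma param_base (b : R) z : gamma z -> exists s, b <= s < b + 1 /\ c s = z.
Proof.
move=> /param_range [s <-]; exists (s - (Num.floor (s - b))%:~R); split.
  by have := floor_itv (s - b); rewrite intrD mulr1z => /andP[h1 h2]; apply/andP; split; lra.
by rewrite -mulrNz param_period.
Qed.

Lemma P_hausdorff : hausdorff_space P.
Proof. exact: norm_hausdorff. Qed.

(** The curve is the image under [c] of the compact interval from [b] to [b + 1], so [c] sends
    closed parts of it to closed sets and the lift is continuous. Avoiding [c b] removes the
    ambiguity at the two ends. *)
Lemma interval_lift (f : R -> P) b : continuous f -> (forall t, gamma (f t)) ->
  (forall t, f t <> c b) ->
  exists2 k : R -> R, continuous k & forall t, c (k t) = f t /\ b < k t < b + 1.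
Proof.
move=> cf gf fb.
have /choice[k kE] : forall t, exists s, c s = f t /\ b < s < b + 1.
  move=> t; have [s [/andP[bs sb] sE]] := param_base b (gf t); exists s; split=> //.
  rewrite sb lt_neqAle bs !andbT; apply/eqP => e.
  by apply: (fb t); rewrite -sE e.
exists k => //; apply/continuous_closedP => K clK.
have -> : k @^-1` K = f @^-1` (c @` (K `&` `[b, b + 1])).
  apply/seteqP; split=> t /=.
    move=> Kt; exists (k t); last by case: (kE t).
    by split=> //; rewrite /= in_itv /=; case: (kE t) => _ /andP[/ltW-> /ltW->].
  case=> s [Ks]; rewrite /= in_itv /= => /andP[bs sb] e.
  have [e2 /andP[k1 k2]] := kE t.
  suff <- : s = k t by [].
  apply: param_inj_lt; first by rewrite e e2.
  suff : s != b /\ s != b + 1.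
    rewrite ltr_norml => -[n1 n2]; have : b < s by rewrite lt_neqAle eq_sym n1.
    have : s < b + 1 by rewrite lt_neqAle n2.
    by move=> h1 h2; apply/andP; split; lra.
  split; apply/eqP => sE; apply: (fb t); rewrite -e sE //.
  by rewrite -[1]/(1%:~R) param_period.
apply: preimage_closed; first by move=> t _; exact: cf.
apply: (compact_closed P_hausdorff); apply: continuous_compact.
  exact: continuous_subspaceT param_continuous.
apply: (subclosed_compact _ (@segment_compact _ b (b + 1))); last by move=> x [].
by apply: closedI => //; exact: itv_closed.
Qed.

Lemma away_nbhs (f : R -> P) z t : continuous f -> f t <> z ->
  exists2 e, 0 < e & forall s, `|t - s| < e -> f s <> z.
Proof.
move=> cf ft; have : nbhs t [set s | f s <> z].
  have : nbhs (f t) (~` [set z]).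
    apply: open_nbhs_nbhs; split=> //; apply: closed_openC.
    exact: (accessible_closed_set1 (hausdorff_accessible P_hausdorff)).
  by move/cf.
by move=> /nbhs_ballP [e /= e0 h]; exists e => // s st; apply: h.
Qed.

Lemma path_lift (f : R -> P) a b : continuous f -> (forall t, gamma (f t)) -> a <= b ->
  exists2 k : R -> R, continuous k & forall t, a <= t <= b -> c (k t) = f t.
Proof.
move=> cf gf; apply: (@interval_gluing (fun a b => exists2 k : R -> R, continuous k &
   forall t, a <= t <= b -> c (k t) = f t)) => {a b}.
  move=> u v w uv vw [k1 ck1 k1E] [k2 ck2 k2E].
  have [n nE] : exists n : int, k1 v = k2 v + n%:~R.
    by apply: param_inj; rewrite k1E ?k2E ?lexx ?uv ?vw.
  exists (fun t => k1 (Num.min t v) + k2 (Num.max t v) - k2 v).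
    move=> t; apply: cvgB; last exact: cvg_cst.
    apply: cvgD.
      apply: (@continuous_comp _ _ _ (fun t => Num.min t v) k1); last exact: ck1.
      by apply: (@continuous_min _ _ id (cst v)); [exact: cvg_id|exact: cvg_cst].
    apply: (@continuous_comp _ _ _ (fun t => Num.max t v) k2); last exact: ck2.
    by apply: (@continuous_max _ _ id (cst v)); [exact: cvg_id|exact: cvg_cst].
  move=> t /andP[ut tw]; have [tv|vt] := leP t v.
    by rewrite addrK k1E // ut tv.
  by rewrite nE addrAC [_ + n%:~R]addrC addrK addrC param_period k2E // (ltW vt).
move=> t.
(* At least one of [c 0] and [c 2^-1] differs from [f t] and can serve as a cut near [t]. *)
have [d [e e0 away]] : exists d, (exists2 e, 0 < e & forall s, `|t - s| < e -> f s <> c d).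
  have [e0|] := pselect (f t = c 0); last by exists 0; apply: away_nbhs.
  exists 2^-1; apply: away_nbhs => //; rewrite e0 => /param_inj_lt.
  have -> : `|0 - 2^-1| = 2^-1 :> R by rewrite sub0r normrN gtr0_norm ?invr_gt0.
  by move=> /(_ ltac:(lra)); lra.
exists e => // u v h1 h2 h3 h4; have uv := le_trans h2 h3.
have [] := @interval_lift (f \o clamp u v) d.
- by move=> s; apply: continuous_comp; [exact: clamp_continuous|exact: cf].
- by move=> s; exact: gf.
- move=> s; apply: away; have /andP[a1 a2] := clamp_in s uv.
  by rewrite ltr_norml; apply/andP; split; lra.
move=> k ck kE; exists k => // s us; have [-> _] := kE s.
by rewrite /= clamp_id.
Qed.

Lemma continuous_ivt (k : R -> R) a b v : continuous k -> a <= b ->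
  (k a <= v <= k b) || (k b <= v <= k a) -> exists2 t, a <= t <= b & k t = v.
Proof.
move=> ck ab hv; have [|t] := @IVT R k a b v ab (continuous_subspaceT ck).
  by rewrite ge_min le_max; case/orP: hv => /andP[-> ->]; rewrite ?orbT.
by rewrite in_itv /= => tab <-; exists t.
Qed.

Lemma continuous_inj_mono (k : R -> R) a b : continuous k -> a < b ->
  (forall s t, a <= s <= b -> a <= t <= b -> k s = k t -> s = t) ->
  (forall s t, a <= s -> s < t -> t <= b -> k s < k t) \/
  (forall s t, a <= s -> s < t -> t <= b -> k t < k s).
Proof.
move=> ck ab inj.
have inj' : {in `[a, b] &, injective k}.
  by move=> s t; rewrite !in_itv /= => hs ht; exact: inj.
have [h|h] := itv_continuous_inj_mono (continuous_subspaceT ck) inj'; [left|right].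
  by move=> s t as_ st tb; apply: h => //; rewrite in_itv /=; apply/andP; split; lra.
by move=> s t as_ st tb; apply: h => //; rewrite in_itv /=; apply/andP; split; lra.
Qed.

Lemma arc_lift (f : R -> P) a b s0 : continuous f -> (forall t, gamma (f t)) -> a < b ->
  (forall s t, a <= s <= b -> a <= t <= b -> f s = f t -> s = t) ->
  forall t0, a <= t0 <= b -> c s0 = f t0 ->
  exists k : R -> R, [/\ continuous k, forall t, a <= t <= b -> c (k t) = f t, k t0 = s0 &
    (forall s t, a <= s -> s < t -> t <= b -> k s < k t) \/
    (forall s t, a <= s -> s < t -> t <= b -> k t < k s)].
Proof.
move=> cf gf ab inj t0 t0ab s0E.
have [k ck kE] := path_lift cf gf (ltW ab).
have [n nE] : exists n : int, s0 = k t0 + n%:~R by apply: param_inj; rewrite s0E kE.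
exists (fun t => k t + n%:~R); split.
- by move=> t; apply: cvgD; [exact: ck|exact: cvg_cst].
- by move=> t tab; rewrite param_period kE.
- by rewrite nE.
have [|h|h] := @continuous_inj_mono k a b ck ab.
- by move=> s t hs ht e; apply: inj => //; rewrite -!kE // e.
- by left=> s t h1 h2 h3; rewrite ltrD2r; apply: h.
- by right=> s t h1 h2 h3; rewrite ltrD2r; apply: h.
Qed.

Lemma param_shift x : closed_param gamma (fun s => c (s + x)).
Proof.
case: cp => cc per inj gE; split.
- move=> s; apply: (@continuous_comp _ _ _ (fun y : R => y + x) c); last exact: cc.
  by apply: cvgD; [exact: cvg_id|exact: cvg_cst].
- by move=> s; rewrite addrAC per.
- by move=> s t /inj [k kE]; exists k; rewrite -kE; ring.
- rewrite gE; apply/seteqP; split=> z [s _ <-].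
    by exists (s - x) => //; rewrite subrK.
  by exists (s + x).
Qed.

Lemma param_reverse : closed_param gamma (fun s => c (- s)).
Proof.
case: cp => cc per inj gE; split.
- move=> s; apply: (@continuous_comp _ _ _ (fun y : R => - y) c); last exact: cc.
  by apply: cvgN; exact: cvg_id.
- by move=> s; rewrite -[LHS]per opprD subrK.
- by move=> s t /inj [k kE]; exists (- k); rewrite mulrNz -kE; ring.
- rewrite gE; apply/seteqP; split=> z [s _ <-].
    by exists (- s) => //; rewrite opprK.
  by exists (- s).
Qed.

End Lifting.

(** * Rotations *)

Section Rotations.
Variable R : realType.
Local Notation P := (R * R)%type.
Implicit Types (p z w : P) (a b t : R).

Definition sqd z w : R := (z.1 - w.1) ^+ 2 + (z.2 - w.2) ^+ 2.

Lemma sqd_ge0 z w : 0 <= sqd z w.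
Proof. by rewrite addr_ge0 ?sqr_ge0. Qed.

Lemma sqd_eq0 z w : sqd z w = 0 -> z = w.
Proof.
move=> /eqP; rewrite paddr_eq0 ?sqr_ge0 // !sqrf_eq0 !subr_eq0 => /andP[/eqP h1 /eqP h2].
by case: z w h1 h2 => z1 z2 [w1 w2] /= -> ->.
Qed.

Lemma sqdC z w : sqd z w = sqd w z.
Proof. by rewrite /sqd; ring. Qed.

Lemma sqdxx z : sqd z z = 0.
Proof. by rewrite /sqd !subrr expr0n addr0. Qed.

Lemma sqd_gt0 z w : z <> w -> 0 < sqd z w.
Proof. by move=> n; rewrite lt_neqAle sqd_ge0 andbT eq_sym; apply/eqP => /sqd_eq0. Qed.

Lemma sqd_continuous (T : topologicalType) (f : T -> P) w :
  continuous f -> continuous (fun u => sqd (f u) w).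
Proof.
move=> cf x; rewrite /continuous_at /sqd; under eq_fun do rewrite !expr2; rewrite !expr2.
have h1 : (fun u => (f u).1 - w.1) @ x --> (f x).1 - w.1.
  by apply: cvgB; [apply: (cvg_comp _ _ (cf x)); exact: cvg_fst|exact: cvg_cst].
have h2 : (fun u => (f u).2 - w.2) @ x --> (f x).2 - w.2.
  by apply: cvgB; [apply: (cvg_comp _ _ (cf x)); exact: cvg_snd|exact: cvg_cst].
by apply: cvgD; apply: cvgM.
Qed.

Lemma rot0 p z : rot 0 p z = z.
Proof. by case: z => x y; rewrite /rot cos0 sin0 /=; congr (_, _); ring. Qed.

Lemma rotD a b p z : rot (a + b) p z = rot a p (rot b p z).
Proof. by rewrite /rot /= cosD sinD; congr (_, _); ring. Qed.

Lemma rotC a b p z : rot a p (rot b p z) = rot b p (rot a p z).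
Proof. by rewrite -!rotD addrC. Qed.

Lemma rotK a p z : rot (- a) p (rot a p z) = z.
Proof. by rewrite -rotD addNr rot0. Qed.

Lemma rotNK a p z : rot a p (rot (- a) p z) = z.
Proof. by rewrite -rotD addrN rot0. Qed.

Lemma rot_center a p : rot a p p = p.
Proof. by case: p => x y; rewrite /rot /=; congr (_, _); ring. Qed.

Lemma rot2pi p z : rot (pi *+ 2) p z = z.
Proof. by case: z => x y; rewrite /rot cos2pi sin2pi /=; congr (_, _); ring. Qed.

Lemma rot_inj a p z w : rot a p z = rot a p w -> z = w.
Proof. by move=> /(congr1 (rot (- a) p)); rewrite !rotK. Qed.

Lemma sqd_rot a p z w : sqd (rot a p z) (rot a p w) = sqd z w.
Proof.
rewrite /sqd /rot /=; have := cos2Dsin2 a; set c := cos a; set s := sin a => cs.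
transitivity ((c ^+ 2 + s ^+ 2) * ((z.1 - w.1) ^+ 2 + (z.2 - w.2) ^+ 2)); first by ring.
by rewrite cs mul1r.
Qed.

Lemma sqd_rot_center a p z : sqd (rot a p z) p = sqd z p.
Proof. by rewrite -{2}(rot_center a p) sqd_rot. Qed.

(** Linear parts of plane rotations commute, so conjugation by a rotation only moves the centre.
    This is how an arc is transported with its angle and its sense. *)
Lemma rot_rot a b p z w : rot a p (rot b z w) = rot b (rot a p z) (rot a p w).
Proof. by rewrite /rot /=; congr (_, _); ring. Qed.

Lemma cos_neq1 a : 0 < a < pi *+ 2 -> cos a <> 1.
Proof.
move=> /andP[a0 a2] c1.
have h : sin (a / 2) > 0.
  by apply: sin_gt0_pi; rewrite divr_gt0 // ltr_pdivrMr // mulr_natr.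
have : cos ((a / 2) *+ 2) = 1 by rewrite -mulr_natr divfK ?pnatr_eq0.
rewrite cos_mulr2n cos2sin2 => e; have : sin (a / 2) ^+ 2 = 0 by lra.
by move=> /eqP; rewrite sqrf_eq0 gt_eqF.
Qed.

Lemma rot_fixed a p z : 0 < a < pi *+ 2 -> rot a p z = z -> z = p.
Proof.
move=> a2; rewrite /rot; case: z => x y [] /= e1 e2.
have e : (2 - 2 * cos a) * ((x - p.1) ^+ 2 + (y - p.2) ^+ 2) = 0.
  have -> : 2 - 2 * cos a = (cos a - 1) ^+ 2 + sin a ^+ 2 by rewrite -[in LHS](cos2Dsin2 a) ?cos2Dsin2; have := cos2Dsin2 a; lra.
  transitivity ((cos a * (x - p.1) - sin a * (y - p.2) - (x - p.1)) ^+ 2 +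
    (sin a * (x - p.1) + cos a * (y - p.2) - (y - p.2)) ^+ 2); first by ring.
  have -> : cos a * (x - p.1) - sin a * (y - p.2) - (x - p.1) = 0 by lra.
  have -> : sin a * (x - p.1) + cos a * (y - p.2) - (y - p.2) = 0 by lra.
  by rewrite expr0n addr0.
apply: sqd_eq0; move/eqP: e; rewrite mulf_eq0 => /orP[/eqP c1|/eqP //].
by have := cos_neq1 a2; lra.
Qed.

Lemma rot_theta_inj a b p z : z <> p -> `|a - b| < pi *+ 2 ->
  rot a p z = rot b p z -> a = b.
Proof.
move=> zp; wlog ab : a b / a <= b => [w|ab_lt e].
  have [ab|/ltW ba] := leP a b; first exact: w.
  by rewrite distrC => h e; apply/esym; apply: w.
have [//|ne] := eqVneq a b; exfalso; apply: zp.
apply: (@rot_fixed (b - a)).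
  rewrite subr_gt0 lt_neqAle ne ab /=; move: ab_lt; rewrite ler0_norm; lra.
by apply: (@rot_inj a p); rewrite -rotD [a + _]addrC subrK e.
Qed.

Lemma cvg_pair_pt (T : topologicalType) (x : T) (f g : T -> R) u v :
  f @ x --> u -> g @ x --> v -> (fun y => (f y, g y)) @ x --> ((u, v) : P).
Proof. by move=> fu gv; apply: (@cvg_pair _ _ _ _ (nbhs u) (nbhs v)). Qed.

Lemma rot_continuous_theta p z : continuous (fun t => rot t p z).
Proof.
move=> t; rewrite /continuous_at /rot.
have cc : (fun t : R => cos t) @ t --> cos t by exact: continuous_cos.
have cs : (fun t : R => sin t) @ t --> sin t by exact: continuous_sin.
apply: cvg_pair_pt; apply: cvgD; try exact: cvg_cst.
  by apply: cvgB; apply: cvgM => //; exact: cvg_cst.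
by apply: cvgD; apply: cvgM => //; exact: cvg_cst.
Qed.

Lemma rot_continuous a p (T : topologicalType) (f : T -> P) :
  continuous f -> continuous (fun u => rot a p (f u)).
Proof.
move=> cf x; rewrite /continuous_at /rot.
have h1 : (fun u => (f u).1 - p.1) @ x --> (f x).1 - p.1.
  by apply: cvgB; [apply: (cvg_comp _ _ (cf x)); exact: cvg_fst|exact: cvg_cst].
have h2 : (fun u => (f u).2 - p.2) @ x --> (f x).2 - p.2.
  by apply: cvgB; [apply: (cvg_comp _ _ (cf x)); exact: cvg_snd|exact: cvg_cst].
apply: cvg_pair_pt; apply: cvgD; try exact: cvg_cst.
  by apply: cvgB; apply: cvgM => //; exact: cvg_cst.
by apply: cvgD; apply: cvgM => //; exact: cvg_cst.
Qed.

End Rotations.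

(** * First hits of circles along a curve *)

Section FirstHit.
Variable R : realType.
Local Notation P := (R * R)%type.

Lemma near_lt (h : R -> R) t r : continuous h -> h t < r ->
  exists2 e, 0 < e & forall s, `|t - s| < e -> h s < r.
Proof.
move=> ch ht; have := ch t _ (open_nbhs_nbhs (conj (@open_lt _ r) ht)).
by move=> /nbhs_ballP [e /= e0 he]; exists e => // s st; apply: he.
Qed.

Lemma first_hit (h : R -> R) a b r : continuous h -> a <= b -> h a < r -> r <= h b ->
  exists t, [/\ a < t, t <= b, h t = r & forall s, a <= s -> s < t -> h s < r].
Proof.
move=> ch ab ha hb; pose E := [set t | a <= t <= b /\ r <= h t].
have Eb : E b by split; rewrite ?ab ?lexx.
have iE : has_inf E by split; [exists b|exists a => t [/andP[]]].
have ib : inf E <= b by apply: ge_inf => //; case: iE.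
have ia : a <= inf E by apply: lb_le_inf; [exists b|move=> t [/andP[]]].
have lo s : a <= s -> s < inf E -> h s < r.
  move=> as_ si; rewrite ltNge; apply/negP => hs.
  have : inf E <= s by apply: ge_inf; [case: iE|split=> //; rewrite as_; lra].
  by lra.
have hi : h (inf E) = r.
  apply/eqP; rewrite eq_le; apply/andP; split; rewrite leNgt; apply/negP => lt.
    have lt' : - h (inf E) < - r by rewrite ltrN2.
    have [|e e0 he] := @near_lt (fun s => - h s) (inf E) (- r) _ lt'.
      by move=> s; apply: cvgN; exact: ch.
    have : a < inf E by rewrite lt_neqAle ia andbT; apply/eqP => e1; rewrite -e1 in lt; lra.
    move=> ia'; pose s := Num.max a (inf E - e / 2).
    have s1 : a <= s by rewrite le_max lexx.
    have s2 : s < inf E by rewrite gt_max ia' /=; lra.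
    have s3 : inf E - e < s by rewrite lt_max; apply/orP; right; lra.
    have : - h s < - r by apply: he; rewrite ltr_norml; apply/andP; split; lra.
    by have := lo s s1 s2; lra.
  have [e e0 he] := near_lt ch lt.
  have [s [/andP[s1 s2] hs] s3] := inf_adherent e0 iE.
  have s4 : inf E <= s by apply: ge_inf; [case: iE|split=> //; apply/andP].
  have : h s < r by apply: he; rewrite ltr_norml; apply/andP; split; lra.
  by lra.
exists (inf E); split=> //.
by rewrite lt_neqAle ia andbT; apply/eqP => e1; rewrite -e1 in hi; lra.
Qed.

Variables (gamma : set P) (c : R -> P).
Hypothesis cp : closed_param gamma c.

(* Two arcs leaving [p] in the same direction along the closed curve reach any
   given distance from [p] for the first time at the same point. *)
Lemma common_first_hit (p : P) (g1 g2 : R -> P) (l1 l2 : R -> R) b1 b2 r :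
  continuous g1 -> continuous g2 -> continuous l1 -> continuous l2 ->
  0 <= b1 -> 0 <= b2 -> l1 0 = 0 -> l2 0 = 0 ->
  (forall t, 0 <= t <= b1 -> c (l1 t) = g1 t) -> (forall t, 0 <= t <= b2 -> c (l2 t) = g2 t) ->
  (forall s t, 0 <= s -> s < t -> t <= b1 -> l1 s < l1 t) ->
  (forall s t, 0 <= s -> s < t -> t <= b2 -> l2 s < l2 t) ->
  g1 0 = p -> g2 0 = p -> 0 < r -> r <= sqd (g1 b1) p -> r <= sqd (g2 b2) p ->
  exists t1 t2, [/\ 0 <= t1 <= b1, 0 <= t2 <= b2, g1 t1 = g2 t2, sqd (g1 t1) p = r &
    (forall s, 0 <= s -> s < t1 -> sqd (g1 s) p < r) /\
    (forall s, 0 <= s -> s < t2 -> sqd (g2 s) p < r)].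
Proof.
move=> cg1 cg2 cl1 cl2 b1p b2p l10 l20 l1E l2E inc1 inc2 g1p g2p r0 r1 r2.
have [|t1 [t1a t1b h1 lo1]] := first_hit (@sqd_continuous _ _ _ p cg1) b1p _ r1.
  by rewrite g1p sqdxx.
have [|t2 [t2a t2b h2 lo2]] := first_hit (@sqd_continuous _ _ _ p cg2) b2p _ r2.
  by rewrite g2p sqdxx.
have t1I : 0 <= t1 <= b1 by rewrite ltW.
have t2I : 0 <= t2 <= b2 by rewrite ltW.
have eq12 : l1 t1 = l2 t2.
  have [lt|gt|//] := ltrgtP (l1 t1) (l2 t2).
    have l10' : 0 < l1 t1 by rewrite -l10; apply: inc1.
    have [|t tI tE] := @continuous_ivt _ l2 0 t2 (l1 t1) cl2 (ltW t2a).
      by rewrite l20 (ltW l10') (ltW lt).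
    have tt2 : t < t2 by rewrite lt_neqAle; case/andP: tI => _ ->; rewrite andbT; apply/eqP => e; rewrite -tE e ltxx in lt.
    case/andP: tI => ta tb; have := lo2 t ta tt2.
    rewrite -l2E ?tE ?l1E ?h1 ?ltxx //; apply/andP; split; lra.
  have l20' : 0 < l2 t2 by rewrite -l20; apply: inc2.
  have [|t tI tE] := @continuous_ivt _ l1 0 t1 (l2 t2) cl1 (ltW t1a).
    by rewrite l10 (ltW l20') (ltW gt).
  have tt1 : t < t1 by rewrite lt_neqAle; case/andP: tI => _ ->; rewrite andbT; apply/eqP => e; rewrite -tE e ltxx in gt.
  case/andP: tI => ta tb; have := lo1 t ta tt1.
  rewrite -l1E ?tE ?l2E ?h2 ?ltxx //; apply/andP; split; lra.
by exists t1, t2; split=> //; rewrite -l1E // -l2E // eq12.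
Qed.

End FirstHit.

(** * The generating point is an end-point *)

Section Endpoint.
Variable R : realType.
Local Notation P := (R * R)%type.

Lemma continuous_affine (T : topologicalType) (f : R -> T) (a b : R) :
  continuous f -> continuous (fun t => f (a + b * t)).
Proof.
move=> cf t; apply: (@continuous_comp _ _ _ (fun t : R => a + b * t) f); last exact: cf.
by apply: cvgD; [exact: cvg_cst|apply: cvgM; [exact: cvg_cst|exact: cvg_id]].
Qed.

Lemma ltW2 (a b t : R) : a < t < b -> a <= t <= b.
Proof. by case/andP=> /ltW -> /ltW ->. Qed.

Lemma opposite_half_turns (p y : P) (t t' : R) : y <> p -> 0 < t < pi -> 0 < t' < pi ->
  rot t p y <> rot (t' + pi) p y.
Proof.
move=> yp /andP[t0 t1] /andP[t'0 t'1] /(rot_theta_inj yp) h.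
have : t = t' + pi by apply: h; rewrite ltr_norml mulr2n; apply/andP; split; lra.
by lra.
Qed.

Section OneParam.
Variables (gamma : set P) (c : R -> P) (p : P).
Hypotheses (cp : closed_param gamma c) (c0 : c 0 = p).

Lemma param_c1 : c 1 = p.
Proof. by rewrite -c0 -[1]add0r -[1]/(1%:~R) (param_period cp). Qed.

(** The arc keeps a constant positive distance from [p], so its lift can cross neither 0 nor 1. *)
Lemma arc_span (a s1 : R) : 0 < a < pi *+ 2 -> 0 < s1 < 1 ->
  (forall t, 0 <= t <= a -> gamma (rot t p (c s1))) ->
  exists l : R -> R, [/\ continuous l, forall t, 0 <= t <= a -> c (l t) = rot t p (c s1),
     l 0 = s1, forall t, 0 <= t <= a -> 0 < l t < 1 &
    (forall s t, 0 <= s -> s < t -> t <= a -> l s < l t) \/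
    (forall s t, 0 <= s -> s < t -> t <= a -> l t < l s)].
Proof.
move=> /andP[a0 a2] /andP[s10 s11] arcg.
have ep : c s1 <> p.
  rewrite -c0 => /(param_inj_lt cp); rewrite subr0 gtr0_norm // => /(_ s11) e.
  by rewrite e ltxx in s10.
pose f t := rot (clamp 0 a t) p (c s1).
have cf : continuous f.
  move=> t; apply: (@continuous_comp _ _ _ (clamp 0 a) (fun t => rot t p (c s1))).
    exact: clamp_continuous.
  exact: rot_continuous_theta.
have fE t : 0 <= t <= a -> f t = rot t p (c s1) by move=> ta; rewrite /f clamp_id.
have [||||k [ck kE k0 mono]] := @arc_lift _ gamma c cp f 0 a s1 cf _ a0 _ 0.
- by move=> t; apply: arcg; apply: clamp_in; exact: ltW.
- move=> s t sI tI; rewrite !fE // => /(rot_theta_inj ep); apply.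
  by case/andP: sI => ? ?; case/andP: tI => ? ?; rewrite ltr_norml; apply/andP; split; lra.
- by rewrite lexx ltW.
- by rewrite fE ?lexx ?ltW // rot0.
exists k; split=> //.
- by move=> t ta; rewrite kE // fE.
move=> t /andP[t0 ta].
have bad v : c v = p -> (k 0 <= v <= k t) || (k t <= v <= k 0) -> False.
  move=> cv /(continuous_ivt ck t0) [u /andP[u0 ut] ku].
  have uI : 0 <= u <= a by rewrite u0 (le_trans ut).
  by apply: ep; apply: (@rot_inj _ u p); rewrite rot_center -fE // -kE // ku.
apply/andP; split; rewrite ltNge; apply/negP => h.
  by apply: (bad 0) => //; rewrite k0 h (ltW s10) orbT.
by apply: (bad 1); [exact: param_c1|rewrite k0 h (ltW s11)].
Qed.

(** Rotation about [p] keeps distances to [p], so both curves make their common first hit at the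
    same time [t]; the rotation would then fix [g t], which differs from [p]. *)
Lemma same_direction_absurd (a b : R) (g : R -> P) (l1 l2 : R -> R) :
  0 < a < pi *+ 2 -> 0 <= b -> continuous g -> continuous l1 -> continuous l2 ->
  l1 0 = 0 -> l2 0 = 0 -> g 0 = p -> g b <> p ->
  (forall t, 0 <= t <= b -> c (l1 t) = g t) ->
  (forall t, 0 <= t <= b -> c (l2 t) = rot a p (g t)) ->
  (forall s t, 0 <= s -> s < t -> t <= b -> l1 s < l1 t) ->
  (forall s t, 0 <= s -> s < t -> t <= b -> l2 s < l2 t) -> False.
Proof.
move=> a2 b0 cg cl1 cl2 l10 l20 g0 gb l1E l2E inc1 inc2.
have r0 := sqd_gt0 gb.
have [|||t1 [t2 [t1I t2I e12 h1 [lo1 lo2]]]] :=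
  common_first_hit cg (rot_continuous (a := a) (p := p) cg) cl1 cl2 b0 b0 l10 l20 l1E l2E inc1 inc2 g0 _ r0.
- by rewrite g0 rot_center.
- by [].
- by rewrite sqd_rot_center.
have h2 : sqd (g t2) p = sqd (g b) p by rewrite -(sqd_rot_center a) -e12 h1.
case/andP: t1I => t10 _; case/andP: t2I => t20 _.
have [lt|gt|e] := ltrgtP t1 t2.
- by have := lo2 _ t10 lt; rewrite sqd_rot_center h1 ltxx.
- by have := lo1 _ t20 gt; rewrite h2 ltxx.
rewrite -e in e12; have := rot_fixed a2 (esym e12) => gp.
by move: r0; rewrite -h1 gp sqdxx ltxx.
Qed.

End OneParam.

Section Generator.
Variables (gamma : set P) (p : P) (a : R) (f : R -> P) (t0 : R).
Hypotheses (a_in : 0 < a < pi *+ 2) (cf : continuous f)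
  (f_inj : forall s t, 0 <= s <= 1 -> 0 <= t <= 1 -> f s = f t -> s = t)
  (f_in : forall t, gamma (f t)) (fa_in : forall t, gamma (rot a p (f t)))
  (arc0 : forall t, 0 <= t <= a -> gamma (rot t p (f 0)))
  (arc1 : forall t, 0 <= t <= a -> gamma (rot t p (f 1)))
  (ft0 : f t0 = p).

Lemma lifted_pair (c : R -> P) : closed_param gamma c -> c 0 = p -> 0 <= t0 <= 1 ->
  exists k k' : R -> R, [/\ continuous k /\ continuous k',
   forall t, 0 <= t <= 1 -> c (k t) = f t, forall t, 0 <= t <= 1 -> c (k' t) = rot a p (f t),
   k t0 = 0 /\ k' t0 = 0 &
   ((forall s t, 0 <= s -> s < t -> t <= 1 -> k s < k t) \/
    (forall s t, 0 <= s -> s < t -> t <= 1 -> k t < k s)) /\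
   ((forall s t, 0 <= s -> s < t -> t <= 1 -> k' s < k' t) \/
    (forall s t, 0 <= s -> s < t -> t <= 1 -> k' t < k' s))].
Proof.
move=> cp c0 t0I.
have [|k [ck kE k0 mk]] := arc_lift cp cf f_in (@ltr01 R) f_inj t0I (s0 := 0); first by rewrite c0.
have inj' s t : 0 <= s <= 1 -> 0 <= t <= 1 -> rot a p (f s) = rot a p (f t) -> s = t.
  by move=> sI tI /rot_inj; exact: f_inj.
have [|k' [ck' k'E k'0 mk']] := arc_lift cp (rot_continuous (a := a) (p := p) cf) fa_in (@ltr01 R) inj' t0I (s0 := 0).
  by rewrite c0 ft0 rot_center.
by exists k, k'.
Qed.

Lemma lift_length (c k : R -> _) (g : R -> P) : closed_param gamma c ->
  continuous k -> (forall s t, 0 <= s <= 1 -> 0 <= t <= 1 -> g s = g t -> s = t) ->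
  (forall t, 0 <= t <= 1 -> c (k t) = g t) ->
  (forall s t, 0 <= s -> s < t -> t <= 1 -> k s < k t) -> k 1 < k 0 + 1 :> R.
Proof.
move=> cp ck ginj kE inc; rewrite ltNge; apply/negP => h.
have [|t /andP[t0' t1] tE] := @continuous_ivt _ k 0 1 (k 0 + 1) ck (@ler01 R).
  by rewrite h andbT lerDl ler01.
have : 0 = t.
  apply: ginj; rewrite ?lexx ?ler01 ?t0' // -!kE ?lexx ?ler01 ?t0' // tE.
  by rewrite -[1]/(1%:~R) (param_period cp).
by move=> e; move: tE; rewrite -e; lra.
Qed.

(** With [p] inside the curve, each half of it leaves [p] together with the rotated copy of the
    other half. The first hits on the two sides combine to a point other than [p] fixed by the
    rotation by $2a$. *)
Lemma generator_half_turn (c : R -> P) (k k' : R -> R) : closed_param gamma c -> c 0 = p ->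
  0 < t0 < 1 -> continuous k -> continuous k' ->
  (forall t, 0 <= t <= 1 -> c (k t) = f t) -> (forall t, 0 <= t <= 1 -> c (k' t) = rot a p (f t)) ->
  k t0 = 0 -> k' t0 = 0 ->
  (forall s t, 0 <= s -> s < t -> t <= 1 -> k s < k t) ->
  (forall s t, 0 <= s -> s < t -> t <= 1 -> k' t < k' s) -> a = pi.
Proof.
move=> cp c0 /andP[t00 t01] ck ck' kE k'E k0 k'0 inc dec.
have f1p : f 1 <> p by rewrite -ft0 => /f_inj h; have := h ltac:(lra) ltac:(lra); lra.
have f0p : f 0 <> p by rewrite -ft0 => /f_inj h; have := h ltac:(lra) ltac:(lra); lra.
pose r := Num.min (sqd (f 1) p) (sqd (f 0) p).
have r0 : 0 < r by rewrite lt_min !sqd_gt0.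
have r1 : r <= sqd (f 1) p by rewrite ge_min lexx.
have r2 : r <= sqd (f 0) p by rewrite ge_min lexx orbT.
pose gp t := f (t0 + 1 * t); pose gm t := f (t0 + (-1) * t).
have cgp : continuous gp by exact: continuous_affine.
have cgm : continuous gm by exact: continuous_affine.
have cagp := rot_continuous (a := a) (p := p) cgp.
have cagm := rot_continuous (a := a) (p := p) cgm.
have b1 : 0 <= 1 - t0 by lra.
have b2 : 0 <= t0 by lra.
have cN (h : R -> R) : continuous h -> continuous (fun t => - h t).
  by move=> ch t; apply: cvgN; exact: ch.
have [|||||||||||t1 [t2 [t1I t2I e12 h1 [lo1 lo2]]]] :=
  @common_first_hit _ c p gp (fun t => rot a p (gm t)) (fun t => k (t0 + 1 * t))
   (fun t => k' (t0 + (-1) * t)) (1 - t0) t0 r cgp cagm (continuous_affine ck) (continuous_affine ck') b1 b2.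
- by rewrite mulr0 addr0.
- by rewrite mulr0 addr0.
- by move=> t tI; rewrite kE //; lra.
- by move=> t tI; rewrite k'E //; lra.
- by move=> s t *; apply: inc; lra.
- by move=> s t *; apply: dec; lra.
- by rewrite /gp mulr0 addr0.
- by rewrite /gm mulr0 addr0 ft0 rot_center.
- exact: r0.
- by rewrite /gp mul1r addrC subrK.
- by rewrite sqd_rot_center /gm mulN1r subrr.
have [|||||||||||t3 [t4 [t3I t4I e34 h3 [lo3 lo4]]]] :=
  @common_first_hit _ (fun s => c (- s)) p gm (fun t => rot a p (gp t)) (fun t => - k (t0 + (-1) * t))
   (fun t => - k' (t0 + 1 * t)) t0 (1 - t0) r cgm cagp (cN _ (continuous_affine ck)) (cN _ (continuous_affine ck')) b2 b1.
- by rewrite mulr0 addr0 k0 oppr0.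
- by rewrite mulr0 addr0 k'0 oppr0.
- by move=> t tI; rewrite opprK kE //; lra.
- by move=> t tI; rewrite opprK k'E //; lra.
- by move=> s t *; rewrite ltrN2; apply: inc; lra.
- by move=> s t *; rewrite ltrN2; apply: dec; lra.
- by rewrite /gm mulr0 addr0.
- by rewrite /gp mulr0 addr0 ft0 rot_center.
- exact: r0.
- by rewrite /gm mulN1r subrr.
- by rewrite sqd_rot_center /gp mul1r addrC subrK.
have h2 : sqd (gm t2) p = r by rewrite -(sqd_rot_center a) -e12 h1.
have h4 : sqd (gp t4) p = r by rewrite -(sqd_rot_center a) -e34 h3.
have e14 : t1 = t4.
  case/andP: t1I => t10 _; case/andP: t4I => t40 _; have [lt|gt|//] := ltrgtP t1 t4.
    by have := lo4 t1 t10 lt; rewrite sqd_rot_center h1 ltxx.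
  by have := lo1 t4 t40 gt; rewrite h4 ltxx.
have e23 : t2 = t3.
  case/andP: t2I => t20 _; case/andP: t3I => t30 _; have [lt|gt|//] := ltrgtP t2 t3.
    by have := lo3 t2 t20 lt; rewrite h2 ltxx.
  by have := lo2 t3 t30 gt; rewrite sqd_rot_center h3 ltxx.
have fix2 : rot (a + a) p (gp t1) = gp t1 by rewrite rotD [in RHS]e12 e23 e34 e14.
have np : gp t1 <> p by move=> e; move: r0; rewrite -h1 e sqdxx ltxx.
case/andP: a_in => a0 a2; have [lt|gt|] := ltrgtP (a + a) (pi *+ 2).
- by exfalso; apply: np; apply: (rot_fixed _ fix2); rewrite lt; lra.
- exfalso; apply: np; apply: (@rot_fixed _ (a + a - pi *+ 2)); first by rewrite mulr2n in a2 gt *; lra.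
  by apply: (@rot_inj _ (pi *+ 2) p); rewrite -rotD addrC subrK fix2 rot2pi.
by rewrite mulr2n; lra.
Qed.

Lemma arc_inner (l : R -> R) (b v : R) : continuous l -> 0 <= b ->
  (l 0 < v < l b) || (l b < v < l 0) -> exists2 t, 0 < t < b & l t = v.
Proof.
move=> cl b0 h; have [|t /andP[t0' tb] tE] := @continuous_ivt _ l 0 b v cl b0.
  by case/orP: h => /andP[/ltW-> /ltW->]; rewrite ?orbT.
exists t => //; rewrite !lt_neqAle t0' tb !andbT; apply/andP; split; apply/eqP => e.
  by move: h; rewrite e tE ltxx andbF.
by move: h; rewrite -e tE ltxx andbF.
Qed.

(** Both added arcs are half circles. Whatever the order of the end parameters, either two opposite
    points fall on one open half circle, or two complementary open half circles share a point. *)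
Lemma generator_interior_absurd (c : R -> P) (k k' : R -> R) : closed_param gamma c -> c 0 = p ->
  0 < t0 < 1 -> continuous k -> continuous k' ->
  (forall t, 0 <= t <= 1 -> c (k t) = f t) -> (forall t, 0 <= t <= 1 -> c (k' t) = rot a p (f t)) ->
  k t0 = 0 -> k' t0 = 0 ->
  (forall s t, 0 <= s -> s < t -> t <= 1 -> k s < k t) ->
  (forall s t, 0 <= s -> s < t -> t <= 1 -> k' t < k' s) -> False.
Proof.
move=> cp c0 t0I ck ck' kE k'E k0 k'0 inc dec.
have api := generator_half_turn cp c0 t0I ck ck' kE k'E k0 k'0 inc dec.
case/andP: t0I => t00 t01; have pi0 := @pi_gt0 R; have pi2 : 0 < (pi : R) < pi *+ 2 by rewrite mulr2n; lra.
have I0 : 0 <= (0 : R) <= 1 by rewrite lexx ler01.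
have I1 : 0 <= (1 : R) <= 1 by rewrite lexx ler01.
have It : 0 <= t0 <= 1 by rewrite !ltW.
have f1p : f 1 <> p by rewrite -ft0 => /(f_inj I1 It); lra.
have f0p : f 0 <> p by rewrite -ft0 => /(f_inj I0 It); lra.
have perD s : c (s + 1) = c s by rewrite -[1]/(1%:~R) (param_period cp).
have turn z : rot pi p (rot pi p z) = z by rewrite -rotD -mulr2n rot2pi.
have cin u v : c u = c v -> 0 < u < 1 -> 0 < v < 1 -> u = v.
  move=> e uI vI; apply: (param_inj_lt cp) => //; rewrite ltr_norml.
  by case/andP: uI; case/andP: vI => *; apply/andP; split; lra.
have b1 : 0 < k 1 by have := inc t0 1 (ltW t00) t01 (lexx _); rewrite k0.
have b2 : k 0 < 0 by have := inc 0 t0 (lexx _) t00 (ltW t01); rewrite k0.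
have b3 : k' 1 < 0 by have := dec t0 1 (ltW t00) t01 (lexx _); rewrite k'0.
have b4 : 0 < k' 0 by have := dec 0 t0 (lexx _) t00 (ltW t01); rewrite k'0.
have b5 := lift_length cp ck f_inj kE inc.
have b6 : k' 0 < k' 1 + 1.
  have cN : continuous (fun t => - k' t) by move=> t; apply: cvgN; exact: ck'.
  have := @lift_length (fun s => c (- s)) (fun t => - k' t) (fun t => rot a p (f t)) (param_reverse cp) cN.
  move=> h; have : - k' 1 < - k' 0 + 1; last by lra.
  apply: h.
  - by move=> s t sI tI /rot_inj; exact: f_inj.
  - by move=> t tI; rewrite opprK k'E.
  - by move=> s t *; rewrite ltrN2; apply: dec.
have [|t tI|l1 [cl1 l1E l10 l1I _]] := arc_span cp c0 pi2 (s1 := k 1); first lra.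
  by rewrite kE //; apply: arc1; rewrite api.
have [|t tI|l0 [cl0 l0E l00 l0I _]] := arc_span cp c0 pi2 (s1 := k 0 + 1); first lra.
  by rewrite perD kE //; apply: arc0; rewrite api.
rewrite kE // in l1E; rewrite perD kE // in l0E.
have pipi : 0 <= (pi : R) <= pi by lra.
have l1pi : l1 pi = k' 1 + 1.
  by apply: cin; [rewrite l1E // perD k'E // api|exact: l1I|lra].
have l0pi : l0 pi = k' 0.
  by apply: cin; [rewrite l0E // k'E // api|exact: l0I|lra].
have [lt|gt|eq] := ltrgtP (k 1) (k' 0).
- have [|t /andP[ta tb] tE] := @continuous_ivt _ k' 0 t0 (k 1) ck' (ltW t00).
    by rewrite k'0 (ltW b1) (ltW lt) orbT.
  have tI : 0 <= t <= 1 by rewrite ta (le_trans tb (ltW t01)).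
  have tn0 : 0 < t by rewrite lt_neqAle ta andbT; apply/eqP => e; rewrite -e in tE; rewrite tE ltxx in lt.
  have tn1 : t < t0 by rewrite lt_neqAle tb andbT; apply/eqP => e; rewrite e k'0 in tE; rewrite -tE ltxx in b1.
  have e1 : f 1 = rot a p (f t) by rewrite -kE // -tE k'E.
  have kt : k t < 0 by have := inc t t0 ta tn1 (ltW t01); rewrite k0.
  have k0t : k 0 < k t by apply: (inc 0 t (lexx _) tn0); case/andP: tI.
  have e2 : k' 1 + 1 = k t + 1.
    apply: cin; [|lra|lra].
    by rewrite !perD k'E // kE // e1 api turn.
  (* The half circle from [f 1] occupies the parameters from [k 1] to [k t + 1]; these contain
     [k 0 + 1], the point [f 0], and [k' 0], the point opposite to it. *)
  have [|u uI uE] := arc_inner cl1 (@pi_ge0 R) (v := k 0 + 1); first by rewrite l10 l1pi; lra.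
  have [|v vI vE] := arc_inner cl1 (@pi_ge0 R) (v := k' 0); first by rewrite l10 l1pi; lra.
  apply: (opposite_half_turns f1p vI uI).
  by rewrite addrC rotD -(l1E u (ltW2 uI)) -(l1E v (ltW2 vI)) uE vE ?perD ?kE ?k'E ?api.
- have [|t /andP[ta tb] tE] := @continuous_ivt _ k t0 1 (k' 0) ck (ltW t01).
    by rewrite k0 (ltW b4) (ltW gt).
  have tI : 0 <= t <= 1 by rewrite tb (le_trans (ltW t00) ta).
  have tn1 : t < 1 by rewrite lt_neqAle tb andbT; apply/eqP => e; rewrite e in tE; rewrite tE ltxx in gt.
  have tn0 : t0 < t by rewrite lt_neqAle ta andbT; apply/eqP => e; rewrite -e k0 in tE; rewrite -tE ltxx in b4.
  have e1 : f t = rot a p (f 0) by rewrite -kE // tE k'E.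
  have kt : k' t < 0 by have := dec t0 t (ltW t00) tn0 tb; rewrite k'0.
  have k0t : k' 1 < k' t by apply: (dec t 1 _ tn1 (lexx _)); case/andP: tI.
  have e2 : k 0 + 1 = k' t + 1.
    apply: cin; [|lra|lra].
    by rewrite !perD k'E // kE // e1 api turn.
  have [|u uI uE] := arc_inner cl0 (@pi_ge0 R) (v := k 1); first by rewrite l00 l0pi; lra.
  have [|v vI vE] := arc_inner cl0 (@pi_ge0 R) (v := k' 1 + 1); first by rewrite l00 l0pi; lra.
  apply: (opposite_half_turns f0p vI uI).
  by rewrite addrC rotD -(l0E u (ltW2 uI)) -(l0E v (ltW2 vI)) uE vE ?perD ?kE ?k'E ?api.
have e1 : f 1 = rot a p (f 0) by rewrite -kE // eq k'E.
have e2 : k 0 + 1 = k' 1 + 1.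
  apply: cin; [|lra|lra].
  by rewrite !perD k'E // kE // e1 api turn.
(* Both half circles now fill the same parameter interval, in opposite senses, so any inner
   parameter gives a common point. *)
pose m := (k 1 + (k 0 + 1)) / 2.
have [|u uI uE] := arc_inner cl1 (@pi_ge0 R) (v := m); first by rewrite l10 l1pi /m; lra.
have [|v vI vE] := arc_inner cl0 (@pi_ge0 R) (v := m); first by rewrite l00 l0pi /m; lra.
apply: (opposite_half_turns f0p vI uI).
rewrite rotD -api -e1 -l1E ?uE -?l0E ?vE //; lra.
Qed.

Lemma generator_endpoint (c : R -> P) : closed_param gamma c -> c 0 = p -> 0 <= t0 <= 1 ->
  t0 = 0 \/ t0 = 1.
Proof.
move=> cp c0 t0I; have [t00|n0] := eqVneq t0 0; first by left.
have [t01|n1] := eqVneq t0 1; first by right.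
exfalso; have {n0 n1}t0J : 0 < t0 < 1 by rewrite !lt_neqAle eq_sym n0 n1 t0I.
have [k [k' [[ck ck'] kE k'E [k0 k'0] [mk mk']]]] := lifted_pair cp c0 t0I.
wlog inc : c k k' cp c0 ck ck' kE k'E k0 k'0 mk mk' /
    (forall s t, 0 <= s -> s < t -> t <= 1 -> k s < k t).
  move=> w; case: (mk) => [inc|dec]; first exact: (w c k k').
  have cN (h : R -> R) : continuous h -> continuous (fun t => - h t).
    by move=> ch t; apply: cvgN; exact: ch.
  apply: (w (fun s => c (- s)) (fun t => - k t) (fun t => - k' t)) => //.
  - exact: param_reverse.
  - by rewrite oppr0.
  - exact: cN.
  - exact: cN.
  - by move=> t tI; rewrite opprK kE.
  - by move=> t tI; rewrite opprK k'E.
  - by rewrite k0 oppr0.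
  - by rewrite k'0 oppr0.
  - by left=> s t *; rewrite ltrN2; apply: dec.
  - by case: mk' => h; [right|left] => s t *; rewrite ltrN2; apply: h.
  - by move=> s t *; rewrite ltrN2; apply: dec.
case: mk' => [inc'|dec']; last exact: (generator_interior_absurd cp c0 t0J ck ck' kE k'E k0 k'0 inc dec').
case/andP: t0J => t00 t01.
apply: (@same_direction_absurd c p a (1 - t0) (fun t => f (t0 + 1 * t)) (fun t => k (t0 + 1 * t)) (fun t => k' (t0 + 1 * t))) => //.
- by lra.
- exact: continuous_affine.
- exact: continuous_affine.
- exact: continuous_affine.
- by rewrite mulr0 addr0.
- by rewrite mulr0 addr0.
- by rewrite mulr0 addr0.
- by rewrite mul1r addrC subrK -ft0 => /f_inj h; have := h ltac:(lra) ltac:(lra); lra.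
- by move=> t tI; rewrite kE //; lra.
- by move=> t tI; rewrite k'E //; lra.
- by move=> s t *; apply: inc; lra.
- by move=> s t *; apply: inc'; lra.
Qed.

End Generator.
End Endpoint.

(** * Normal form of a radially generated contour *)

Section Sector.
Variable R : realType.
Local Notation P := (R * R)%type.

(* A parametrization of [gamma = <eta, p, a>] starting at [p]: it runs along
   [eta] on [0, s1], along the arc on [s1, s2], and back along the rotated copy
   of [eta] on [s2, 1]; the rotation about [p] acts as the decreasing map [h]. *)
Definition sector_param (gamma : set P) (c : R -> P) (p : P) (a : R) (e : P)
    (s1 s2 : R) (h l : R -> R) : Prop :=
  [/\ [/\ closed_param gamma c, c 0 = p, e <> p & 0 < a < pi *+ 2],
    [/\ 0 < s1, s1 < s2 & s2 < 1],
    [/\ forall s : R, 0 <= s <= s1 -> s2 <= h s <= 1,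
        forall s : R, 0 <= s <= s1 -> c (h s) = rot a p (c s),
        forall s t : R, 0 <= s -> s < t -> t <= s1 -> h t < h s &
        forall u : R, s2 <= u <= 1 -> exists2 s : R, 0 <= s <= s1 & h s = u] &
    [/\ forall t : R, 0 <= t <= a -> s1 <= l t <= s2,
        forall t : R, 0 <= t <= a -> c (l t) = rot t p e,
        forall s t : R, 0 <= s -> s < t -> t <= a -> l s < l t &
        forall u : R, s1 <= u <= s2 -> exists2 t : R, 0 <= t <= a & l t = u]].

Section Construction.
Variables (gamma : set P) (p : P) (a : R) (f : R -> P).
Hypotheses (a_in : 0 < a < pi *+ 2) (cf : continuous f)
  (f_inj : forall s t, 0 <= s <= 1 -> 0 <= t <= 1 -> f s = f t -> s = t)
  (f_in : forall t, gamma (f t)) (fa_in : forall t, gamma (rot a p (f t)))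
  (arc1 : forall t, 0 <= t <= a -> gamma (rot t p (f 1)))
  (f0 : f 0 = p).

Lemma sector_oriented (c k k' : R -> _) : closed_param gamma c -> c 0 = p ->
  continuous k -> continuous k' ->
  (forall t, 0 <= t <= 1 -> c (k t) = f t) -> (forall t, 0 <= t <= 1 -> c (k' t) = rot a p (f t)) ->
  k 0 = 0 -> k' 0 = 0 ->
  (forall s t, 0 <= s -> s < t -> t <= 1 -> k s < k t) ->
  (forall s t, 0 <= s -> s < t -> t <= 1 -> k' t < k' s) ->
  exists s1 s2 h l, sector_param gamma c p a (f 1) s1 s2 h l.
Proof.
move=> cp c0 ck ck' kE k'E k0 k'0 inc dec; case/andP: (a_in) => a0 a2.
have I0 : 0 <= (0 : R) <= 1 by rewrite lexx ler01.
have I1 : 0 <= (1 : R) <= 1 by rewrite lexx ler01.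
have f1p : f 1 <> p by rewrite -f0 => /(f_inj I1 I0); lra.
have perD s : c (s + 1) = c s by rewrite -[1]/(1%:~R) (param_period cp).
have b1 : 0 < k 1 by rewrite -k0; apply: inc; lra.
have b3 : k' 1 < 0 by rewrite -k'0; apply: dec; lra.
have b5 : k 1 < 1 by have := lift_length cp ck f_inj kE inc; rewrite k0 add0r.
have b6 : 0 < k' 1 + 1.
  have cN : continuous (fun t => - k' t) by move=> t; apply: cvgN; exact: ck'.
  have := @lift_length _ gamma (fun s => c (- s)) (fun t => - k' t) (fun t => rot a p (f t)) (param_reverse cp) cN.
  move=> h; have : - k' 1 < - k' 0 + 1; last by rewrite k'0; lra.
  apply: h.
  - by move=> s t sI tI /rot_inj; exact: f_inj.
  - by move=> t tI; rewrite opprK k'E.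
  - by move=> s t *; rewrite ltrN2; apply: dec.
(* If the two branches met, the intermediate value theorem would give [k t = k' t + 1], a point of
   the curve fixed by the rotation; this is [p], so [t = 0], which is impossible. *)
have lt12 : k 1 < k' 1 + 1.
  rewrite ltNge; apply/negP => le.
  have cd : continuous (fun t => k t - k' t - 1).
    by move=> t; apply: cvgB; [apply: cvgB; [exact: ck|exact: ck']|exact: cvg_cst].
  have [|t tI tE] := @continuous_ivt _ _ 0 1 0 cd (@ler01 R); first by rewrite k0 k'0; lra.
  have fx : rot a p (f t) = f t.
    by rewrite -k'E // -kE //; have -> : k t = k' t + 1 by lra.
  have /(f_inj tI I0) t0 : f t = f 0 by rewrite f0; apply: rot_fixed fx.
  by move/eqP: tE; rewrite t0 k0 k'0 subr0 sub0r oppr_eq0 oner_eq0.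
have [||l [cl lE l0 lI mono]] := arc_span cp c0 a_in (s1 := k 1); first lra.
  by move=> t tI; rewrite kE //; apply: arc1.
rewrite kE // in lE.
have la : l a = k' 1 + 1.
  have aI : 0 <= a <= a by lra.
  apply: (param_inj_lt cp); first by rewrite lE // perD k'E.
  by have := lI a aI; rewrite ltr_norml => /andP[? ?]; apply/andP; split; lra.
have linc s t : 0 <= s -> s < t -> t <= a -> l s < l t.
  case: mono => [|dec']; first exact.
  by have := dec' 0 a (lexx _) a0 (lexx _); rewrite l0 la; lra.
have linc' s t : 0 <= s -> s <= t -> t <= a -> l s <= l t.
  move=> s0; rewrite le_eqVlt => /orP[/eqP -> //|st ta]; exact/ltW/linc.
have inc' s t : 0 <= s -> s <= t -> t <= 1 -> k s <= k t.
  move=> s0; rewrite le_eqVlt => /orP[/eqP -> //|st ta]; exact/ltW/inc.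
have dec' s t : 0 <= s -> s <= t -> t <= 1 -> k' t <= k' s.
  move=> s0; rewrite le_eqVlt => /orP[/eqP -> //|st ta]; exact/ltW/dec.
(* [g] inverts [k], so that the rotation can be read as a map of the parameter of [c]. *)
have /choice[g gE] : forall s, exists t, 0 <= s <= k 1 -> 0 <= t <= 1 /\ k t = s.
  move=> s; have [sI|] := boolP (0 <= s <= k 1); last by exists 0.
  have [|t tI tE] := @continuous_ivt _ k 0 1 s ck (@ler01 R); first by rewrite k0 sI.
  by exists t.
have gk t : 0 <= t <= 1 -> g (k t) = t.
  move=> tI; have [|gI gkE] := gE (k t).
    by case/andP: tI => *; rewrite -k0 !inc'.
  by apply: f_inj => //; rewrite -!kE // gkE.
exists (k 1), (k' 1 + 1), (fun s => k' (g s) + 1), l; split=> //; split=> //.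
- by lra.
- move=> s sI; have [/andP[g0 g1] gkE] := gE s sI.
  by rewrite lerD2r gerDr -k'0 !dec'.
- by move=> s sI; have [gI gkE] := gE s sI; rewrite perD k'E // -kE // gkE.
- move=> s t s0 st ts.
  have [|/andP[gs0 gs1] gsE] := gE s; first by lra.
  have [|/andP[gt0 gt1] gtE] := gE t; first by lra.
  rewrite ltrD2r; apply: dec => //; rewrite ltNge; apply/negP => le.
  by have := inc' _ _ gt0 le gs1; rewrite gsE gtE; lra.
- move=> u uI; have [|t tI tE] := @continuous_ivt _ k' 0 1 (u - 1) ck' (@ler01 R).
    by rewrite k'0; lra.
  exists (k t); first by case/andP: tI => *; rewrite -k0 !inc'.
  by rewrite gk // tE subrK.
- by move=> t /andP[t0 ta]; rewrite -l0 -la !linc'.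
- move=> u uI; have [|t tI tE] := @continuous_ivt _ l 0 a u cl (ltW a0); last by exists t.
  by rewrite l0 la uI.
Qed.

(** [same_direction_absurd] makes the curve and its rotated copy leave [p] in opposite directions;
    reversing [c] if necessary lets the curve come first. *)
Lemma sector_exists (c : R -> P) : closed_param gamma c -> c 0 = p ->
  exists c', (c' = c \/ c' = fun s => c (- s)) /\
    exists s1 s2 h l, sector_param gamma c' p a (f 1) s1 s2 h l.
Proof.
move=> cp c0; have I0 : 0 <= (0 : R) <= 1 by rewrite lexx ler01.
have I1 : 0 <= (1 : R) <= 1 by rewrite lexx ler01.
have f1p : f 1 <> p by rewrite -f0 => /(f_inj I1 I0); lra.
have [k [k' [[ck ck'] kE k'E [k0 k'0] [mk mk']]]] := lifted_pair cf f_inj f_in fa_in f0 cp c0 I0.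
have cN (h : R -> R) : continuous h -> continuous (fun t => - h t).
  by move=> ch t; apply: cvgN; exact: ch.
case: mk => mk; case: mk' => mk'.
- by exfalso; apply: (@same_direction_absurd _ c p a 1 f k k').
- by exists c; split; [left|exact: (sector_oriented cp c0 ck ck' kE k'E)].
- exists (fun s => c (- s)); split; first by right.
  apply: (@sector_oriented _ (fun t => - k t) (fun t => - k' t)) => //.
  + exact: param_reverse.
  + by rewrite oppr0.
  + exact: cN.
  + exact: cN.
  + by move=> t tI; rewrite opprK kE.
  + by move=> t tI; rewrite opprK k'E.
  + by rewrite k0 oppr0.
  + by rewrite k'0 oppr0.
  + by move=> s t *; rewrite ltrN2; apply: mk.
  + by move=> s t *; rewrite ltrN2; apply: mk'.
exfalso; apply: (@same_direction_absurd _ (fun s => c (- s)) p a 1 f (fun t => - k t) (fun t => - k' t)) => //.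
- exact: cN.
- exact: cN.
- by rewrite k0 oppr0.
- by rewrite k'0 oppr0.
- by move=> t tI; rewrite opprK kE.
- by move=> t tI; rewrite opprK k'E.
- by move=> s t *; rewrite ltrN2; apply: mk.
- by move=> s t *; rewrite ltrN2; apply: mk'.
Qed.

End Construction.

Theorem radially_generated_sector (T : tile R) eta p a (c : R -> P) :
  radially_generated T eta p a -> closed_param (tboundary T) c -> c 0 = p ->
  exists e c', (c' = c \/ c' = fun s => c (- s)) /\
    exists s1 s2 h l, sector_param (tboundary T) c' p a e s1 s2 h l.
Proof.
case=> -[ceta ieta] [t0 /= t0I t0E] a_in gE cp c0.
rewrite in_itv /= in t0I; have le01 : (0 : R) <= 1 by [].
pose f := eta \o clamp 0 1; have cf : continuous f by apply: within_clamp.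
have fE t : 0 <= t <= 1 -> f t = eta t by move=> tI; rewrite /f /= clamp_id.
have f_inj s t : 0 <= s <= 1 -> 0 <= t <= 1 -> f s = f t -> s = t.
  by move=> sI tI; rewrite !fE //; apply: ieta; rewrite inE /= in_itv.
have tr t : trace eta (f t) by exists (clamp 0 1 t) => //=; rewrite in_itv /= clamp_in.
have f_in t : tboundary T (f t) by rewrite gE; left; left; left.
have fa_in t : tboundary T (rot a p (f t)).
  by rewrite gE; left; left; right; exists (f t).
have I0 : 0 <= (0 : R) <= 1 by rewrite lexx ler01.
have I1 : 0 <= (1 : R) <= 1 by rewrite lexx ler01.
have a_in' : 0 < a < pi *+ 2 by rewrite -mulr_natl.
have arc0 t : 0 <= t <= a -> tboundary T (rot t p (f 0)).
  by move=> tI; rewrite gE fE //; left; right; exists t => //=; rewrite in_itv.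
have arc1 t : 0 <= t <= a -> tboundary T (rot t p (f 1)).
  by move=> tI; rewrite gE fE //; right; exists t => //=; rewrite in_itv.
have ft0 : f t0 = p by rewrite fE.
have [t00|t01] := generator_endpoint a_in' cf f_inj f_in fa_in arc0 arc1 ft0 cp c0 t0I.
  by exists (f 1); apply: sector_exists => //; rewrite -t00.
exists (f 0).
pose g t := f (1 + (-1) * t).
have -> : f 0 = g 1 by rewrite /g mulr1 subrr.
apply: (@sector_exists _ p a g) => //.
- exact: continuous_affine.
- by move=> s t sI tI /f_inj h; have := h ltac:(lra) ltac:(lra); lra.
- by move=> t; apply: f_in.
- by move=> t; apply: fa_in.
- by move=> t tI; rewrite /g mulr1 subrr; apply: arc0.
- by rewrite /g mulr0 addr0 -t01.
Qed.

End Sector.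

(** * Common points of circles *)

Section Circles.
Variable R : realType.
Local Notation P := (R * R)%type.

Lemma sumsq_eq0 (x y : R) : x ^+ 2 + y ^+ 2 = 0 -> x = 0 /\ y = 0.
Proof.
by move=> /eqP; rewrite paddr_eq0 ?sqr_ge0 // !sqrf_eq0 => /andP[/eqP -> /eqP ->].
Qed.

Lemma dot_ortho (a1 a2 d1 d2 b1 b2 : R) : (d1, d2) <> (0, 0) ->
  a1 * d1 + a2 * d2 = 0 -> b1 * d1 + b2 * d2 = 0 -> a1 * b2 = a2 * b1.
Proof.
move=> nd ea eb; apply/eqP; rewrite -subr_eq0; apply/negPn/negP => D; apply: nd.
have k : d1 * (a1 * b2 - a2 * b1) = 0.
  transitivity (b2 * (a1 * d1 + a2 * d2) - a2 * (b1 * d1 + b2 * d2)); first by ring.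
  by rewrite ea eb !mulr0 subrr.
have k' : d2 * (a1 * b2 - a2 * b1) = 0.
  transitivity (a1 * (b1 * d1 + b2 * d2) - b1 * (a1 * d1 + a2 * d2)); first by ring.
  by rewrite ea eb !mulr0 subrr.
by move/eqP: k; move/eqP: k'; rewrite !mulf_eq0 (negPf D) !orbF => /eqP -> /eqP ->.
Qed.

(** A line through a point of a circle meets it in at most one further point; here the point is the
    origin and [(x, y)] is the centre. *)
Lemma chord_unique (a1 a2 b1 b2 x y : R) : (a1, a2) <> (0, 0) -> (b1, b2) <> (0, 0) ->
  a1 * b2 = a2 * b1 -> a1 ^+ 2 + a2 ^+ 2 = 2 * (a1 * x + a2 * y) ->
  b1 ^+ 2 + b2 ^+ 2 = 2 * (b1 * x + b2 * y) -> (a1, a2) = (b1, b2).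
Proof.
have key u1 u2 v1 v2 : (u1, u2) <> (0, 0) -> u1 * v2 = u2 * v1 ->
    u1 ^+ 2 + u2 ^+ 2 = 2 * (u1 * x + u2 * y) -> v1 ^+ 2 + v2 ^+ 2 = 2 * (v1 * x + v2 * y) ->
    v1 ^+ 2 + v2 ^+ 2 = u1 * v1 + u2 * v2.
  move=> nu D eu ev; set m := u1 * v1 + u2 * v2.
  have nz : u1 ^+ 2 + u2 ^+ 2 != 0.
    by apply/eqP => /sumsq_eq0 [h1 h2]; apply: nu; rewrite h1 h2.
  have h1 : (u1 ^+ 2 + u2 ^+ 2) * v1 = u1 * m.
    by transitivity (u1 * (u1 * v1) + u2 * (u2 * v1)); [ring|rewrite -D /m; ring].
  have h2 : (u1 ^+ 2 + u2 ^+ 2) * v2 = u2 * m.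
    by transitivity (u1 * (u1 * v2) + u2 * (u2 * v2)); [ring|rewrite D /m; ring].
  apply: (mulfI nz); rewrite ev.
  transitivity (2 * ((u1 ^+ 2 + u2 ^+ 2) * v1 * x + (u1 ^+ 2 + u2 ^+ 2) * v2 * y)); first by ring.
  by rewrite h1 h2 eu; ring.
move=> na nb D ea eb; have k1 := key _ _ _ _ na D ea eb.
have k2 : a1 ^+ 2 + a2 ^+ 2 = b1 * a1 + b2 * a2.
  by apply: (key _ _ _ _ nb) => //; rewrite [LHS]mulrC -D mulrC.
have /sumsq_eq0 [h1 h2] : (a1 - b1) ^+ 2 + (a2 - b2) ^+ 2 = 0.
  transitivity (a1 ^+ 2 + a2 ^+ 2 + (b1 ^+ 2 + b2 ^+ 2) - 2 * (a1 * b1 + a2 * b2)); first by ring.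
  by rewrite k1 k2; ring.
by congr (_, _); apply/eqP; rewrite -subr_eq0 ?h1 ?h2.
Qed.

Lemma point_neq (u v : P) : u <> v -> (u.1 - v.1, u.2 - v.2) <> (0, 0).
Proof.
case: u v => [u1 u2] [v1 v2] uv [/= /eqP h1 /eqP h2]; apply: uv.
by rewrite !subr_eq0 in h1 h2; rewrite (eqP h1) (eqP h2).
Qed.

(** For different centres the chords from [v] to [u] and to [w] are both orthogonal to the line of
    centres, hence collinear, and [chord_unique] identifies [u] with [w]. *)
Lemma two_circles_center (z z' u v w : P) : u <> v -> v <> w -> u <> w ->
  sqd u z = sqd v z -> sqd w z = sqd v z -> sqd u z' = sqd v z' -> sqd w z' = sqd v z' -> z = z'.
Proof.
rewrite /sqd => uv vw uw e1 e2 e3 e4; have [//|/eqP zz] := eqVneq z z'.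
exfalso; apply: uw.
have wv : w <> v by move=> e; apply: vw.
have D := dot_ortho (point_neq zz) (a1 := u.1 - v.1) (a2 := u.2 - v.2)
  (b1 := w.1 - v.1) (b2 := w.2 - v.2) ltac:(lra) ltac:(lra).
have := chord_unique (x := z.1 - v.1) (y := z.2 - v.2) (point_neq uv) (point_neq wv) D ltac:(lra) ltac:(lra).
case: u v w {uv vw e1 e2 e3 e4 wv D} => [u1 u2] [v1 v2] [w1 w2] [/= h1 h2].
by rewrite -(subrK v1 u1) -(subrK v2 u2) h1 h2 !subrK.
Qed.

(** The points lie on the circle about [z] and on its copy turned by [- a] about [p], both passing
    through [p]. A third common point would make the centres equal, so the rotation would fix
    [z]. *)
Lemma rotated_circle_meet (a : R) (z p u v : P) : 0 < a < pi *+ 2 -> z <> p -> u <> p -> v <> p ->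
  sqd u z = sqd p z -> sqd (rot a p u) z = sqd p z ->
  sqd v z = sqd p z -> sqd (rot a p v) z = sqd p z -> u = v.
Proof.
move=> a_in zp up vp e1 e2 e3 e4; set z' := rot (- a) p z.
have zE : rot a p z' = z by rewrite /z' rotNK.
have f2 : sqd u z' = sqd p z' by rewrite -(sqd_rot a p u) -(sqd_rot a p p) zE rot_center.
have f4 : sqd v z' = sqd p z' by rewrite -(sqd_rot a p v) -(sqd_rot a p p) zE rot_center.
have [//|/eqP uv] := eqVneq u v; exfalso.
have zz : z = z' by apply: (two_circles_center up (w := v)) => // e; apply: vp.
by apply: zp; apply: (rot_fixed a_in); rewrite {1}zz.
Qed.

End Circles.

(** * Sectors *)

Section SectorTheory.
Variable R : realType.
Local Notation P := (R * R)%type.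
Variables (gamma : set P) (c : R -> P) (p : P) (a : R) (e : P) (s1 s2 : R) (h l : R -> R).
Hypothesis sp : sector_param gamma c p a e s1 s2 h l.

Lemma sector_cp : closed_param gamma c. Proof. by case: sp => [[]]. Qed.
Lemma sector_c0 : c 0 = p. Proof. by case: sp => [[]]. Qed.
Lemma sector_ep : e <> p. Proof. by case: sp => [[]]. Qed.
Lemma sector_a_in : 0 < a < pi *+ 2. Proof. by case: sp => [[]]. Qed.
Lemma sector_ineqs : [/\ 0 < s1, s1 < s2, s2 < 1, 0 < a & a < pi *+ 2].
Proof. by case: sp => _ [? ? ?] _ _; case/andP: sector_a_in. Qed.

Lemma sector_hI (s : R) : 0 <= s <= s1 -> s2 <= h s <= 1. Proof. by case: sp => _ _ [+ _ _ _] _; apply. Qed.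
Lemma sector_hE (s : R) : 0 <= s <= s1 -> c (h s) = rot a p (c s). Proof. by case: sp => _ _ [_ + _ _] _; apply. Qed.
Lemma sector_h_dec (s t : R) : 0 <= s -> s < t -> t <= s1 -> h t < h s. Proof. by case: sp => _ _ [_ _ + _] _; apply. Qed.
Lemma sector_h_onto (u : R) : s2 <= u <= 1 -> exists2 s : R, 0 <= s <= s1 & h s = u.
Proof. by case: sp => _ _ [_ _ _ +] _; apply. Qed.
Lemma sector_lI (t : R) : 0 <= t <= a -> s1 <= l t <= s2. Proof. by case: sp => _ _ _ [+ _ _ _]; apply. Qed.
Lemma sector_lE (t : R) : 0 <= t <= a -> c (l t) = rot t p e. Proof. by case: sp => _ _ _ [_ + _ _]; apply. Qed.
Lemma sector_l_inc (s t : R) : 0 <= s -> s < t -> t <= a -> l s < l t. Proof. by case: sp => _ _ _ [_ _ + _]; apply. Qed.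
Lemma sector_l_onto (u : R) : s1 <= u <= s2 -> exists2 t : R, 0 <= t <= a & l t = u.
Proof. by case: sp => _ _ _ [_ _ _ +]; apply. Qed.

Lemma sector_h0 : h 0 = 1.
Proof.
have [s1_gt0 s12 s2_lt1 a0 a2] := sector_ineqs.
have [s sI sE] : exists2 s : R, 0 <= s <= s1 & h s = 1 by apply: sector_h_onto; lra.
have [s0|//] := eqVneq s 0; first by rewrite -s0.
by move=> ns; have := sector_hI (s := 0); have := @sector_h_dec 0 s; rewrite sE; lra.
Qed.

Lemma sector_hs1 : h s1 = s2.
Proof.
have [s1_gt0 s12 s2_lt1 a0 a2] := sector_ineqs.
have [s sI sE] : exists2 s : R, 0 <= s <= s1 & h s = s2 by apply: sector_h_onto; lra.
have [s0|ns] := eqVneq s s1; first by rewrite -s0.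
by have := sector_hI (s := s1); have := @sector_h_dec s s1; rewrite sE; lra.
Qed.

Lemma sector_l0 : l 0 = s1.
Proof.
have [s1_gt0 s12 s2_lt1 a0 a2] := sector_ineqs.
have [t tI tE] : exists2 t : R, 0 <= t <= a & l t = s1 by apply: sector_l_onto; lra.
have [t0|nt] := eqVneq t 0; first by rewrite -t0.
by have := @sector_lI 0; have := @sector_l_inc 0 t; rewrite tE; lra.
Qed.

Lemma sector_la : l a = s2.
Proof.
have [s1_gt0 s12 s2_lt1 a0 a2] := sector_ineqs.
have [t tI tE] : exists2 t : R, 0 <= t <= a & l t = s2 by apply: sector_l_onto; lra.
have [ta|nt] := eqVneq t a; first by rewrite -ta.
by have := @sector_lI a; have := @sector_l_inc t a; rewrite tE; lra.
Qed.

Lemma sector_cs1 : c s1 = e.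
Proof. have [? ? ? ? ?] := sector_ineqs; by rewrite -sector_l0 sector_lE ?rot0 //; lra. Qed.

Lemma sector_cs2 : c s2 = rot a p e.
Proof. have [? ? ? ? ?] := sector_ineqs; rewrite -sector_hs1 sector_hE ?sector_cs1 //; lra. Qed.

Lemma sector_h_inj (s t : R) : 0 <= s <= s1 -> 0 <= t <= s1 -> h s = h t -> s = t.
Proof.
have [s1_gt0 s12 s2_lt1 a0 a2] := sector_ineqs.
move=> sI tI ht; have [lt|gt|//] := ltrgtP s t.
  by have := @sector_h_dec s t; rewrite ht; lra.
by have := @sector_h_dec t s; rewrite ht; lra.
Qed.

(** A prolongation entering the arc repeats its points at other angles. One entering the first
    branch is turned by [a] both onto the second branch and onto the inner part of the arc, which
    are disjoint. *)
Lemma sector_end_before (b : R) : 0 < b -> (forall t : R, 0 <= t <= b -> gamma (rot (- t) p e)) -> False.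
Proof.
have [s1_gt0 s12 s2_lt1 a0 a2] := sector_ineqs.
move=> b0 hb.
pose b' := Num.min b (Num.min a ((pi *+ 2 - a) / 2)).
have b'0 : 0 < b' by rewrite !lt_min b0 a0 /= divr_gt0 // subr_gt0.
have b'b : b' <= b by rewrite ge_min lexx.
have b'a : b' <= a by rewrite !ge_min lexx orbT.
have b'2 : b' <= (pi *+ 2 - a) / 2 by rewrite !ge_min lexx !orbT.
pose f t := rot (- clamp 0 b' t) p e.
have cf : continuous f.
  move=> t; apply: (@continuous_comp _ _ _ (fun t => - clamp 0 b' t) (fun t => rot t p e)).
    by apply: cvgN; exact: clamp_continuous.
  exact: rot_continuous_theta.
have fE t : 0 <= t <= b' -> f t = rot (- t) p e by move=> ta; rewrite /f clamp_id.
have [||||k [ck kE k0 mono]] := @arc_lift _ gamma c sector_cp f 0 b' s1 cf _ b'0 _ 0.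
- by move=> t; apply: hb; have := @clamp_in _ 0 b' t (ltW b'0); lra.
- move=> s t sI tI; rewrite !fE // => /(rot_theta_inj sector_ep) h'; apply: oppr_inj; apply: h'.
  by rewrite ltr_norml; lra.
- by rewrite lexx ltW.
- by rewrite fE ?lexx ?ltW // oppr0 rot0 sector_cs1.
have kb' t : 0 <= t <= b' -> c (k t) = rot (- t) p e by move=> tI; rewrite kE // fE.
case: mono => mono.
  pose v := Num.min (k b') s2.
  have v1 : s1 < v by rewrite lt_min s12 -k0 mono.
  have v2 : v <= s2 by rewrite ge_min lexx orbT.
  have v3 : v <= k b' by rewrite ge_min lexx.
  have [|t tI tE] := continuous_ivt ck (ltW b'0) (v := v); first by rewrite k0; lra.
  have [|s sI sE] := @sector_l_onto v; first lra.
  have t0 : t != 0 by apply/eqP => t0; move: tE; rewrite t0 k0; lra.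
  have : rot (- t) p e = rot s p e by rewrite -kb' // tE -sE sector_lE.
  by move=> /(rot_theta_inj sector_ep) h'; have := h' ltac:(rewrite ltr_norml; lra); lra.
pose v := Num.max (k b') (s1 / 2).
have v1 : v < s1 by rewrite gt_max -{1}k0 mono //; lra.
have v2 : s1 / 2 <= v by rewrite le_max lexx orbT.
have v3 : k b' <= v by rewrite le_max lexx.
have [|t tI tE] := continuous_ivt ck (ltW b'0) (v := v); first by rewrite k0; lra.
have t0 : t != 0 by apply/eqP => t0; move: tE; rewrite t0 k0; lra.
have vI : 0 <= v <= s1 by lra.
have atI : 0 <= a - t <= a by lra.
have := sector_hI vI; have := sector_lI atI => l1 l2.
have e1 : h v = l (a - t).
  apply: (param_inj_lt sector_cp); last by rewrite ltr_norml; lra.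
  by rewrite sector_hE // sector_lE // rotD -kb' // tE.
by have := @sector_l_inc (a - t) a; rewrite sector_la -e1; lra.
Qed.

(** Turned back by [a], a prolongation into the second branch would lie on the first branch and on
    the arc at once, hence at their common end [e]. *)
Lemma sector_end_after (b : R) : 0 < b -> (forall t : R, 0 <= t <= b -> gamma (rot (a + t) p e)) -> False.
Proof.
have [s1_gt0 s12 s2_lt1 a0 a2] := sector_ineqs.
move=> b0 hb.
pose b' := Num.min b (Num.min a ((pi *+ 2 - a) / 2)).
have b'0 : 0 < b' by rewrite !lt_min b0 a0 /= divr_gt0 // subr_gt0.
have b'b : b' <= b by rewrite ge_min lexx.
have b'a : b' <= a by rewrite !ge_min lexx orbT.
have b'2 : b' <= (pi *+ 2 - a) / 2 by rewrite !ge_min lexx !orbT.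
pose f t := rot (a + clamp 0 b' t) p e.
have cf : continuous f.
  move=> t; apply: (@continuous_comp _ _ _ (fun t => a + clamp 0 b' t) (fun t => rot t p e)).
    by apply: cvgD; [exact: cvg_cst|exact: clamp_continuous].
  exact: rot_continuous_theta.
have fE t : 0 <= t <= b' -> f t = rot (a + t) p e by move=> ta; rewrite /f clamp_id.
have [||||k [ck kE k0 mono]] := @arc_lift _ gamma c sector_cp f 0 b' s2 cf _ b'0 _ 0.
- by move=> t; apply: hb; have := @clamp_in _ 0 b' t (ltW b'0); lra.
- move=> s t sI tI; rewrite !fE // => /(rot_theta_inj sector_ep) h'; apply: (addrI a); apply: h'.
  by rewrite ltr_norml; lra.
- by rewrite lexx ltW.
- by rewrite fE ?lexx ?ltW // addr0 sector_cs2.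
have kb' t : 0 <= t <= b' -> c (k t) = rot (a + t) p e by move=> tI; rewrite kE // fE.
case: mono => mono.
  pose v := Num.min (k b') ((s2 + 1) / 2).
  have v1 : s2 < v by rewrite lt_min -{1}k0 mono //; lra.
  have v2 : v <= (s2 + 1) / 2 by rewrite ge_min lexx orbT.
  have v3 : v <= k b' by rewrite ge_min lexx.
  have [|t tI tE] := continuous_ivt ck (ltW b'0) (v := v); first by rewrite k0; lra.
  have [|s sI sE] := @sector_h_onto v; first lra.
  have tI' : 0 <= t <= a by lra.
  have es : c s = c (l t).
    by rewrite sector_lE //; apply: (@rot_inj _ a p); rewrite -sector_hE // sE -rotD -kb' // tE.
  have lt := sector_lI tI'.
  have := param_inj_lt sector_cp es ltac:(rewrite ltr_norml; lra) => e1.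
  have e2 : s = s1 by lra.
  by move: sE; rewrite e2 sector_hs1; lra.
pose v := Num.max (k b') s1.
have v1 : v < s2 by rewrite gt_max -{1}k0 mono //; lra.
have v2 : s1 <= v by rewrite le_max lexx orbT.
have v3 : k b' <= v by rewrite le_max lexx.
have [|t tI tE] := continuous_ivt ck (ltW b'0) (v := v); first by rewrite k0; lra.
have [|s sI sE] := @sector_l_onto v; first lra.
have t0 : t != 0 by apply/eqP => t0; move: tE; rewrite t0 k0; lra.
have : rot (a + t) p e = rot s p e by rewrite -kb' // tE -sE sector_lE.
by move=> /(rot_theta_inj sector_ep) h'; have := h' ltac:(rewrite ltr_norml; lra); lra.
Qed.

End SectorTheory.

(** * Circular arcs inside a closed curve *)

Section ArcPath.
Variable R : realType.
Local Notation P := (R * R)%type.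

(* The last clause stands for the continuity of the lift [m] of the arc; unlike
   continuity it is visibly preserved by the maps [h] of [sector_param]. *)
Definition arc_path (c : R -> P) (d : R) (z w : P) (up : bool) (m : R -> R) : Prop :=
  [/\ forall t : R, 0 <= t <= d -> c (m t) = rot t z w,
      forall s t : R, 0 <= s -> s < t -> t <= d -> if up then m s < m t else m t < m s &
      forall v : R, (m 0 <= v <= m d) || (m d <= v <= m 0) -> exists2 t : R, 0 <= t <= d & m t = v].

Lemma arc_path_shift c d z w up m (x : R) : arc_path c d z w up m ->
  arc_path (fun s => c (s + x)) d z w up (fun t => m t - x).
Proof.
case=> mE mono ivt; split.
- by move=> t tI; rewrite subrK mE.
- by move=> s t h1 h2 h3; have := mono s t h1 h2 h3; case: up {mono}; rewrite ltrD2r.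
move=> v vI; have [|t tI tE] := ivt (v + x); first by case/orP: vI => /andP[? ?]; apply/orP; [left|right]; lra.
by exists t => //; rewrite tE addrK.
Qed.

Lemma arc_path_reverse c d z w up m : arc_path c d z w up m ->
  arc_path (fun s => c (- s)) d z w (~~ up) (fun t => - m t).
Proof.
case=> mE mono ivt; split.
- by move=> t tI; rewrite opprK mE.
- by move=> s t h1 h2 h3; have := mono s t h1 h2 h3; case: up {mono}; rewrite /= ltrN2.
move=> v vI; have [|t tI tE] := ivt (- v); first by case/orP: vI => /andP[? ?]; apply/orP; [right|left]; lra.
by exists t => //; rewrite tE opprK.
Qed.

Lemma arc_path_ext c c' d z w up m : (forall s, c s = c' s) -> arc_path c d z w up m -> arc_path c' d z w up m.
Proof. by move=> cE [mE mono ivt]; split=> // t tI; rewrite -cE mE. Qed.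

Section Path.
Variables (gamma : set P) (c : R -> P).
Hypothesis cp : closed_param gamma c.

Lemma arc_path_translate d z w up m (n : int) : arc_path c d z w up m ->
  arc_path c d z w up (fun t => m t + n%:~R).
Proof.
case=> mE mono ivt; split.
- by move=> t tI; rewrite (param_period cp) mE.
- by move=> s t h1 h2 h3; have := mono s t h1 h2 h3; case: up {mono}; rewrite ltrD2r.
move=> v vI; have [|t tI tE] := ivt (v - n%:~R); first by case/orP: vI => /andP[? ?]; apply/orP; [left|right]; lra.
by exists t => //; rewrite tE subrK.
Qed.

Lemma arc_path_exists d z w : w <> z -> 0 < d < pi *+ 2 ->
  (forall t, 0 <= t <= d -> gamma (rot t z w)) -> exists up m, arc_path c d z w up m.
Proof.
move=> wz /andP[d0 d2] hg.
pose f t := rot (clamp 0 d t) z w.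
have cf : continuous f.
  move=> t; apply: (@continuous_comp _ _ _ (clamp 0 d) (fun t => rot t z w)).
    exact: clamp_continuous.
  exact: rot_continuous_theta.
have fE t : 0 <= t <= d -> f t = rot t z w by move=> ta; rewrite /f clamp_id.
have [s0 s0E] : exists s0, c s0 = f 0.
  by apply/(param_range cp); apply: hg; apply: clamp_in; exact: ltW.
have [|||k [ck kE k0 mono]] := @arc_lift _ gamma c cp f 0 d s0 cf _ d0 _ 0 _ s0E.
- by move=> t; apply: hg; apply: clamp_in; exact: ltW.
- move=> s t sI tI; rewrite !fE // => /(rot_theta_inj wz); apply.
  by rewrite ltr_norml; lra.
- by rewrite lexx ltW.
have mE t : 0 <= t <= d -> c (k t) = rot t z w by move=> tI; rewrite kE // fE.
case: mono => mono; [exists true|exists false]; exists k; split=> // v vI;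
  by have [t tI tE] := continuous_ivt ck (ltW d0) vI; exists t.
Qed.

Section Fixed.
Variables (d : R) (z w : P) (up : bool) (m : R -> R).
Hypotheses (d0 : 0 < d) (ap : arc_path c d z w up m).

Lemma arc_path_between (s t v : R) : 0 <= s -> s < t -> t <= d -> (m s < v < m t) || (m t < v < m s) ->
  exists2 r : R, s < r < t & m r = v.
Proof.
case: ap => _ mono ivt s0 st td vI.
have mono' r r' : 0 <= r -> r <= r' -> r' <= d -> if up then m r <= m r' else m r' <= m r.
  move=> h; rewrite le_eqVlt => /orP[/eqP ->|lt]; first by rewrite lexx if_same.
  by move=> h'; have := mono _ _ h lt h'; case: up => /ltW.
have h1 := mono' 0 s (lexx _) s0 ltac:(lra); have h2 := mono' t d ltac:(lra) td (lexx _).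
have h3 := mono s t s0 st td.
have [|r rI rE] := ivt v.
  move/orP: vI; case: up h1 h2 h3 {mono mono'} => h1 h2 h3 [] vI; apply/orP; by [left; lra|right; lra].
exists r => //; rewrite !ltNge; apply/andP; split; apply/negP => le.
  by have := mono' r s ltac:(lra) le ltac:(lra); move/orP: vI; case: up h1 h2 h3 {mono mono'} => h1 h2 h3 []; lra.
by have := mono' t r ltac:(lra) le ltac:(lra); move/orP: vI; case: up h1 h2 h3 {mono mono'} => h1 h2 h3 []; lra.
Qed.

Lemma arc_path_avoid (v : R) : (forall t : R, 0 < t < d -> m t <> v) ->
  (forall t : R, 0 <= t <= d -> m t <= v) \/ (forall t : R, 0 <= t <= d -> v <= m t).
Proof.
move=> av; case: (ap) => _ mono _.
have [up'|dn] := boolP up.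
  have le s t : 0 <= s -> s <= t -> t <= d -> m s <= m t.
    by move=> h; rewrite le_eqVlt => /orP[/eqP ->//|lt] h'; have := mono _ _ h lt h'; rewrite up' => /ltW.
  have [h|h] := leP (m d) v; [left|right] => t tI; first by have := le t d; lra.
  have [h'|h'] := leP v (m 0); first by have := le 0 t; lra.
  by have [|r rI rE] := @arc_path_between 0 d v (lexx _) d0 (lexx _); [apply/orP; left; lra|case: (av r)].
have le s t : 0 <= s -> s <= t -> t <= d -> m t <= m s.
  by move=> h; rewrite le_eqVlt => /orP[/eqP ->//|lt] h'; have := mono _ _ h lt h'; rewrite (negPf dn) => /ltW.
have [h|h] := leP (m 0) v; [left|right] => t tI; first by have := le 0 t; lra.
have [h'|h'] := leP v (m d); first by have := le t d; lra.
by have [|r rI rE] := @arc_path_between 0 d v (lexx _) d0 (lexx _); [apply/orP; right; lra|case: (av r)].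
Qed.

Lemma arc_path_nbhs (r : R) : 0 < r < d -> exists2 eps : R, 0 < eps &
  forall v : R, `|v - m r| < eps -> exists2 t : R, 0 < t < d & m t = v.
Proof.
move=> rI; case: (ap) => _ mono _.
have h1 := mono 0 r (lexx _) ltac:(lra) ltac:(lra); have h2 := mono r d ltac:(lra) ltac:(lra) (lexx _).
have [up'|dn] := boolP up; [rewrite up' in h1 h2|rewrite (negPf dn) in h1 h2].
  exists (Num.min (m r - m 0) (m d - m r)); first by rewrite lt_min !subr_gt0 h1.
  move=> v; rewrite lt_min !ltr_norml => /andP[v1 v2].
  by apply: (@arc_path_between 0 d v (lexx _) d0 (lexx _)); apply/orP; left; lra.
exists (Num.min (m 0 - m r) (m r - m d)); first by rewrite lt_min !subr_gt0 h1.
move=> v; rewrite lt_min !ltr_norml => /andP[v1 v2].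
by apply: (@arc_path_between 0 d v (lexx _) d0 (lexx _)); apply/orP; right; lra.
Qed.

Lemma arc_path_circle (t : R) : 0 <= t <= d -> sqd (c (m t)) z = sqd w z.
Proof. by case: ap => mE _ _ tI; rewrite mE // sqd_rot_center. Qed.

End Fixed.
End Path.
End ArcPath.

Section Moves.
Variable R : realType.
Local Notation P := (R * R)%type.

Definition turn (pos : bool) (a : R) : R := if pos then a else - a.

(** The partial involution on parameters; [pos] records whether it turns by [a], from the first
    branch to the second, or back. *)
Definition sector_move (s1 : R) (h : R -> R) (pos : bool) (u u' : R) : Prop :=
  if pos then 0 <= u <= s1 /\ u' = h u else 0 <= u' <= s1 /\ u = h u'.

Definition open_arc (d : R) (z w : P) : set P :=
  [set Q | exists2 t : R, 0 < t < d & rot t z w = Q].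

Variables (gamma : set P) (c : R -> P) (p : P) (a : R) (e : P) (s1 s2 : R) (h l : R -> R).
Hypothesis sp : sector_param gamma c p a e s1 s2 h l.
Let cp := sector_cp sp.

Definition first_branch (Q : P) := exists2 s : R, 0 < s <= s1 & c s = Q.
Definition second_branch (Q : P) := exists2 s : R, s2 <= s < 1 & c s = Q.

Lemma sector_param_eq (s t : R) : c s = c t -> 0 <= s < 1 -> 0 <= t < 1 -> s = t.
Proof. by move=> st sI tI; apply: (param_inj_lt cp st); rewrite ltr_norml; lra. Qed.

Lemma branches_disjoint Q : first_branch Q -> second_branch Q -> False.
Proof.
have [? ? ? ? ?] := sector_ineqs sp; move=> [s sI <-] [t tI tE]; have e' := sector_param_eq tE.
by have := e' ltac:(lra) ltac:(lra); lra.
Qed.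

Lemma first_branch_open_arc Q : first_branch Q -> open_arc a p e Q -> False.
Proof.
have [? ? ? ? ?] := sector_ineqs sp; move=> [s sI <-] [t tI tE].
have tI' : 0 <= t <= a by lra.
have e' := sector_param_eq (s := l t) (t := s) (etrans (sector_lE sp tI') tE).
have lI := sector_lI sp tI'; have := sector_l_inc sp (s := 0) (t := t) (lexx _) ltac:(lra) ltac:(lra).
by rewrite (sector_l0 sp); have := e' ltac:(lra) ltac:(lra); lra.
Qed.

Lemma second_branch_open_arc Q : second_branch Q -> open_arc a p e Q -> False.
Proof.
have [? ? ? ? ?] := sector_ineqs sp; move=> [s sI <-] [t tI tE].
have tI' : 0 <= t <= a by lra.
have e' := sector_param_eq (s := l t) (t := s) (etrans (sector_lE sp tI') tE).
have lI := sector_lI sp tI'; have := sector_l_inc sp (s := t) (t := a) ltac:(lra) ltac:(lra) (lexx _).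
by rewrite (sector_la sp); have := e' ltac:(lra) ltac:(lra); lra.
Qed.

Lemma sector_h_lt1 (s : R) : 0 < s <= s1 -> s2 <= h s < 1.
Proof.
have [? ? ? ? ?] := sector_ineqs sp; move=> sI; have sI' : 0 <= s <= s1 by lra.
have := sector_hI sp sI'; have := sector_h_dec sp (s := 0) (t := s) (lexx _) ltac:(lra) ltac:(lra).
by rewrite (sector_h0 sp); lra.
Qed.

Lemma sector_move_branches pos u u' Q : sector_move s1 h pos u u' -> c u = Q -> Q <> p ->
  c u' = rot (turn pos a) p Q /\
  if pos then first_branch Q /\ second_branch (c u') else second_branch Q /\ first_branch (c u').
Proof.
have [? ? ? ? ?] := sector_ineqs sp.
case: pos => /= -[uI -> <-] np.
  split; first exact: (sector_hE sp).
  have u0 : 0 < u by rewrite lt_neqAle andbC; case/andP: uI => -> _ /=; apply/eqP => u0; apply: np; rewrite -u0; exact: (sector_c0 sp).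
  split; first by exists u => //; lra.
  by exists (h u) => //; apply: sector_h_lt1; lra.
split; first by rewrite /turn (sector_hE sp) // rotK.
have u0 : 0 < u'.
  rewrite lt_neqAle andbC; case/andP: uI => -> _ /=; apply/eqP => u0; apply: np.
  by rewrite -u0 (sector_h0 sp); exact: (param_c1 cp (sector_c0 sp)).
split; last by exists u' => //; lra.
by exists (h u') => //; apply: sector_h_lt1; lra.
Qed.

Section Path.
Variables (d : R) (z w : P) (up : bool) (m : R -> R).
Hypotheses (d0 : 0 < d) (wz : w <> z) (ap : arc_path c d z w up m).

(** If [p] were inside such an arc, both branches near [p] would lie on one circle. Two points of
    the first branch and their images under the rotation would then all be on it, against
    [rotated_circle_meet]. *)
Lemma sector_germ (t : R) : 0 < t < d -> rot t z w <> p.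
Proof.
have [? ? ? ? ?] := sector_ineqs sp; move=> tI tp.
have zp : z <> p by move=> zp; apply: wz; rewrite -zp -{2}(rot_center t z) in tp; exact: rot_inj tp.
have tI' : 0 <= t <= d by lra.
have mt : c (m t) = p by case: ap => -> //; exact: tp.
have [n nE] : exists n : int, m t = n%:~R.
  have [|n nE] := param_inj cp (s := m t) (t := 0); first by rewrite mt (sector_c0 sp).
  by exists n; rewrite nE add0r.
have ap' := arc_path_translate cp (- n) ap.
have mt0 : m t + (- n)%:~R = 0 by rewrite nE mulrNz subrr.
have [eps eps0] := arc_path_nbhs d0 ap' tI; rewrite mt0 => near.
have circ (v : R) : `|v| < eps -> sqd (c v) z = sqd p z.
  move=> vI; have [|r rI /= <-] := near v; first by rewrite subr0.
  have /= -> := arc_path_circle ap' (t := r) ltac:(lra).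
  by rewrite -mt (arc_path_circle ap).
pose v1 := Num.max (1 - eps) s2.
have v11 : v1 < 1 by rewrite gt_max; apply/andP; split; lra.
have v12 : s2 <= v1 by rewrite le_max lexx orbT.
have v13 : 1 - eps <= v1 by rewrite le_max lexx.
have [|t1 t1I t1E] := sector_h_onto sp (u := v1); first lra.
have t10 : 0 < t1.
  rewrite lt_neqAle andbC; case/andP: t1I => -> _ /=; apply/eqP => t10.
  by move: v11; rewrite -t1E -t10 (sector_h0 sp) ltxx.
pose s := Num.min t1 eps / 2.
have s0 : 0 < s by rewrite divr_gt0 // lt_min t10.
have m1 : Num.min t1 eps <= t1 by rewrite ge_min lexx.
have m2 : Num.min t1 eps <= eps by rewrite ge_min lexx orbT.
have st1 : s < t1 by rewrite /s; lra.
have seps : s < eps by rewrite /s; lra.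
have good (r : R) : 0 < r <= s -> [/\ c r <> p, sqd (c r) z = sqd p z & sqd (rot a p (c r)) z = sqd p z].
  move=> rI; split.
  - by rewrite -(sector_c0 sp) => /sector_param_eq h'; have := h' ltac:(lra) ltac:(lra); lra.
  - by apply: circ; rewrite ltr_norml; lra.
  rewrite -(sector_hE sp); last lra.
  rewrite -[c (h r)](param_period cp _ (- 1)); apply: circ.
  have /sector_h_lt1 : 0 < r <= s1 by lra.
  have := sector_h_dec sp (s := r) (t := t1) ltac:(lra) ltac:(lra) ltac:(lra); rewrite t1E mulrNz ltr_norml; lra.
have [|n1 e1 f1] := good s; first lra.
have [|n2 e2 f2] := good (s / 2); first lra.
have := rotated_circle_meet (sector_a_in sp) zp n1 n2 e1 f1 e2 f2.
by move=> /sector_param_eq h'; have := h' ltac:(lra) ltac:(lra); lra.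
Qed.

(** By [sector_germ] the arc does not cross [p], and by hypothesis it avoids the arc about [p], so
    it stays in one branch. The transporting map is decreasing, so the direction along the curve
    flips. *)
Lemma sector_step : (forall t : R, 0 < t < d -> ~ open_arc a p e (rot t z w)) ->
  exists pos (n : int) m',
    arc_path c d (rot (turn pos a) p z) (rot (turn pos a) p w) (~~ up) m' /\
    forall t : R, 0 <= t <= d -> sector_move s1 h pos (m t + n%:~R) (m' t).
Proof.
move=> nov; have [s10 s12 s21 a0 a2] := sector_ineqs sp.
(* The translate that places the middle of the arc in the period from 0 to 1. *)
pose n := - Num.floor (m (d / 2)).
have apM := arc_path_translate cp n ap; pose M t := m t + n%:~R; rewrite -/M in apM.
have Mmid : 0 <= M (d / 2) < 1.
  by have := floor_itv (m (d / 2)); rewrite /M /n intrD mulrNz mulr1z => /andP[h1 h2]; apply/andP; split; lra.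
have d0' := d0; have dI : 0 < d / 2 < d by lra.
have ME t : 0 <= t <= d -> c (M t) = rot t z w by case: apM => h' _ _; exact: h'.
have M0 t : 0 < t < d -> M t <> 0.
  by move=> tI e0; apply: (sector_germ tI); rewrite -ME ?e0 ?(sector_c0 sp) //; lra.
have M1 t : 0 < t < d -> M t <> 1.
  by move=> tI e0; apply: (sector_germ tI); rewrite -ME ?e0 ?(param_c1 cp (sector_c0 sp)) //; lra.
have Marc t : 0 < t < d -> s1 < M t < s2 -> False.
  move=> tI MI; apply: (nov t tI); have [|r rI rE] := sector_l_onto sp (u := M t); first lra.
  exists r; last by rewrite -(sector_lE sp) // rE ME //; lra.
  have r0 : r != 0 by apply/eqP => r0; move: rE; rewrite r0 (sector_l0 sp); lra.
  have ra : r != a by apply/eqP => r1; move: rE; rewrite r1 (sector_la sp); lra.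
  by rewrite !lt_neqAle ra eq_sym r0.
have lo : forall t : R, 0 <= t <= d -> 0 <= M t.
  case: (arc_path_avoid d0 apM M0) => // /(_ (d / 2)) h'; exfalso; apply: (M0 (d / 2)) => //; lra.
have hi : forall t : R, 0 <= t <= d -> M t <= 1.
  case: (arc_path_avoid d0 apM M1) => // /(_ (d / 2)) h'; exfalso; lra.
have approach (t v : R) : 0 <= t <= d -> (M (d / 2) < v < M t) || (M t < v < M (d / 2)) ->
    exists2 r : R, 0 < r < d & M r = v.
  move=> tI vI; have [lt|gt|e'] := ltrgtP t (d / 2).
  - have [r rI rE] := arc_path_between apM (s := t) (t := d / 2) (v := v) ltac:(lra) lt ltac:(lra) ltac:(by rewrite orbC).
    by exists r => //; lra.
  - have [r rI rE] := arc_path_between apM (s := d / 2) (t := t) (v := v) ltac:(lra) gt ltac:(lra) vI.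
    by exists r => //; lra.
  by move/orP: vI; rewrite e' => -[]; lra.
have [|below|above] := arc_path_avoid d0 apM (v := (s1 + s2) / 2).
- by move=> t tI e'; apply: (Marc t tI); rewrite e'; lra.
- have MI t : 0 <= t <= d -> 0 <= M t <= s1.
    move=> tI; rewrite lo //= leNgt; apply/negP => lt; have := below t tI => le.
    have mid : M (d / 2) <= s1.
      by rewrite leNgt; apply/negP => lt'; apply: (Marc (d / 2)) => //; have := below (d / 2); lra.
    have [|r rI rE] := approach t ((s1 + M t) / 2) tI; first by apply/orP; left; lra.
    by apply: (Marc r rI); rewrite rE; lra.
  exists true, n, (fun t => h (M t)); split; last by move=> t tI; split=> //; exact: MI.
  case: apM => _ mono ivt; split.
  + by move=> t tI; rewrite (sector_hE sp) ?MI // ME // rot_rot.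
  + move=> s t h1 h2 h3; have := mono s t h1 h2 h3.
    have Ms := MI s ltac:(lra); have Mt := MI t ltac:(lra).
    by case: up {mono} => /= lt; apply: (sector_h_dec sp) => //; lra.
  move=> v vI; have h0 := sector_hI sp (MI 0 ltac:(lra)); have hd := sector_hI sp (MI d ltac:(lra)).
  have [|s sI sE] := sector_h_onto sp (u := v); first by move/orP: vI => -[]; lra.
  have dec r r' : 0 <= r <= s1 -> 0 <= r' <= s1 -> h r <= h r' -> r' <= r.
    move=> rI r'I le; rewrite leNgt; apply/negP => lt.
    by have := sector_h_dec sp (s := r) (t := r') ltac:(lra) lt ltac:(lra); lra.
  have [|t tI tE] := ivt s; last by exists t => //; rewrite tE.
  by rewrite -sE in vI; case/orP: vI => /andP[v1 v2]; apply/orP; [right|left];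
    apply/andP; split; apply: dec => //; apply: MI; lra.
have MI t : 0 <= t <= d -> s2 <= M t <= 1.
  move=> tI; rewrite hi //= andbT leNgt; apply/negP => lt; have := above t tI => le.
  have mid : s2 <= M (d / 2).
    by rewrite leNgt; apply/negP => lt'; apply: (Marc (d / 2)) => //; have := above (d / 2); lra.
  have [|r rI rE] := approach t ((s2 + M t) / 2) tI; first by apply/orP; right; lra.
  by apply: (Marc r rI); rewrite rE; lra.
have /choice[g gE] : forall u : R, exists s : R, s2 <= u <= 1 -> 0 <= s <= s1 /\ h s = u.
  move=> u; have [uI|] := boolP (s2 <= u <= 1); last by exists 0.
  by have [s sI sE] := sector_h_onto sp uI; exists s.
have gI t : 0 <= t <= d -> 0 <= g (M t) <= s1 by move=> tI; have [] := gE (M t) (MI t tI).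
have hg t : 0 <= t <= d -> h (g (M t)) = M t by move=> tI; have [] := gE (M t) (MI t tI).
exists false, n, (fun t => g (M t)); split; last first.
  by move=> t tI; split; [exact: gI|rewrite hg].
case: apM => _ mono ivt; split.
- by move=> t tI; rewrite /turn -rot_rot -(ME t tI) -[in RHS](hg t tI) (sector_hE sp (gI t tI)) rotK.
- move=> s t h1 h2 h3; have := mono s t h1 h2 h3.
  have Ms := gI s ltac:(lra); have Mt := gI t ltac:(lra).
  have dec r r' : 0 <= r <= s1 -> 0 <= r' <= s1 -> h r < h r' -> r' < r.
    move=> rI r'I le; rewrite ltNge; apply/negP => lt.
    case: (eqVneq r r') => [E|ne]; first by move: le; rewrite E ltxx.
    by have := sector_h_dec sp (s := r) (t := r') ltac:(lra) ltac:(lra) ltac:(lra); lra.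
  by case: up {mono} => /= lt; apply: dec => //; rewrite !hg //; lra.
move=> v vI; have g0 := gI 0 ltac:(lra); have gd := gI d ltac:(lra).
have v0 : 0 <= v <= s1 by move/orP: vI => -[]; lra.
have dec r r' : 0 <= r <= s1 -> 0 <= r' <= s1 -> r <= r' -> h r' <= h r.
  move=> rI r'I; rewrite le_eqVlt => /orP[/eqP -> //|lt].
  by apply: ltW; apply: (sector_h_dec sp) => //; lra.
have [|t tI tE] := ivt (h v).
  have e0 := hg 0 ltac:(lra); have ed := hg d ltac:(lra).
  by case/orP: vI => /andP[v1 v2]; apply/orP; [right|left]; rewrite -e0 -ed; apply/andP; split; apply: dec.
exists t => //; apply: (sector_h_inj sp) => //; first exact: gI.
by rewrite hg.
Qed.

End Path.
End Moves.

Section Overlap.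
Variable R : realType.
Local Notation P := (R * R)%type.
Variables (gamma : set P) (c : R -> P) (p : P) (a : R) (e : P) (s1 s2 : R) (h l : R -> R).
Hypothesis sp : sector_param gamma c p a e s1 s2 h l.

Lemma sector_l_inner (t : R) : 0 < t < a -> s1 < l t < s2.
Proof.
move=> tI; have [_ _ _ a0 _] := sector_ineqs sp.
have := sector_l_inc sp (s := 0) (t := t) (lexx _) ltac:(lra) ltac:(lra).
have := sector_l_inc sp (s := t) (t := a) ltac:(lra) ltac:(lra) (lexx _).
by rewrite (sector_l0 sp) (sector_la sp) => -> ->.
Qed.

Lemma sector_circle (v : R) : s1 <= v <= s2 -> sqd (c v) p = sqd e p.
Proof. by move=> /(sector_l_onto sp) [t tI <-]; rewrite (sector_lE sp) // sqd_rot_center. Qed.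

(** Around the common point the curve is a piece of both circles, and three of its points determine
    the centre. *)
Lemma arc_overlap_center d z w (t : R) : w <> z -> 0 < d < pi *+ 2 ->
  (forall s : R, 0 <= s <= d -> gamma (rot s z w)) -> 0 < t < d -> open_arc a p e (rot t z w) -> z = p.
Proof.
move=> wz d_in hg tI [t2 t2I t2E]; have cp := sector_cp sp; have [s10 s12 s21 a0 _] := sector_ineqs sp.
have [up [m ap]] := arc_path_exists cp wz d_in hg.
have d0 : 0 < d by case/andP: d_in.
have lt2 := sector_l_inner t2I.
have mt : c (m t) = c (l t2).
  have [mE _ _] := ap; rewrite (mE t ltac:(lra)) (sector_lE sp (t := t2) ltac:(lra)).
  by rewrite t2E.
have [n nE] := param_inj cp mt.
have ap' := arc_path_translate cp (- n) ap.
have mt0 : m t + (- n)%:~R = l t2 by rewrite nE mulrNz addrK.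
have [eps eps0] := arc_path_nbhs d0 ap' tI; rewrite mt0 => near.
have circ (v : R) : `|v - l t2| < eps -> sqd (c v) z = sqd w z.
  move=> /near [r rI <-]; apply: (arc_path_circle ap'); lra.
pose del := Num.min eps (Num.min (l t2 - s1) (s2 - l t2)) / 2.
have del0 : 0 < del by rewrite divr_gt0 // !lt_min eps0 !subr_gt0.
have dE : del *+ 2 = Num.min eps (Num.min (l t2 - s1) (s2 - l t2)) by rewrite -mulr_natr divfK.
have del1 : del *+ 2 <= eps by rewrite dE ge_min lexx.
have del2 : del *+ 2 <= l t2 - s1 by rewrite dE !ge_min lexx orbT.
have del3 : del *+ 2 <= s2 - l t2 by rewrite dE !ge_min lexx !orbT.
rewrite mulr2n in del1 del2 del3; move: (l t2) del {dE mt nE mt0 near t2E} lt2 circ del0 del1 del2 del3 => v0 del.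
move=> v0I circ del0 del1 del2 del3.
have ne (v v' : R) : s1 <= v -> v < v' -> v' <= s2 -> c v <> c v'.
  by move=> h1 h2 h3 /(sector_param_eq sp) e'; have := e' ltac:(lra) ltac:(lra); lra.
apply: (@two_circles_center _ z p (c (v0 - del)) (c v0) (c (v0 + del))).
- by apply: ne; lra.
- by apply: ne; lra.
- by apply: ne; lra.
- by rewrite !circ ?subrr ?normr0 // ltr_norml; lra.
- by rewrite !circ ?subrr ?normr0 // ltr_norml; lra.
- by rewrite !sector_circle //; lra.
- by rewrite !sector_circle //; lra.
Qed.

(** Once the centres agree, starting before [e] or ending beyond its image would prolong the arc
    about [p] inside the curve; an arc of angle at least [a] has no other freedom. *)
Lemma arc_overlap d z w (t : R) : w <> z -> 0 < d < pi *+ 2 -> a <= d ->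
  (forall s : R, 0 <= s <= d -> gamma (rot s z w)) -> 0 < t < d -> open_arc a p e (rot t z w) ->
  [/\ z = p, w = e & d = a].
Proof.
move=> wz d_in ad hg tI ov; have zp := arc_overlap_center wz d_in hg tI ov.
rewrite {}zp in wz hg ov *; case: ov => t2 t2I t2E; pose phi := t2 - t.
have wE : w = rot phi p e.
  by apply: (@rot_inj _ t p); rewrite -t2E -rotD /phi addrC subrK.
have phi0 : 0 <= phi.
  rewrite leNgt; apply/negP => lt.
  apply: (sector_end_before sp (b := - phi)); first by rewrite oppr_gt0.
  move=> s sI; have -> : rot (- s) p e = rot (- s - phi) p w by rewrite wE -rotD subrK.
  by apply: hg; rewrite /phi in sI *; lra.
have phi1 : phi + d <= a.
  rewrite leNgt; apply/negP => lt.
  apply: (sector_end_after sp (b := phi + d - a)); first by rewrite subr_gt0.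
  move=> s sI; have -> : rot (a + s) p e = rot (a + s - phi) p w by rewrite wE -rotD subrK.
  by apply: hg; rewrite /phi in sI phi0 *; lra.
have phiE : phi = 0 by lra.
by split=> //; [rewrite wE phiE rot0|lra].
Qed.

(** A decreasing lift starting at [s1] would give points of the arc parameters smaller than [s1],
    which belong to the first branch. *)
Lemma arc_direction up m : arc_path c a p e up m -> up.
Proof.
move=> ap; apply/negPn/negP => dn; have cp := sector_cp sp; have [s10 s12 s21 a0 _] := sector_ineqs sp.
have m0 : c (m 0) = c s1 by have [mE _ _] := ap; rewrite (mE 0 ltac:(lra)) rot0 (sector_cs1 sp).
have [n nE] := param_inj cp m0.
have [ME mono ivt] := arc_path_translate cp (- n) ap.
have M0 : m 0 + (- n)%:~R = s1 by rewrite nE mulrNz addrK.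
rewrite (negPf dn) M0 /= in ME mono ivt.
have := mono 0 a (lexx _) a0 (lexx _); rewrite M0; set Ma := m a + _ => lt.
pose v := Num.max Ma (s1 / 2).
have v1 : v < s1 by rewrite gt_max lt /=; lra.
have v2 : s1 / 2 <= v by rewrite le_max lexx orbT.
have v3 : Ma <= v by rewrite le_max lexx.
have [|t tI tE] := ivt v; first by apply/orP; right; rewrite v3 ltW.
have := ME t tI; rewrite tE -(sector_lE sp) // => /(sector_param_eq sp) vl.
by have lt' := sector_lI sp tI; have := vl ltac:(lra) ltac:(lra); lra.
Qed.

End Overlap.

(** * The orbit of the circular arc *)

Section Uniform.
Variable R : realType.
Local Notation P := (R * R)%type.

Lemma sqd_triangle (u v w : P) : sqd u w <= 2 * sqd u v + 2 * sqd v w.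
Proof.
rewrite /sqd; have h1 := sqr_ge0 ((u.1 - v.1) - (v.1 - w.1)); have h2 := sqr_ge0 ((u.2 - v.2) - (v.2 - w.2)).
by lra.
Qed.

Lemma uniform_sqd (c : R -> P) (D : R) : continuous c -> 0 < D -> forall u v : R, u <= v ->
  exists2 del : R, 0 < del &
  forall s t : R, u <= s <= v -> `|t - s| < del -> sqd (c s) (c t) < D.
Proof.
move=> cc D0; apply: (@interval_gluing R (fun u v => exists2 del : R, 0 < del &
  forall s t : R, u <= s <= v -> `|t - s| < del -> sqd (c s) (c t) < D)).
- move=> u v w uv vw [d1 d10 k1] [d2 d20 k2].
  exists (Num.min d1 d2) => [|s t sI]; first by rewrite lt_min d10.
  rewrite lt_min => /andP[l1 l2].
  have [sv|vs] := leP s v; first by apply: k1 => //; lra.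
  by apply: k2 => //; lra.
(* The bound is [D / 4] because [sqd] obeys the triangle inequality only with a factor 2. *)
move=> t; have [r r0 near] := near_lt (t := t) (sqd_continuous (w := c t) cc) (r := D / 4) ltac:(rewrite /= sqdxx; lra).
exists (r / 2); first lra.
move=> u v h1 h2 h3 h4; exists (r / 2); first lra.
move=> s s' sI s'I; have := sqd_triangle (c s) (c t) (c s'); rewrite (sqdC (c t)).
rewrite ltr_norml in s'I.
have := near s ltac:(rewrite ltr_norml; lra); have := near s' ltac:(rewrite ltr_norml; lra).
by lra.
Qed.

Lemma int_ord_mod (K : nat) (j : int) : (0 < K)%N -> exists (i : 'I_K) (n : int), j = i%:Z + n * K%:Z.
Proof.
move=> K0; have K0' : K%:Z != 0 by rewrite eqz_nat -lt0n.
have m0 := modz_ge0 j K0'.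
have lt : (`|(j %% K%:Z)%Z|%N < K)%N by rewrite -ltz_nat gez0_abs // ltz_pmod.
exists (Ordinal lt), (j %/ K%:Z)%Z => /=.
by rewrite {1}(divz_eq j K%:Z) gez0_abs // addrC.
Qed.

(** By uniform continuity, an arc whose chord is bounded below spans more than [1 / K] in parameter.
    Pigeonhole on the grid then bounds the number of disjoint congruent arcs. *)
Lemma arc_meets_grid (gamma : set P) (c : R -> P) (D : R) : closed_param gamma c -> 0 < D -> exists2 K : nat, (0 < K)%N &
  forall d z w, w <> z -> 0 < d < pi *+ 2 -> (forall t : R, 0 <= t <= d -> gamma (rot t z w)) -> D <= sqd w (rot d z w) ->
  exists i : 'I_K, open_arc d z w (c (i%:R / K%:R)).
Proof.
move=> cp D0; have [del del0 near] := uniform_sqd (param_continuous cp) D0 (u := 0) (v := 1) ler01.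
have [K K0 KE] : exists2 K : nat, (0 < K)%N & 1 / K%:R < del.
  exists (Num.truncn (1 / del)).+1 => //; rewrite ltr_pdivrMr ?ltr0n // mulrC -ltr_pdivrMr //.
  by rewrite truncnS_gt.
exists K => // d z w wz d_in hg chord; have [d0 _] := andP d_in.
have [up [m ap]] := arc_path_exists cp wz d_in hg.
pose lo := Num.min (m 0) (m d); pose hi := Num.max (m 0) (m d).
have lohi : del <= hi - lo.
  rewrite leNgt; apply/negP => lt; move: chord; rewrite leNgt => /negP; apply.
  have [mE _ _] := ap.
  have e0 : c (m 0) = w by rewrite mE ?rot0 ?lexx ?ltW.
  have ed : c (m d) = rot d z w by rewrite mE ?lexx ?ltW.
  rewrite -ed -e0 -(param_period cp (m 0) (- Num.floor (m 0))) -(param_period cp (m d) (- Num.floor (m 0))).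
  have := floor_itv (m 0); rewrite intrD mulr1z mulrNz => /andP[f1 f2].
  apply: near; first lra.
  have h1 : lo <= m 0 by rewrite ge_min lexx.
  have h2 : lo <= m d by rewrite ge_min lexx orbT.
  have h3 : m 0 <= hi by rewrite le_max lexx.
  have h4 : m d <= hi by rewrite le_max lexx orbT.
  by rewrite ltr_norml; lra.
have KR : 0 < (K%:R : R) by rewrite ltr0n.
pose j := Num.floor (lo * K%:R) + 1.
have jI : lo < j%:~R / K%:R < hi.
  have := floor_itv (lo * K%:R); rewrite -/j => /andP[f1 f2].
  rewrite ltr_pdivlMr // f2 ltr_pdivrMr //=.
  have : 1 < del * K%:R by rewrite -ltr_pdivrMr.
  have : del * K%:R <= (hi - lo) * K%:R by rewrite ler_pM2r.
  by rewrite /j intrD mulr1z; lra.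
have [|r rI rE] := arc_path_between ap (s := 0) (t := d) (v := j%:~R / K%:R) (lexx _) d0 (lexx _).
  move: jI; rewrite /lo /hi gt_min lt_max => /andP[/orP[] h1 /orP[] h2]; rewrite ?h1 ?h2 ?orbT //.
    by move: (lt_trans h1 h2); rewrite ltxx.
  by move: (lt_trans h1 h2); rewrite ltxx.
have [i [n iE]] := int_ord_mod j K0.
exists i, r => //; have [mE _ _] := ap; rewrite -mE; last lra.
rewrite rE iE intrD intrM mulrDl mulfK ?lt0r_neq0 // (param_period cp).
by [].
Qed.

End Uniform.

(** * Alternating rotations about the two generating points *)

Section Dynamics.
Variable R : realType.
Local Notation P := (R * R)%type.

(** The sector about [q] has its own origin and orientation; expressing it through the [c] of the
    first sector makes the two comparable. *)
Definition flip_param (rev : bool) (x : R) (c : R -> P) (s : R) : P := c ((if rev then - s else s) + x).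

Lemma flip_param_arc (c : R -> P) d z w up m rev x : arc_path c d z w up m ->
  exists m', arc_path (flip_param rev x c) d z w (up (+) rev) m'.
Proof.
move=> /(arc_path_shift x); case: rev => ap.
  by exists (fun t => - (m t - x)); rewrite addbT; exact: arc_path_reverse ap.
by exists (fun t => m t - x); rewrite addbF.
Qed.

Lemma flip_param_arc_inv (c : R -> P) d z w up m rev x : arc_path (flip_param rev x c) d z w up m ->
  exists m', arc_path c d z w (up (+) rev) m'.
Proof.
case: rev => ap.
  have ap' : arc_path (fun s => c (s + x)) d z w (~~ up) (fun t => - m t).
    by apply: arc_path_ext (arc_path_reverse ap) => s; rewrite /flip_param opprK.
  exists (fun t => - m t - (- x)); rewrite addbT.
  by apply: arc_path_ext (arc_path_shift (- x) ap') => s; rewrite subrK.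
exists (fun t => m t - (- x)); rewrite addbF.
by apply: arc_path_ext (arc_path_shift (- x) ap) => s; rewrite /flip_param subrK.
Qed.

Variables (gamma : set P) (c : R -> P) (p q : P) (a b : R) (e f : P) (s1 s2 u1 u2 : R)
  (h l h' l' : R -> R) (rev : bool) (x : R).
Hypotheses (sp : sector_param gamma c p a e s1 s2 h l)
  (sq : sector_param gamma (flip_param rev x c) q b f u1 u2 h' l')
  (pq : p <> q) (ba : b <= a).
Local Notation c' := (flip_param rev x c).

Let cp := sector_cp sp.
Let a_in := sector_a_in sp.
Let a0 : 0 < a. Proof. by case/andP: a_in. Qed.

(** [up] has two meanings that stay synchronized: the direction of the current arc along [c], and
    the next centre, which is [q] for [true]. Every move flips both. *)
Definition branch (up pos : bool) : set P :=
  match up, pos with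
  | true, true => first_branch c' u1 | true, false => second_branch c' u2
  | false, true => first_branch c s1 | false, false => second_branch c s2
  end.
Definition base (up : bool) := if up then q else p.
Definition angle (up : bool) := if up then b else a.
Definition base_arc (up : bool) := if up then open_arc b q f else open_arc a p e.

Definition placed_arc (up : bool) (A : P * P) : Prop :=
  A.2 <> A.1 /\ exists m, arc_path c a A.1 A.2 up m.

Definition arc_move (up pos : bool) (A B : P * P) : Prop :=
  [/\ B = (rot (turn pos (angle up)) (base up) A.1, rot (turn pos (angle up)) (base up) A.2),
      placed_arc (~~ up) B &
      forall t : R, 0 < t < a -> branch up pos (rot t A.1 A.2) /\ branch up (~~ pos) (rot t B.1 B.2)].

Lemma branch_disjoint up Q : branch up true Q -> branch up false Q -> False.
Proof. by case: up; [exact: (branches_disjoint sq)|exact: (branches_disjoint sp)]. Qed.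

Lemma branch_base_arc up pos Q : branch up pos Q -> base_arc up Q -> False.
Proof.
case: up; case: pos; [exact: (first_branch_open_arc sq)|exact: (second_branch_open_arc sq)
  |exact: (first_branch_open_arc sp)|exact: (second_branch_open_arc sp)].
Qed.

Lemma arc_move_exists up A : placed_arc up A ->
  (forall t : R, 0 < t < a -> ~ base_arc up (rot t A.1 A.2)) -> exists B pos, arc_move up pos A B.
Proof.
case: A => z w [/= wz [m ap]] nov.
have wz' pos up' : rot (turn pos (angle up')) (base up') w <> rot (turn pos (angle up')) (base up') z.
  by move=> /rot_inj.
case: up ap nov => ap nov.
  have [m1 ap1] := flip_param_arc rev x ap.
  have [pos [n [m2 [ap2 mv]]]] := sector_step sq a0 wz ap1 nov.
  exists (rot (turn pos b) q z, rot (turn pos b) q w), pos; split=> //.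
    split; first exact: (wz' pos true).
    by have [m3] := flip_param_arc_inv ap2; rewrite addTb negbK addbb => ap3; exists m3.
  move=> t tI /=; have tI' : 0 <= t <= a by lra.
  have [mE _ _] := ap1; have [mE2 _ _] := ap2.
  have E : c' (m1 t + n%:~R) = rot t z w by rewrite (param_period (sector_cp sq)) mE.
  have [_] := sector_move_branches sq (mv t tI') E (sector_germ sq a0 wz ap1 tI).
  by rewrite mE2 //; case: pos {wz' ap2 mv mE2}.
have [pos [n [m2 [ap2 mv]]]] := sector_step sp a0 wz ap nov.
exists (rot (turn pos a) p z, rot (turn pos a) p w), pos; split=> //.
  by split; [exact: (wz' pos false)|exists m2].
move=> t tI /=; have tI' : 0 <= t <= a by lra.
have [mE _ _] := ap; have [mE2 _ _] := ap2.
have E : c (m t + n%:~R) = rot t z w by rewrite (param_period cp) mE.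
have [_] := sector_move_branches sp (mv t tI') E (sector_germ sp a0 wz ap tI).
by rewrite mE2 //; case: pos {wz' ap2 mv mE2}.
Qed.

Section Orbit.
Variables (A : nat -> P * P) (n : nat).
Let arcpt (t : nat) (th : R) := rot th (A t).1 (A t).2.
Hypotheses (A0 : A 0%N = (p, e))
  (move_ : forall t, (t < n)%N -> exists pos, arc_move (~~ odd t) pos (A t) (A t.+1)).

Lemma arc_move_pt t : (t < n)%N -> exists pos, forall th : R, 0 < th < a ->
  [/\ arcpt t.+1 th = rot (turn pos (angle (~~ odd t))) (base (~~ odd t)) (arcpt t th),
    branch (~~ odd t) pos (arcpt t th) & branch (~~ odd t) (~~ pos) (arcpt t.+1 th)].
Proof.
move=> /move_ [pos [BE _ br]]; exists pos => th thI; have [b1 b2] := br th thI.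
by split=> //; rewrite /arcpt BE /= [RHS]rot_rot.
Qed.

Lemma branch_eq up pos pos' Q : branch up pos Q -> branch up pos' Q -> pos = pos'.
Proof.
case: pos; case: pos' => // h1 h2; exfalso; [exact: branch_disjoint h1 h2|exact: branch_disjoint h2 h1].
Qed.

Lemma turn_neg pos (d : R) (z Q : P) : rot (turn (~~ pos) d) z (rot (turn pos d) z Q) = Q.
Proof. by case: pos; rewrite /turn /= ?rotK ?rotNK. Qed.

(** The branch containing the common point determines the sense of the rotation, so the move leaving
    arc [s] undoes there the move that produced arc [t.+1]. *)
Lemma orbit_forth s t (th th' : R) : (s < n)%N -> (t < n)%N -> odd s = odd t ->
  0 < th < a -> 0 < th' < a -> arcpt s th = arcpt t.+1 th' -> arcpt s.+1 th = arcpt t th'.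
Proof.
move=> sn tn st thI th'I E; have [pos /(_ th thI) [e1 b1 b1']] := arc_move_pt sn.
have [pos' /(_ th' th'I) [e2 b2 b2']] := arc_move_pt tn.
rewrite -st in e2 b2 b2'; rewrite -E in e2 b2'; have pp := branch_eq b1 b2'.
by rewrite e1 e2 pp turn_neg.
Qed.

Lemma orbit_back s t (th th' : R) : (s < n)%N -> (t < n)%N -> odd s = odd t ->
  0 < th < a -> 0 < th' < a -> arcpt s.+1 th = arcpt t.+1 th' -> arcpt s th = arcpt t th'.
Proof.
move=> sn tn st thI th'I E; have [pos /(_ th thI) [e1 b1 b1']] := arc_move_pt sn.
have [pos' /(_ th' th'I) [e2 b2 b2']] := arc_move_pt tn.
rewrite -st in e2 b2 b2'; rewrite -E in e2 b2'; have pp := branch_eq b1' b2'.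
have {}pp : pos = pos' by case: (pos) (pos') pp => -[].
by move: e2; rewrite e1 -pp; exact: rot_inj.
Qed.

(* The same involution moves arc [s] forward and arc [s + k.*2.+1] back, so that
   the two indices approach each other; a step always changes the branch. *)
Lemma orbit_disjoint_odd k s (th th' : R) : (s + k.*2.+1 <= n)%N -> 0 < th < a -> 0 < th' < a ->
  arcpt s th = arcpt (s + k.*2.+1) th' -> False.
Proof.
elim: k s => [|k IH] s; rewrite ?addn1 ?doubleS.
  move=> sn thI th'I E; have [pos h1] := arc_move_pt sn.
  have [_ b1 _] := h1 th thI; have [_ _ b2] := h1 th' th'I.
  by rewrite -E in b2; have := branch_eq b1 b2; case: (pos).
rewrite !addnS => sn thI th'I E; apply: (IH s.+1 _ thI th'I); first by lia.
have -> : (s.+1 + k.*2.+1)%N = (s + k.*2).+2 by lia.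
by apply: orbit_forth E => //; rewrite /= ?oddD ?odd_double ?addbF ?negbK //; lia.
Qed.

(* Here both arcs move back, until the first one is the arc about [p]. *)
Lemma orbit_disjoint_even k s (th th' : R) : (s + k.+1.*2 <= n)%N -> 0 < th < a -> 0 < th' < a ->
  arcpt s th = arcpt (s + k.+1.*2) th' -> False.
Proof.
elim: s => [|s IH] sn thI th'I E; last first.
  apply: (IH _ thI th'I); first by lia.
  by apply: orbit_back E => //; rewrite ?oddD ?odd_double ?addbF //; lia.
have [|pos /(_ th' th'I) [_ _ br]] := @arc_move_pt (k.*2.+1); first by lia.
rewrite add0n doubleS in E; rewrite -E /= odd_double in br.
apply: (branch_base_arc br); exists th => //.
by rewrite /arcpt A0.
Qed.

Lemma orbit_disjoint s t (th th' : R) : (s < t)%N -> (t <= n)%N -> 0 < th < a -> 0 < th' < a ->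
  arcpt s th = arcpt t th' -> False.
Proof.
move=> st tn thI th'I; have := odd_double_half (t - s); move: (t - s)./2 => k.
case: (odd (t - s)) => tE.
  have tE' : t = (s + k.*2.+1)%N by lia.
  by rewrite tE' in tn *; exact: orbit_disjoint_odd tn thI th'I.
case: k tE => [|k] tE; first by lia.
have tE' : t = (s + k.+1.*2)%N by lia.
by rewrite tE' in tn *; exact: orbit_disjoint_even tn thI th'I.
Qed.

Lemma orbit_placed t : (t <= n)%N -> placed_arc (~~ odd t) (A t).
Proof.
case: t => [_|t tn]; last by have [pos [_]] := move_ tn.
rewrite A0 /=; split; first exact: (sector_ep sp).
exists l; split=> /=; [exact: (sector_lE sp)|exact: (sector_l_inc sp)|].
move=> v; rewrite (sector_l0 sp) (sector_la sp) => /orP[vI|]; first exact: (sector_l_onto sp).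
by have [_ s12 _ _ _] := sector_ineqs sp; lra.
Qed.

Lemma orbit_chord t : (t <= n)%N -> sqd (A t).2 (rot a (A t).1 (A t).2) = sqd e (rot a p e).
Proof.
elim: t => [_|t IH tn]; first by rewrite A0.
have [pos [-> _ _]] := move_ tn; rewrite /= -rot_rot sqd_rot; apply: IH; exact: ltnW.
Qed.

End Orbit.

Lemma placed_arc_in up A (t : R) : placed_arc up A -> 0 <= t <= a -> gamma (rot t A.1 A.2).
Proof. by move=> [_ [m [mE _ _]]] tI; rewrite -mE //; exact: (param_in cp). Qed.

Definition orbit_stop (A : nat -> P * P) (t : nat) : Prop :=
  ~~ odd t /\ exists2 th : R, 0 < th < a & open_arc b q f (rot th (A t).1 (A t).2).

(** The successor is chosen as a total function, with the arc itself as default where no move is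
    possible. If the orbit never stopped, [K + 1] of its arcs would meet a grid of [K] points,
    against disjointness. *)
Lemma orbit_exists : exists (A : nat -> P * P) (n : nat), [/\ A 0%N = (p, e),
  forall t, (t < n)%N -> exists pos, arc_move (~~ odd t) pos (A t) (A t.+1) & orbit_stop A n].
Proof.
have /choice[F FE] : forall S : bool * (P * P), exists B, placed_arc S.1 S.2 ->
    (forall t : R, 0 < t < a -> ~ base_arc S.1 (rot t S.2.1 S.2.2)) -> exists pos, arc_move S.1 pos S.2 B.
  case=> up A; have [[pl fr]|no] := pselect (placed_arc up A /\
      forall t : R, 0 < t < a -> ~ base_arc up (rot t A.1 A.2)).
    by have [B [pos mv]] := arc_move_exists pl fr; exists B => _ _; exists pos.
  by exists A => pl fr; exfalso; apply: no.
pose A := fix A t := if t is t'.+1 then F (~~ odd t', A t') else (p, e).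
have A0 : A 0%N = (p, e) by [].
have moves n : (forall t, (t < n)%N -> ~ orbit_stop A t) ->
    forall t, (t < n)%N -> exists pos, arc_move (~~ odd t) pos (A t) (A t.+1).
  elim: n => // n IH nst t; rewrite ltnS leq_eqVlt => /orP[/eqP ->|tn]; last first.
    by apply: IH => // s sn; apply: nst; exact: ltnW.
  have {}IH := IH (fun s sn => nst s (ltnW sn)).
  apply: (FE (~~ odd n, A n)) => /=; first exact: (orbit_placed A0 IH).
  move=> th thI; case: (boolP (odd n)) => on /=; last first.
    by move=> ov; apply: (nst n (ltnSn n)); split=> //; exists th.
  (* The arc about [p] is arc 0 of the orbit, so an arc of odd index cannot overlap it. *)
  move=> [th' th'I E]; apply: (orbit_disjoint A0 IH (s := 0%N) (t := n) _ (leqnn n) th'I thI) => //.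
  by case: (n) on.
have [[t st]|no] := pselect (exists t, orbit_stop A t); last first.
  have {}moves n := moves n (fun t _ st => no (ex_intro _ t st)).
  have D0 : 0 < sqd e (rot a p e).
    by apply: sqd_gt0 => E; apply: (sector_ep sp); exact: (rot_fixed a_in (esym E)).
  have [K K0 grid] := arc_meets_grid cp D0.
  have /choice[g gE] : forall t : 'I_K.+1, exists i : 'I_K, open_arc a (A t).1 (A t).2 (c (i%:R / K%:R)).
    move=> t; have pl := orbit_placed A0 (@moves t) (leqnn t).
    apply: grid => //; first by case: pl.
      by move=> th; exact: (placed_arc_in pl).
    by rewrite (orbit_chord A0 (@moves t) (leqnn t)).
  have : ~~ injectiveb g.
    by apply/negP => /injectiveP /leq_card; rewrite !card_ord ltnn.
  move=> /injectivePn [s [t st gst]]; exfalso.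
  wlog lt : s t st gst / (s < t)%N => [w|].
    have [lt|lt|eq] := ltngtP s t; [exact: (w s t)|by apply: (w t s); rewrite 1?eq_sym|].
    by move: st; rewrite (val_inj eq) eqxx.
  have [th thI E] := gE s; have [th' th'I E'] := gE t; rewrite -gst -E in E'.
  by apply: (orbit_disjoint A0 (@moves t) lt (leqnn t) thI th'I); rewrite E'.
have ex : exists t, `[< orbit_stop A t >] by exists t; apply/asboolP.
case: (ex_minnP ex) => n /asboolP stn min; exists A, n; split=> //; apply: moves => s sn sst.
by have := min s; rewrite leqNgt sn => /(_ (asboolT sst)).
Qed.

(** Every arc of the orbit has angle [a], at least [b], so an overlap with the arc about [q] is an
    equality. Evenness of [n] makes the lift increasing, and [arc_direction] at [q] excludes a
    reversal. *)
Lemma orbit_end (A : nat -> P * P) n : A 0%N = (p, e) ->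
  (forall t, (t < n)%N -> exists pos, arc_move (~~ odd t) pos (A t) (A t.+1)) -> orbit_stop A n ->
  [/\ (0 < n)%N, A n = (q, f), a = b & rev = false].
Proof.
move=> A0 moves [on [th thI ov]].
have pl := orbit_placed A0 moves (leqnn n).
have [zq wf ab] := arc_overlap sq (proj1 pl) a_in ba (fun t tI => placed_arc_in pl tI) thI ov.
have AE : A n = (q, f) by rewrite -zq -wf; case: (A n).
split=> //.
  by rewrite lt0n; apply/eqP => n0; apply: pq; move: zq; rewrite n0 A0.
case: pl => _ [m]; rewrite on zq wf ab => ap; have [m' ap'] := flip_param_arc rev x ap.
by have := arc_direction sq ap'; case: (rev).
Qed.

End Dynamics.

(** * Ranks along the curve *)

Section Rank.
Variables (R : realType) (k : nat).
Local Notation N := (k.*2.+1).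

Definition rank (V : nat -> R) (t : nat) : nat := (\sum_(s < N) (V s < V t)%R)%N.

Variables (V : nat -> R).
Hypothesis Vinj : forall s t : 'I_N, V s = V t -> s = t.

Lemma rank_lt (s t : 'I_N) : V s < V t -> (rank V s < rank V t)%N.
Proof.
move=> st; rewrite /rank (bigD1 s) //= [X in (_ < X)%N](bigD1 s) //= st ltxx add0n add1n ltnS.
by apply: leq_sum => i _; case: (ltP (V i) (V s)) => // h; rewrite (lt_trans h st).
Qed.

Lemma rank_ltE (s t : 'I_N) : (rank V s < rank V t)%N = (V s < V t).
Proof.
apply/idP/idP => [|/rank_lt //]; have [//|lt|/Vinj ->] := ltgtP (V s) (V t); last by rewrite ltnn.
by move=> h; have := ltn_trans h (rank_lt lt); rewrite ltnn.
Qed.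

Lemma rank_inj (s t : 'I_N) : rank V s = rank V t -> s = t.
Proof.
move=> e; have [lt|lt|/Vinj //] := ltgtP (V s) (V t).
  by have := rank_lt lt; rewrite e ltnn.
by have := rank_lt lt; rewrite e ltnn.
Qed.

Lemma rank_bound (t : 'I_N) : (rank V t < N)%N.
Proof.
rewrite /rank (bigD1 t) //= ltxx add0n -[X in (_ < X)%N]card_ord -sum1_card [X in (_ < X)%N](bigD1 t) //= add1n ltnS.
by apply: leq_sum => i _; case: (_ < _).
Qed.

(** The involution turns the items below [sg t] into those above [t]; together with the items below
    [t] they are all but [t]. *)
Lemma rank_reflect (sg : 'I_N -> 'I_N) : involutive sg ->
  (forall s t : 'I_N, V s < V t -> V (sg t) < V (sg s)) -> forall t : 'I_N, (rank V (sg t) + rank V t = k.*2)%N.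
Proof.
move=> sgK sgV t; have sgV' s t' : (V (sg s) < V (sg t')) = (V t' < V s).
  by apply/idP/idP => [/sgV|/sgV //]; rewrite !sgK.
rewrite {1}/rank (reindex_inj (inv_inj sgK)) /=.
under eq_bigr => s _ do rewrite sgV'.
rewrite /rank -big_split /= (bigD1 t) //= ltxx add0n.
rewrite (eq_bigr (fun=> 1%N)) => [|s st]; last first.
  have [lt|lt|/Vinj e] := ltgtP (V t) (V s) => //.
  by rewrite e eqxx in st.
rewrite sum1_card; apply: etrans (etrans (cardC1 t) _); last by rewrite card_ord.
by apply: eq_card => s; rewrite !inE.
Qed.

(** Cutting the closed curve at [x] instead of 0 moves the [j] items before [x] to the end. *)
Lemma rank_shift (x : R) (V' : nat -> R) (t : 'I_N) :
  (forall s : 'I_N, [/\ 0 <= V s < 1, V s <> x & V' s = if x < V s then V s - x else V s + 1 - x]) ->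
  let j := (\sum_(s < N) (V s < x)%R)%N in
  (rank V t = rank V' t + j \/ rank V t + N = rank V' t + j)%N.
Proof.
move=> V'E j; have [Vt tx V't] := V'E t; case: ifP V't => [xt|/negbT xt] V't; [left|right].
  rewrite /rank /j -big_split /=; apply: eq_bigr => s _; have [Vs sx ->] := V'E s.
  rewrite V't; case: ifP => [xs|/negbT xs].
    by rewrite ltrD2r [V s < x]ltNge (ltW xs) addn0.
  have {}xs : V s < x by rewrite lt_neqAle leNgt xs andbT; apply/eqP.
  by rewrite xs (lt_trans xs xt) ltNge; have -> : V t - x <= V s + 1 - x by lra.
have {}xt : V t < x by rewrite lt_neqAle leNgt xt andbT; apply/eqP.
have NE : N = (\sum_(s < N) 1)%N by rewrite sum1_card card_ord.
rewrite /rank /j [X in (_ + X)%N = _]NE -!big_split /=; apply: eq_bigr => s _; have [Vs sx ->] := V'E s.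
rewrite V't; case: ifP => [xs|/negbT xs].
  rewrite [V s < x]ltNge (ltW xs) addn0 [V s < V t]ltNge (ltW (lt_trans xt xs)) add0n.
  by have -> : V s - x < V t + 1 - x by lra.
have {}xs : V s < x by rewrite lt_neqAle leNgt xs andbT; apply/eqP.
by rewrite xs ltrD2r ltrD2r.
Qed.

End Rank.

Section Reflection.
Variables (R : realType) (k : nat) (V : nat -> R) (s1 s2 : R) (h : R -> R).
Local Notation N := (k.*2.+1).
Hypotheses (Vinj : forall s t : 'I_N, V s = V t -> s = t) (s12 : s1 < s2)
  (h_lo : forall u : R, 0 < u <= s1 -> s2 <= h u)
  (h_dec : forall u v : R, 0 < u -> u < v -> v <= s1 -> h v < h u).

Definition reflected (u v : R) : Prop := (0 < u <= s1 /\ v = h u) \/ (0 < v <= s1 /\ u = h v).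

Variables (o : 'I_N) (sg : 'I_N -> 'I_N).
Hypotheses (Vo : s1 < V o < s2) (sgo : sg o = o) (sgK : involutive sg)
  (sgV : forall t : 'I_N, t != o -> reflected (V t) (V (sg t))).

Lemma reflected_anti (s t : 'I_N) : V s < V t -> V (sg t) < V (sg s).
Proof.
have s12' := s12; have [->|so] := eqVneq s o; have [->|to] := eqVneq t o; rewrite ?sgo ?ltxx //.
- by have [[/[dup] h1 /h_lo h2 E]|[/[dup] h1 /h_lo h2 E]] := sgV to; have := Vo; lra.
- by have [[/[dup] h1 /h_lo h2 E]|[/[dup] h1 /h_lo h2 E]] := sgV so; have := Vo; lra.
have [[/[dup] h1 /h_lo h2 E]|[/[dup] h1 /h_lo h2 E]] := sgV so;
have [[/[dup] k1 /h_lo k2 F]|[/[dup] k1 /h_lo k2 F]] := sgV to => lt.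
- by rewrite E F; apply: h_dec; lra.
- by lra.
- by lra.
- have [lt'|lt'|e] := ltgtP (V (sg t)) (V (sg s)) => //.
    by have := h_dec _ lt'; rewrite -E -F; lra.
  by move: lt; rewrite E F e ltxx.
Qed.

Lemma reflected_rank (t : 'I_N) : (rank k V (sg t) + rank k V t = k.*2)%N.
Proof. by apply: rank_reflect => // s t'; exact: reflected_anti. Qed.

Lemma reflected_rank_mid : rank k V o = k.
Proof. by have := reflected_rank o; rewrite sgo; lia. Qed.

End Reflection.

(** The run tracks the [t]-th centre measured from the centre of the next rotation, in units of
    [q - p]. Changing this reference point contributes the added 1, and its alternation turns [zeta]
    into [- zeta]. *)
Lemma affine_run_orbit (F : fieldType) (zeta p q : F) (Z : nat -> F) (pos : nat -> bool) n :
  p <> q -> Z 0%N = p ->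
  (forall t, (t < n)%N -> Z t.+1 = (if odd t then p else q) +
     (if pos t then zeta else zeta^-1) * (Z t - if odd t then p else q)) ->
  forall t, (t <= n)%N ->
  affine_run (- zeta) (fun t => pos t.-1) t 1 =
    - (-1) ^+ t * (Z t - if odd t then p else q) / (q - p).
Proof.
move=> pq Z0 ZS; have D0 : q - p != 0 by rewrite subr_eq0; apply/eqP => e; apply: pq.
elim=> [_|t IH tn]; first by rewrite /= Z0 expr0 mulN1r opprB divff.
rewrite /= /affine_step IH 1?ltnW // ZS // exprS invrN.
have -> : (if pos t then - zeta else - zeta^-1) = - (if pos t then zeta else zeta^-1) by case: ifP.
have sg : (-1) ^+ t = (if odd t then -1 else 1) :> F by rewrite -signr_odd; case: (odd t); rewrite ?expr1 ?expr0.
move: (if pos t then _ else _) => u; apply: (mulIf D0); rewrite mulrDl !divfK //.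
rewrite mulrA divfK // sg mul1r; case: (odd t) => /=; ring.
Qed.

Section Complex.
Variable R : realType.
Local Notation P := (R * R)%type.

Definition cx (z : P) : R[i] := Complex z.1 z.2.

Lemma cx_inj : injective cx.
Proof. by case=> x y [x' y'] [/= -> ->]. Qed.

Lemma cx_rot (t : R) (p z : P) : cx (rot t p z) = cx p + expi t * (cx z - cx p).
Proof. by rewrite /cx /rot /expi /=; apply/eqP; rewrite eq_complex /= addrC [X in _ && (_ == X)]addrC; apply/andP; split; apply/eqP; ring. Qed.

Lemma cx_rot_turn pos (t : R) (p z : P) :
  cx (rot (turn pos t) p z) = cx p + (if pos then expi t else (expi t)^-1) * (cx z - cx p).
Proof. by rewrite cx_rot; case: pos; rewrite /turn ?expiN. Qed.

End Complex.

Section MoveReflected.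
Variable R : realType.
Local Notation P := (R * R)%type.
Variables (gamma : set P) (c : R -> P) (p : P) (a : R) (e : P) (s1 s2 : R) (h l : R -> R).
Hypothesis sp : sector_param gamma c p a e s1 s2 h l.

Lemma move_reflected pos (Q Q' : P) (v v' : R) : Q' = rot (turn pos a) p Q ->
  first_branch c s1 (if pos then Q else Q') -> c v = Q -> c v' = Q' -> 0 <= v < 1 -> 0 <= v' < 1 ->
  reflected s1 h v v' /\ if pos then v <= s1 else s2 <= v.
Proof.
have [s10 s12 s21 _ _] := sector_ineqs sp.
case: pos => E [s sI sE] vE v'E vI v'I.
  have sv : s = v by apply: (sector_param_eq sp) => //; [rewrite sE|lra].
  rewrite sv in sI sE; have hv := sector_h_lt1 sp sI.
  have v'h : v' = h v.
    apply: (sector_param_eq sp) => //; last lra.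
    by rewrite (sector_hE sp) ?v'E ?E ?vE //; lra.
  by split; [left|case/andP: sI].
have sv : s = v' by apply: (sector_param_eq sp) => //; [rewrite sE|lra].
rewrite sv in sI sE; have hv := sector_h_lt1 sp sI.
have vh : v = h v'.
  apply: (sector_param_eq sp) => //; last lra.
  by rewrite (sector_hE sp) ?vE ?v'E; [rewrite E /turn rotNK|lra].
by split; [right|rewrite vh; case/andP: hv].
Qed.

End MoveReflected.

Section Swaps.
Variable k : nat.
Local Notation N := (k.*2.+1).

(** Rotations about [p] exchange arcs 1 and 2, 3 and 4, and so on, and arc 0 is their own;
    [even_swap] does the same for [q], with the last arc fixed. *)
Definition odd_swap (t : 'I_N) : 'I_N := inord (if odd t then t.+1 else t.-1).
Definition even_swap (t : 'I_N) : 'I_N :=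
  inord (if odd t then t.-1 else if t == k.*2 :> nat then k.*2 else t.+1).

Lemma odd_swapE t : odd_swap t = (if odd t then t.+1 else t.-1) :> nat.
Proof.
rewrite inordK //; have := ltn_ord t; case: (boolP (odd t)) => ot; last by lia.
by rewrite ltnS leq_eqVlt => /orP[/eqP E|//]; rewrite E odd_double in ot.
Qed.

Lemma even_swapE t : even_swap t = (if odd t then t.-1 else if t == k.*2 :> nat then k.*2 else t.+1) :> nat.
Proof.
rewrite inordK //; have := ltn_ord t; case: (boolP (odd t)) => ot; first by lia.
by case: eqP => E; lia.
Qed.

Lemma odd_swapK : involutive odd_swap.
Proof.
move=> t; apply: val_inj; rewrite /= !odd_swapE; case: (boolP (odd t)) => ot /=; first by rewrite ot.
by case: (val t) ot => [|m] //=; rewrite negbK => ->.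
Qed.

Lemma even_swapK : involutive even_swap.
Proof.
move=> t; apply: val_inj; rewrite /= !even_swapE; case: (boolP (odd t)) => ot.
  have := ltn_ord t; case: (val t) ot => [|m] //= om lt; rewrite (negPf om).
  by case: eqP => // E; lia.
by case: eqP => [->|E]; [rewrite odd_double eqxx|rewrite /= ot].
Qed.

Lemma odd_swap0 : odd_swap ord0 = ord0.
Proof. by apply: val_inj; rewrite /= odd_swapE. Qed.

Lemma even_swap_max : even_swap ord_max = ord_max.
Proof. by apply: val_inj; rewrite /= even_swapE /= odd_double eqxx. Qed.

Lemma odd_ltn_double t : odd t -> (t < N)%N -> (t < k.*2)%N.
Proof. by move=> ot; rewrite ltnS leq_eqVlt => /orP[/eqP E|//]; rewrite E odd_double in ot. Qed.

Lemma odd_slope (j : nat) : odd `|(N%:Z - 2 * j%:Z)%R|%N /\ odd `|N%:Z|%N.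
Proof. by split; lia. Qed.

End Swaps.

(** * The equation satisfied by the angle *)

Section OrbitEquation.
Variable R : realType.
Local Notation P := (R * R)%type.
Variables (gamma : set P) (c : R -> P) (p q : P) (a : R) (e f : P) (s1 s2 u1 u2 : R)
  (h l h' l' : R -> R) (x : R).
Local Notation c' := (flip_param false x c).
Hypotheses (sp : sector_param gamma c p a e s1 s2 h l)
  (sq : sector_param gamma c' q a f u1 u2 h' l')
  (pq : p <> q) (x01 : 0 <= x < 1).
Variables (A : nat -> P * P) (k : nat).
Local Notation n := k.*2.
Local Notation N := (k.*2.+1).
Local Notation move := (arc_move c p q a a s1 s2 u1 u2 false x).
Hypotheses (k0 : (0 < k)%N) (A0 : A 0%N = (p, e)) (An : A n = (q, f))
  (moves : forall t, (t < n)%N -> exists pos, move (~~ odd t) pos (A t) (A t.+1)).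

Let a_in := sector_a_in sp.
Let mid : 0 < a / 2 < a. Proof. by case/andP: a_in => ? _; lra. Qed.
Let Q t := rot (a / 2) (A t).1 (A t).2.

(** Each disjoint arc is represented by its midpoint, and [sector_germ] keeps midpoints away from
    [q], where the curve is cut a second time. *)
Lemma orbit_midpoints : exists V : nat -> R, forall t, (t <= n)%N ->
  [/\ 0 <= V t < 1, c (V t) = Q t & V t <> x].
Proof.
have [V VE] : {V : nat -> R & forall t, (t <= n)%N -> 0 <= V t < 0 + 1 /\ c (V t) = Q t}.
  apply: (@choice _ _ (fun t v => (t <= n)%N -> 0 <= v < 0 + 1 /\ c v = Q t)) => t.
  have [tn|tn] := leqP t n; last by exists 0.
  have [|v vE] := param_base (sector_cp sp) 0 (z := Q t); last by exists v.
  by apply: (placed_arc_in sp (orbit_placed sp A0 moves tn)); have := mid; lra.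
exists V => t tn; have [] := VE t tn; rewrite add0r => VI cV; split=> // Vx.
have [wz [m ap]] := orbit_placed sp A0 moves tn; have [m' ap'] := flip_param_arc false x ap.
have a0 : 0 < a by case/andP: a_in.
apply: (sector_germ sq a0 wz ap' mid); rewrite -/(Q t) -cV Vx.
by rewrite -(sector_c0 sq) /flip_param add0r.
Qed.

Theorem orbit_equation : exists S T : int, [/\ 1 < T, odd `|S|%N, odd `|T|%N, coprimez S T &
  line_run (- expi a) S T 1 = 0].
Proof.
have [V VE] := orbit_midpoints; have x01' := x01.
pose V' t := if x < V t then V t - x else V t + 1 - x.
have [ps psE] : {ps : nat -> bool & forall t, (t < n)%N -> move (~~ odd t) (ps t) (A t) (A t.+1)}.
  apply: (@choice _ _ (fun t b => (t < n)%N -> move (~~ odd t) b (A t) (A t.+1))) => t.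
  by have [tn|] := ltnP t n; [have [b bE] := moves tn; exists b|exists true].
have V'E t : (t <= n)%N -> 0 <= V' t < 1 /\ c' (V' t) = Q t.
  move=> tn; have [VI cV Vx] := VE t tn; rewrite /V' /flip_param; case: ltP => xV.
    by rewrite subrK cV; split=> //; lra.
  have lt : V t < x by rewrite lt_neqAle xV andbT; apply/eqP.
  rewrite subrK; case: (sector_cp sp) => _ per _ _.
  by rewrite per; split; first lra.
have step t : (t < n)%N -> Q t.+1 = rot (turn (ps t) a) (if odd t then p else q) (Q t) /\
    branch c s1 s2 u1 u2 false x (~~ odd t) true (if ps t then Q t else Q t.+1).
  move=> tn; have [BE _ br] := psE t tn; have [b1 b2] := br _ mid; split.
    by rewrite /Q BE /= [RHS]rot_rot; case: (odd t).
  by case: (ps t) b1 b2.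
have stepV t : (t < n)%N -> odd t -> reflected s1 h (V t) (V t.+1) /\ if ps t then V t <= s1 else s2 <= V t.
  move=> tn ot; have [QE br] := step t tn; rewrite ot /= in QE br.
  have [vI vE _] := VE t (ltnW tn); have [v'I v'E _] := VE t.+1 tn.
  exact: (move_reflected sp QE br vE v'E vI v'I).
have stepV' t : (t < n)%N -> ~~ odd t -> reflected u1 h' (V' t) (V' t.+1) /\ if ps t then V' t <= u1 else u2 <= V' t.
  move=> tn ot; have [QE br] := step t tn; rewrite (negPf ot) /= in QE br.
  have [vI vE] := V'E t (ltnW tn); have [v'I v'E] := V'E t.+1 tn.
  exact: (move_reflected sq QE br vE v'E vI v'I).
have tle (t : 'I_N) : (t <= n)%N by rewrite -ltnS.
have Qinj (s t : 'I_N) : Q s = Q t -> s = t.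
  wlog lt : s t / (s < t)%N => [w|] E.
    by have [lt|lt|/val_inj //] := ltngtP s t; [exact: w|apply/esym; exact: w].
  by exfalso; apply: (orbit_disjoint sp sq (lexx a) A0 moves lt (tle t) mid mid E).
have Vinj (s t : 'I_N) : V s = V t -> s = t.
  have [_ Es _] := VE s (tle s); have [_ Et _] := VE t (tle t).
  by move=> e'; apply: Qinj; rewrite -Es -Et e'.
have V'inj (s t : 'I_N) : V' s = V' t -> s = t.
  have [_ Es] := V'E s (tle s); have [_ Et] := V'E t (tle t).
  by move=> e'; apply: Qinj; rewrite -Es -Et e'.
have mid' : 0 <= a / 2 <= a by have := mid; lra.
have V0 : s1 < V 0%N < s2.
  have [vI vE _] := VE 0%N (leq0n _); have li := sector_l_inner sp mid.
  have [s10 s12 s21 _ _] := sector_ineqs sp.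
  suff -> : V 0%N = l (a / 2) by [].
  by apply: (sector_param_eq sp) => //; [rewrite vE /Q A0 (sector_lE sp)|lra].
have Vn : u1 < V' n < u2.
  have [vI vE] := V'E n (leqnn _); have li := sector_l_inner sq mid.
  have [s10 s12 s21 _ _] := sector_ineqs sq.
  suff -> : V' n = l' (a / 2) by [].
  by apply: (sector_param_eq sq) => //; [rewrite vE /Q An (sector_lE sq)|lra].
have reflC (d : R) g u v : reflected d g u v -> reflected d g v u by case=> ?; [right|left].
have sgpV (t : 'I_N) : t != ord0 -> reflected s1 h (V t) (V (odd_swap t)).
  rewrite -val_eqE /= odd_swapE => t0; case: (boolP (odd t)) => ot.
    exact: (proj1 (stepV t (odd_ltn_double ot (ltn_ord t)) ot)).
  have := ltn_ord t; case: (val t) t0 ot => [//|m] /= _; rewrite negbK => om lt.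
  by apply: reflC; apply: (proj1 (stepV m _ om)).
have sgqV (t : 'I_N) : t != ord_max -> reflected u1 h' (V' t) (V' (even_swap t)).
  rewrite -val_eqE /= even_swapE => tn; rewrite (negPf tn).
  have lt : (t < n)%N by rewrite ltn_neqAle tn tle.
  case: (boolP (odd t)) => ot; last by apply: (proj1 (stepV' t _ ot)).
  case: (val t) tn ot lt => [//|m] /= _ om lt.
  by apply: reflC; apply: (proj1 (stepV' m _ om)); exact: ltnW.
have hlo (u : R) : 0 < u <= s1 -> s2 <= h u by move=> /(sector_h_lt1 sp) /andP[].
have hlo' (u : R) : 0 < u <= u1 -> u2 <= h' u by move=> /(sector_h_lt1 sq) /andP[].
have hdec (u v : R) : 0 < u -> u < v -> v <= s1 -> h v < h u by move=> /ltW; exact: (sector_h_dec sp).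
have hdec' (u v : R) : 0 < u -> u < v -> v <= u1 -> h' v < h' u by move=> /ltW; exact: (sector_h_dec sq).
have [_ s12 _ _ _] := sector_ineqs sp; have [_ u12 _ _ _] := sector_ineqs sq.
have refl := reflected_rank Vinj s12 hlo hdec (o := ord0) V0 (odd_swap0 k) (@odd_swapK k) sgpV.
have refl' := reflected_rank V'inj u12 hlo' hdec' (o := ord_max) Vn (even_swap_max k) (@even_swapK k) sgqV.
have rk0 := reflected_rank_mid Vinj s12 hlo hdec (o := ord0) V0 (odd_swap0 k) (@odd_swapK k) sgpV.
have rkn := reflected_rank_mid V'inj u12 hlo' hdec' (o := ord_max) Vn (even_swap_max k) (@even_swapK k) sgqV.
pose j := (\sum_(s < N) (V s < x)%R)%N.
have rk_lt t : (t < N)%N -> (rank k V t < N)%N by move=> tN; exact: (rank_bound V (Ordinal tN)).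
have rk'_lt t : (t < N)%N -> (rank k V' t < N)%N by move=> tN; exact: (rank_bound V' (Ordinal tN)).
have rk_mid t : (t < N)%N -> rank k V t = k -> t = 0%N.
  by move=> tN E; have := rank_inj Vinj (s := Ordinal tN) (t := ord0); rewrite /= E rk0 => /(_ erefl) [].
have rk'_mid t : (t < N)%N -> rank k V' t = k -> t = n.
  by move=> tN E; have := rank_inj V'inj (s := Ordinal tN) (t := ord_max); rewrite /= E rkn => /(_ erefl) [].
have rk_shift t : (t < N)%N -> (rank k V t = rank k V' t + j \/ rank k V t + N = rank k V' t + j)%N.
  move=> tN; apply: (rank_shift (Ordinal tN) (V' := V')) => s.
  by have [? ? ?] := VE s (tle s).
have rk_reflect t : odd t -> (t < n)%N -> (rank k V t.+1 + rank k V t = n)%N.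
  move=> ot tn; have tN : (t < N)%N by exact: ltnW.
  by have := refl (Ordinal tN); rewrite odd_swapE /= ot.
have rk'_reflect t : ~~ odd t -> (t < n)%N -> (rank k V' t.+1 + rank k V' t = n)%N.
  move=> ot tn; have tN : (t < N)%N by exact: ltnW.
  by have := refl' (Ordinal tN); rewrite even_swapE /= (negPf ot) ltn_eqF.
have sign := orbit_sign rk_lt rk'_lt rk_mid rk'_mid rk_shift rk0 rk_reflect rk'_reflect.
have cop := orbit_coprime rk_lt rk'_lt rk_mid rk'_mid rk_shift rk0 rk_reflect rk'_reflect.
exists (N%:Z - 2 * j%:Z), N%:Z; split=> //.
- by case: (k) k0.
- by have [] := odd_slope k j.
- by have [] := odd_slope k j.
have psV t : (t < n)%N -> odd t -> ps t = (rank k V t < k)%N.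
  move=> tn ot; have tN : (t < N)%N by exact: ltnW.
  have := rank_ltE Vinj (Ordinal tN) ord0; rewrite /= rk0 => ->.
  by have [_] := stepV t tn ot; case: (ps t) => le; apply/esym; [|apply/negbTE; rewrite -leNgt]; lra.
have psV' t : (t < n)%N -> ~~ odd t -> ps t = (rank k V' t < k)%N.
  move=> tn ot; have tN : (t < N)%N by exact: ltnW.
  have := rank_ltE V'inj (Ordinal tN) ord_max; rewrite /= rkn => ->.
  by have [_] := stepV' t tn ot; case: (ps t) => le; apply/esym; [|apply/negbTE; rewrite -leNgt]; lra.
(* Runs number their steps from 1 and the orbit from 0, hence the predecessor. *)
have signE t : (0 < t <= n)%N -> slope_sign (N%:Z - 2 * j%:Z) N t = ps t.-1.
  move=> tI; rewrite sign //; case: t tI => [//|t] /= tn; case: (boolP (odd t)) => ot /=.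
    by rewrite psV.
  by rewrite psV'.
rewrite /line_run /=.
have congr_run m (y : R[i]) : (m <= n)%N -> affine_run (- expi a) (slope_sign (N%:Z - 2 * j%:Z) N) m y =
    affine_run (- expi a) (fun t => ps t.-1) m y.
  by elim: m => [//|m IH] mn /=; rewrite signE // IH // ltnW.
rewrite congr_run //.
have := @affine_run_orbit _ (expi a) (cx p) (cx q) (fun t => cx (A t).1) ps n.
have cpq : cx p <> cx q by move=> /cx_inj.
have Z0 : cx (A 0%N).1 = cx p by rewrite A0.
move=> /(_ cpq Z0) ->//; first by rewrite An odd_double /= subrr mulr0 mul0r.
by move=> t tn; have [-> _ _] := psE t tn; rewrite /= cx_rot_turn; case: (odd t).
Qed.

End OrbitEquation.

Section TwoCentres.
Variable R : realType.
Local Notation P := (R * R)%type.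

Lemma generator_in_boundary (T : tile R) eta p a : radially_generated T eta p a -> tboundary T p.
Proof. by case=> _ tp _ ->; left; left; left. Qed.

Lemma generator_sector (T : tile R) eta p a : radially_generated T eta p a ->
  exists c e s1 s2 h l, sector_param (tboundary T) c p a e s1 s2 h l.
Proof.
move=> gen; have [c0 cp0] := closed_param_exists (tboundary_simple T).
have [x xE] := (param_range cp0 p).1 (generator_in_boundary gen).
have [|e [c [_ [s1 [s2 [h [l sp]]]]]]] := radially_generated_sector gen (param_shift cp0 x).
  by rewrite add0r.
by exists c, e, s1, s2, h, l.
Qed.

Lemma two_generators_equation (T : tile R) eta nu p q a b :
  radially_generated T eta p a -> radially_generated T nu q b -> p <> q -> b <= a ->
  a = b /\ exists S T : int, [/\ 1 < T, odd `|S|%N, odd `|T|%N, coprimez S T &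
  line_run (- expi a) S T 1 = 0].
Proof.
move=> genp genq pq ba; have [c [e [s1 [s2 [h [l sp]]]]]] := generator_sector genp.
have cp := sector_cp sp.
have [x [xI xE]] := param_base cp 0 (generator_in_boundary genq); rewrite add0r in xI.
have [|f [c' [c'E [u1 [u2 [h' [l' sq]]]]]]] := radially_generated_sector genq (param_shift cp x).
  by rewrite add0r.
have [rev {}c'E] : exists rev, c' = flip_param rev x c.
  by case: c'E => ->; [exists false|exists true].
rewrite {}c'E in sq.
have [A [n [A0 moves st]]] := orbit_exists sp sq ba.
have [n0 An ab rev0] := orbit_end sp sq pq ba A0 moves st.
split=> //; case: st => on _; have nE : n = n./2.*2 by rewrite -[LHS]odd_double_half (negPf on).
move: sq moves; rewrite {}rev0 -ab => sq moves.
apply: (orbit_equation sp sq pq xI (A := A) (k := n./2)) => //.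
- by case: (n) n0 on => [|[|m]].
- by rewrite -nE An.
- by rewrite -nE.
Qed.

End TwoCentres.

(** * Tiling a disk *)

Section HalfDisc.
Variable R : realType.
Local Notation P := (R * R)%type.

Lemma open_sqd (U : set P) (z : P) : open U -> U z ->
  exists2 d : R, 0 < d & forall y, sqd y z < d -> U y.
Proof.
move=> oU Uz; have /nbhs_ballP [r /= r0 sub] : nbhs z U by apply: open_nbhs_nbhs.
exists (r ^+ 2); first by rewrite exprn_gt0.
move=> y; rewrite /sqd => yz; apply: sub.
have sq (u v : R) : (u - v) ^+ 2 < r ^+ 2 -> `|v - u| < r.
  by move=> h; rewrite distrC -(@ltr_pXn2r _ 2) ?nnegrE ?normr_ge0 ?(ltW r0) // real_normK ?num_real.
have h1 := sqr_ge0 (y.1 - z.1); have h2 := sqr_ge0 (y.2 - z.2).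
by split; apply: sq; lra.
Qed.

Lemma closure_sqd (U : set P) (z : P) (d : R) : closure U z -> 0 < d -> exists2 y, U y & sqd y z < d.
Proof.
move=> cz d0; have : nbhs z [set y | sqd y z < d].
  apply: open_nbhs_nbhs; split; last by rewrite /= sqdxx.
  rewrite (_ : [set y | _] = (fun y => sqd y z) @^-1` [set t | t < d]) //.
  by apply: open_comp => [y _|]; [apply: sqd_continuous; move=> ?; exact: cvg_id|exact: open_lt].
by move=> /cz [y [Uy yz]]; exists y.
Qed.

(** [U] and the complement of its closure are open, so membership is locally constant along a path
    that avoids the frontier. *)
Lemma path_frontier (U : set P) (f : R -> P) (u v : R) : open U -> continuous f -> u <= v ->
  (forall t : R, ~ frontier U (f t)) -> U (f u) <-> U (f v).
Proof.
move=> oU cf uv nf; apply: (@interval_gluing R (fun u v => U (f u) <-> U (f v))) uv => {u v}.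
  by move=> u v w _ _ -> ->.
move=> t; have [Ut|Ut] := pselect (U (f t)).
  have /nbhs_ballP [r /= r0 sub] : nbhs t (f @^-1` U) by apply: cf; apply: open_nbhs_nbhs.
  exists r => // u v h1 h2 h3 h4; split=> _; apply: sub; rewrite /ball /= ltr_norml; lra.
have nc : ~ closure U (f t).
  by move=> cl; apply: (nf t); split=> //; move=> /interior_subset.
have /nbhs_ballP [r /= r0 sub] : nbhs t (f @^-1` ~` closure U).
  by apply: cf; apply: open_nbhs_nbhs; split=> //; apply: closed_openC; exact: closed_closure.
have out s : ball t r s -> ~ U (f s) by move=> /sub h /subset_closure.
exists r => // u v h1 h2 h3 h4; split=> Uf; exfalso; apply: out Uf; rewrite /ball /= ltr_norml; lra.
Qed.

Definition segment (y0 y1 : P) (t : R) : P := (y0.1 + t * (y1.1 - y0.1), y0.2 + t * (y1.2 - y0.2)).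

Lemma segment_continuous y0 y1 : continuous (segment y0 y1).
Proof.
move=> t; rewrite /continuous_at /segment; apply: cvg_pair_pt; apply: cvgD; try exact: cvg_cst.
  by apply: cvgM; [exact: cvg_id|exact: cvg_cst].
by apply: cvgM; [exact: cvg_id|exact: cvg_cst].
Qed.

Lemma segment_sqd y0 y1 z (t : R) : 0 <= t <= 1 ->
  sqd (segment y0 y1 t) z <= (1 - t) * sqd y0 z + t * sqd y1 z.
Proof.
move=> /andP[t0 t1]; rewrite -subr_ge0.
have -> : (1 - t) * sqd y0 z + t * sqd y1 z - sqd (segment y0 y1 t) z = t * (1 - t) * sqd y0 y1.
  by rewrite /segment /sqd /=; ring.
by rewrite !mulr_ge0 ?sqd_ge0 // subr_ge0.
Qed.

Lemma segment_sqd_lt y0 y1 z (t d : R) : 0 <= t <= 1 -> sqd y0 z < d -> sqd y1 z < d ->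
  sqd (segment y0 y1 t) z < d.
Proof.
move=> tI h0 h1; apply: le_lt_trans (segment_sqd _ _ _ tI) _.
have [->|t1] := eqVneq t 1; first by rewrite subrr mul0r add0r mul1r.
have : (1 - t) * sqd y0 z < (1 - t) * d by rewrite ltr_pM2l // subr_gt0 lt_neqAle t1; case/andP: tI.
have : t * sqd y1 z <= t * d by rewrite ler_wpM2l ?(ltW h1) //; case/andP: tI.
by lra.
Qed.

Variables (gamma U : set P) (c : R -> P) (p : P) (r2 : R).
Hypotheses (cp : closed_param gamma c) (oU : open U) (frU : frontier U = gamma)
  (in_disk : forall z, U z -> sqd z p <= r2).

(** A point of [U] on the rim could be pushed outwards by a small factor [1 + s] and remain in [U],
    outside the disk. *)
Lemma open_in_disk z : U z -> 0 < r2 -> sqd z p < r2.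
Proof.
move=> Uz r0; rewrite lt_neqAle in_disk // andbT; apply/eqP => zr.
have [d d0 sub] := open_sqd oU Uz.
pose s := Num.min (d / (2 * r2)) 1.
have s0 : 0 < s by rewrite lt_min ltr01 divr_gt0 // mulr_gt0.
have s1 : s <= 1 by rewrite ge_min lexx orbT.
have sd : s * r2 < d.
  have : s <= d / (2 * r2) by rewrite ge_min lexx.
  rewrite ler_pdivlMr ?mulr_gt0 //; lra.
pose y := segment p z (1 + s).
have yz : sqd y z = s ^+ 2 * r2 by rewrite -zr /y /segment /sqd /=; ring.
have yp : sqd y p = (1 + s) ^+ 2 * r2 by rewrite -zr /y /segment /sqd /=; ring.
have : U y.
  apply: sub; rewrite yz; apply: le_lt_trans sd; rewrite ler_pM2r // expr2 ler_piMr //; exact: ltW.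
move=> /in_disk; rewrite yp.
have -> : (1 + s) ^+ 2 * r2 = r2 + (2 * (s * r2) + s ^+ 2 * r2) by ring.
have h1 : 0 < s * r2 by rewrite mulr_gt0.
have h2 : 0 < s ^+ 2 * r2 by rewrite mulr_gt0 // exprn_gt0.
by rewrite gerDl; apply/negP; rewrite -ltNge; lra.
Qed.

(** By compactness, the part of the curve with parameters away from [v] keeps a positive distance
    from [c v]. *)
Lemma curve_near_param (v eps : R) : 0 < eps -> exists2 d : R, 0 < d &
  forall z, gamma z -> sqd z (c v) < d -> exists2 s : R, `|s - v| < eps & c s = z.
Proof.
move=> eps0; pose e1 := Num.min eps (1 / 2).
have e10 : 0 < e1 by rewrite lt_min eps0 /=; lra.
have e1e : e1 <= eps by rewrite ge_min lexx.
have e12 : e1 <= 1 / 2 by rewrite ge_min lexx orbT.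
have le : v + e1 <= v + 1 - e1 by lra.
have [] := @EVT_min R (fun s => sqd (c s) (c v)) _ _ le.
  by apply: continuous_subspaceT; apply: sqd_continuous; exact: (param_continuous cp).
move=> m mI min; rewrite in_itv /= in mI.
exists (sqd (c m) (c v)).
  by apply: sqd_gt0 => /(param_inj_lt cp) h; have := h ltac:(rewrite ltr_norml; lra); lra.
move=> z /(param_base cp v) [s [sI <-]] lt.
have [h1|h1] := ltP s (v + e1); first by exists s => //; rewrite ltr_norml; lra.
have [h2|h2] := leP s (v + 1 - e1).
  have := min s; rewrite in_itv /= h1 h2 => /(_ isT); lra.
exists (s - 1); first by rewrite ltr_norml; lra.
by rewrite -(param_period cp (s - 1) 1) subrK.
Qed.

(** Near the given point the frontier of [U] lies on the rim. A segment from a nearby point of [U]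
    to a nearby point inside the disk stays inside the disk, so it never meets the frontier. *)
Lemma half_disc d w (t : R) : 0 < r2 -> w <> p -> sqd w p = r2 -> 0 < d < pi *+ 2 ->
  (forall s : R, 0 <= s <= d -> gamma (rot s p w)) -> 0 < t < d ->
  exists2 eps : R, 0 < eps & forall y, sqd y (rot t p w) < eps -> sqd y p < r2 -> U y.
Proof.
move=> r0 wp wr d_in hg tI; have d0 : 0 < d by case/andP: d_in.
have [up [m ap]] := arc_path_exists cp wp d_in hg.
have [eps1 eps10 near1] := arc_path_nbhs d0 ap tI.
have [eps eps0 near] := curve_near_param (m t) eps10.
have mE : c (m t) = rot t p w by case: ap => mE _ _; apply: mE; lra.
rewrite mE in near.
have circ z : gamma z -> sqd z (rot t p w) < eps -> sqd z p = r2.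
  move=> gz zt; have [s sI <-] := near z gz zt; have [u uI <-] := near1 s sI.
  by rewrite (arc_path_circle ap) //; lra.
have gz : gamma (rot t p w) by apply: hg; lra.
have [y0 Uy0 y0e] : exists2 y, U y & sqd y (rot t p w) < eps.
  by apply: closure_sqd => //; move: gz; rewrite -frU => -[].
exists eps => // y ye yr.
pose f s := segment y0 y (clamp 0 1 s).
have cf : continuous f.
  move=> s; apply: (@continuous_comp _ _ _ (clamp 0 1) (segment y0 y)).
    exact: clamp_continuous.
  exact: segment_continuous.
have f0 : f 0 = y0.
  rewrite /f clamp_id ?lexx ?ler01 // /segment !mul0r !addr0; by case: (y0).
have f1 : f 1 = y.
  by rewrite /f clamp_id ?lexx ?ler01 // /segment !mul1r ![_ + (_ - _)]addrC !subrK; case: (y).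
rewrite -f1; apply/(path_frontier oU cf (@ler01 R)); last by rewrite f0.
move=> s; rewrite frU => gs; have cl := @clamp_in R 0 1 s (@ler01 R).
have := circ _ gs (segment_sqd_lt cl y0e ye).
have := segment_sqd_lt cl (open_in_disk Uy0 r0) yr.
by rewrite -/(f s) => + E; rewrite E ltxx.
Qed.

End HalfDisc.

Section Tiling.
Variable R : realType.
Local Notation P := (R * R)%type.

(** Since the circle avoids [p], its lift stays between consecutive integers and returns to its
    start. But it is strictly monotone on two overlapping three-quarter turns, in the same sense on
    both. *)
Lemma circle_not_in_curve (gamma : set P) (c : R -> P) (p z : P) : closed_param gamma c -> c 0 = p ->
  z <> p -> (forall t : R, gamma (rot t p z)) -> False.
Proof.
move=> cp c0 zp hg; have pi0 := @pi_gt0 R.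
have pi2 : 0 <= (pi : R) *+ 2 by rewrite mulr2n; lra.
have [k ck kE] := path_lift cp (rot_continuous_theta (p := p) (z := z)) hg pi2.
pose n := Num.floor (k 0).
have I0 : 0 <= (0 : R) <= pi *+ 2 by rewrite lexx.
have I2 : 0 <= (pi : R) *+ 2 <= pi *+ 2 by rewrite lexx pi2.
have notint (t : R) (m : int) : 0 <= t <= pi *+ 2 -> k t <> m%:~R.
  move=> tI E; apply: zp; apply: (@rot_inj _ t p); rewrite rot_center -kE // E.
  by rewrite -[m%:~R]add0r (param_period cp).
have kI (t : R) : 0 <= t <= pi *+ 2 -> n%:~R < k t < n%:~R + 1.
  have := floor_itv (k 0); rewrite -/n intrD mulr1z => /andP[n1 n2] tI.
  have [t0 t2] := andP tI.
  have ivt v : (k 0 <= v <= k t) || (k t <= v <= k 0) -> exists2 u : R, 0 <= u <= pi *+ 2 & k u = v.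
    move=> /(continuous_ivt ck t0) [u uI uE]; exists u => //; lra.
  apply/andP; split; rewrite ltNge; apply/negP => le.
    by have [|u uI] := ivt n%:~R; [apply/orP; right; lra|exact: notint].
  have [|u uI] := ivt (n + 1)%:~R; last exact: notint.
  by rewrite intrD mulr1z; apply/orP; left; lra.
have inj (s t : R) : 0 <= s < pi *+ 2 -> 0 <= t < pi *+ 2 -> k s = k t -> s = t.
  move=> sI tI E; apply: (rot_theta_inj zp); first by rewrite ltr_norml; lra.
  by rewrite -!kE ?E //; lra.
have e02 : k 0 = k (pi *+ 2).
  apply: (param_inj_lt cp); first by rewrite !kE // rot0 rot2pi.
  by have := kI 0 I0; have := kI _ I2; rewrite ltr_norml; lra.
have inj' (s t : R) : 0 < s <= pi *+ 2 -> 0 < t <= pi *+ 2 -> k s = k t -> s = t.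
  move=> sI tI E; have [s2|s2] := eqVneq s (pi *+ 2); have [t2|t2] := eqVneq t (pi *+ 2).
  - by rewrite s2 t2.
  - have : 0 = t by apply: inj; [lra|lra|rewrite e02 -s2].
    by lra.
  - have : 0 = s by apply: inj; [lra|lra|rewrite e02 -t2].
    by lra.
  by apply: inj => //; lra.
have lt1 : (0 : R) < pi + pi / 2 by lra.
have lt2 : (pi : R) / 2 < pi *+ 2 by lra.
have i1 (s t : R) : 0 <= s <= pi + pi / 2 -> 0 <= t <= pi + pi / 2 -> k s = k t -> s = t.
  by move=> sI tI; apply: inj; lra.
have i2 (s t : R) : pi / 2 <= s <= pi *+ 2 -> pi / 2 <= t <= pi *+ 2 -> k s = k t -> s = t.
  by move=> sI tI; apply: inj'; lra.
have p1 : (pi : R) / 2 < pi by lra.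
have p2 : (pi : R) < pi *+ 2 by lra.
case: (continuous_inj_mono ck lt1 i1) => m1; case: (continuous_inj_mono ck lt2 i2) => m2.
- have := m1 0 pi (lexx _) pi0 ltac:(lra); have := m2 pi (pi *+ 2) ltac:(lra) p2 (lexx _).
  by rewrite e02; lra.
- have := m1 (pi / 2) pi ltac:(lra) p1 ltac:(lra); have := m2 (pi / 2) pi (lexx _) p1 (ltW p2).
  by lra.
- have := m1 (pi / 2) pi ltac:(lra) p1 ltac:(lra); have := m2 (pi / 2) pi (lexx _) p1 (ltW p2).
  by lra.
have := m1 0 pi (lexx _) pi0 ltac:(lra); have := m2 pi (pi *+ 2) ltac:(lra) p2 (lexx _).
by rewrite e02; lra.
Qed.

(** The sets of angles handled by a fixed [j] are closed and cover the line, so one of them contains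
    an interval. *)
Lemma covered_arc (K : set P) (p z : P) (a : R) : closed K ->
  (forall t : R, exists j : nat, K (rot (- (j%:R * a)) p (rot t p z))) ->
  exists (w : P) (d : R), [/\ sqd w p = sqd z p, 0 < d < pi *+ 2 & forall s : R, 0 <= s <= d -> K (rot s p w)].
Proof.
move=> cK cov; pose E (j : nat) : set R^o := [set t : R | K (rot (- (j%:R * a)) p (rot t p z))].
have cE j : closed (E j).
  rewrite (_ : E j = (fun t : R => rot (- (j%:R * a)) p (rot t p z)) @^-1` K) //.
  by apply: preimage_closed => // t _; apply: rot_continuous; exact: rot_continuous_theta.
have [j nd] : exists j, ~ dense (~` E j).
  apply/not_existsP => all.
  have bE : dense (\bigcap_j (~` E j)).
    by apply: Baire => j; split; [exact/closed_openC|exact: contrapT (all j)].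
  have [||t [_ tE]] := bE setT; [by exists 0|exact: openT|].
  by have [j jE] := cov t; apply: (tE j I).
have [W [[t0 Wt0] [oW sub]]] : exists W : set R^o, W !=set0 /\ (open W /\ W `<=` E j).
  apply: contrapT => no; apply: nd => W W0 oW; apply: contrapT => no'; apply: no; exists W; split=> //; split=> // t Wt.
  by apply: contrapT => nE; apply: no'; exists t.
have /nbhs_ballP [r /= r0 rW] : nbhs t0 W by apply: open_nbhs_nbhs.
have pi0 := @pi_gt0 R.
exists (rot (t0 - j%:R * a) p z), (Num.min (r / 2) pi); split; first by rewrite sqd_rot_center.
  rewrite lt_min gt_min pi0; apply/andP; split; first by rewrite divr_gt0.
  by apply/orP; right; lra.
move=> s sI; have : E j (t0 + s).
  apply/sub/rW; rewrite /ball /= opprD addrA subrr sub0r normrN.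
  have : Num.min (r / 2) pi <= r / 2 by rewrite ge_min lexx.
  by rewrite ltr_norml; lra.
by rewrite /E /= -!rotD; congr (K (rot _ _ _)); ring.
Qed.

Lemma iter_rot j (a : R) (p z : P) : iter j (rot a p) z = rot (j%:R * a) p z.
Proof. by elim: j => [|j IH] /=; rewrite ?mul0r ?rot0 // IH -rotD -natr1; congr (rot _ _ _); ring. Qed.

Lemma image_iter_rot j (a : R) (p z : P) (X : set P) :
  (iter j (rot a p) @` X) z <-> X (rot (- (j%:R * a)) p z).
Proof.
split=> [[y Xy <-]|Xz]; first by rewrite iter_rot rotK.
by exists (rot (- (j%:R * a)) p z) => //; rewrite iter_rot rotNK.
Qed.

Lemma region_boundary_disjoint (T : tile R) z : region T z -> tboundary T z -> False.
Proof.
rewrite -region_frontier => Uz [_]; apply.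
by rewrite (interior_id _).1 //; exact: region_open.
Qed.

Lemma tile_set_closed (T : tile R) : closed (tile_set T).
Proof.
have -> : tile_set T = closure (region T); last exact: closed_closure.
rewrite /tile_set -region_frontier eqEsubset; split=> z.
  by move=> [/subset_closure //|[]].
move=> cz; have [Uz|nU] := pselect (region T z); [by left|right; split=> //].
by move=> /interior_subset.
Qed.

Section Tile.
Variables (T : tile R) (c : R -> P) (p : P) (a : R) (e : P) (s1 s2 : R) (h l : R -> R) (r : R).
Hypothesis sp : sector_param (tboundary T) c p a e s1 s2 h l.
Hypotheses (r0 : 0 < r)
  (cover : \bigcup_(k in [set: nat]) (iter k (rot a p) @` tile_set T) = disk p r)
  (disj : forall j k : nat,
          iter j (rot a p) @` tile_set T <> iter k (rot a p) @` tile_set T ->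
          iter j (rot a p) @` tile_set T `&` iter k (rot a p) @` tile_set T
            `<=` iter j (rot a p) @` tboundary T `&` iter k (rot a p) @` tboundary T).

Let cp := sector_cp sp.

Lemma tile_in_disk z : tile_set T z -> sqd z p <= r ^+ 2.
Proof.
move=> Tz; have : disk p r z by rewrite -cover; exists 0%N => //; exists z.
by [].
Qed.

(** Distinct copies meet only along their boundaries, so a common point of the open regions makes
    the two copies equal. *)
Lemma tile_overlap j y : region T y -> region T (rot (- (j%:R * a)) p y) ->
  forall z, tile_set T z <-> tile_set T (rot (- (j%:R * a)) p z).
Proof.
move=> Uy Uy'; have [E|ne] := pselect (iter j (rot a p) @` tile_set T = iter 0 (rot a p) @` tile_set T).
  move=> z; rewrite -(image_iter_rot j) E image_iter_rot mul0r oppr0 rot0; exact: iff_refl.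
have [|_ [z bz zy]] := disj ne (t := y).
  by split; [apply/image_iter_rot; left|exists y => //; left].
by exfalso; rewrite /= in zy; rewrite zy in bz; exact: region_boundary_disjoint Uy bz.
Qed.

Lemma rim_in_boundary z : sqd z p = r ^+ 2 -> tile_set T z -> tboundary T z.
Proof.
move=> zr [Uz|//]; have := open_in_disk (@region_open _ T) (fun y Uy => tile_in_disk (or_introl Uy)) Uz (exprn_gt0 2 r0).
by rewrite zr ltxx.
Qed.

Lemma tile_half_disc d w (t : R) : w <> p -> sqd w p = r ^+ 2 -> 0 < d < pi *+ 2 ->
  (forall s : R, 0 <= s <= d -> tboundary T (rot s p w)) -> 0 < t < d ->
  exists2 eps : R, 0 < eps & forall y, sqd y (rot t p w) < eps -> sqd y p < r ^+ 2 -> region T y.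
Proof.
apply: half_disc cp (@region_open _ T) (@region_frontier _ T) _ _ _ _ _ => //; last exact: exprn_gt0.
by move=> z Uz; apply: tile_in_disk; left.
Qed.

Definition rim_arc (d : R) (w : P) : Prop :=
  [/\ w <> p, sqd w p = r ^+ 2, 0 < d < pi *+ 2 & forall s : R, 0 <= s <= d -> tboundary T (rot s p w)].

Lemma rotated_rim_arcs d w t d' w' t' b : rim_arc d w -> rim_arc d' w' -> 0 < t < d -> 0 < t' < d' ->
  rot (- b) p (rot t p w) = rot t' p w' -> exists y, region T y /\ region T (rot (- b) p y).
Proof.
move=> [wp wr d_in hg] [wp' wr' d_in' hg'] tI tI' E; have rr : 0 < r ^+ 2 by exact: exprn_gt0.
have [e1 e10 k1] := tile_half_disc wp wr d_in hg tI.
have [e2 e20 k2] := tile_half_disc wp' wr' d_in' hg' tI'.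
pose eps := Num.min e1 e2; have eps0 : 0 < eps by rewrite lt_min e10.
(* The common rim point is pulled towards [p] by the factor [1 - s], little enough to stay in both
   half discs. *)
pose s := Num.min (eps / (2 * r ^+ 2)) (1 / 2).
have s0 : 0 < s by rewrite lt_min !divr_gt0 // mulr_gt0.
have s1' : s <= 1 / 2 by rewrite ge_min lexx orbT.
have sd : s * (2 * r ^+ 2) <= eps.
  by rewrite -ler_pdivlMr ?mulr_gt0 // ge_min lexx.
set z := rot t p w in k1 E; pose y := segment z p s.
have zr : sqd z p = r ^+ 2 by rewrite /z sqd_rot_center.
have yz : sqd y z = s ^+ 2 * r ^+ 2 by rewrite -zr /y /segment /sqd /=; ring.
have yp : sqd y p = (1 - s) ^+ 2 * r ^+ 2 by rewrite -zr /y /segment /sqd /=; ring.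
have yz' : sqd y z < eps.
  apply: lt_le_trans sd; have -> : sqd y z = s * (s * r ^+ 2) by rewrite yz; ring.
  by rewrite ltr_pM2l // ltr_pM2r //; lra.
have yp' : sqd y p < r ^+ 2.
  by rewrite yp gtr_pMl // expr_lt1 //; lra.
exists y; split; first by apply: k1 => //; move: yz'; rewrite lt_min => /andP[].
apply: k2; last by rewrite sqd_rot_center.
by rewrite -E sqd_rot; move: yz'; rewrite lt_min => /andP[].
Qed.

(** Copy [M] overlaps copy 0 along the rim, so the tile is invariant under the excess rotation, and
    its arc would continue backwards by that excess, against [sector_end_before]. *)
Lemma outer_arc_angle (M : nat) : sqd e p = r ^+ 2 -> 0 < M%:R * a - pi *+ 2 < a -> False.
Proof.
move=> er; set th := _ - _ => thI; have [s10 s12 s21 a0 a2] := sector_ineqs sp.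
have ME z : rot (- (M%:R * a)) p z = rot (- th) p z.
  by rewrite -[in LHS](rot2pi p z) -rotD /th; congr (rot _ _ _); ring.
have ra : rim_arc a e.
  split=> //; [exact: (sector_ep sp)|exact: (sector_a_in sp)|].
  by move=> s sI; rewrite -(sector_lE sp) //; exact: (param_in cp).
have [|||y [Uy Uy']] := @rotated_rim_arcs a e ((th + a) / 2) a e ((a - th) / 2) (M%:R * a) ra ra.
- by lra.
- by lra.
- by rewrite ME -rotD; congr (rot _ _ _); lra.
have inv := tile_overlap Uy Uy'.
apply: (sector_end_before sp (b := th)); first by case/andP: thI.
move=> t tI; apply: rim_in_boundary; first by rewrite sqd_rot_center.
have -> : rot (- t) p e = rot (- (M%:R * a)) p (rot (th - t) p e).
  by rewrite ME -rotD; congr (rot _ _ _); ring.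
apply: (inv _).1; right; rewrite -(sector_lE sp (t := th - t) ltac:(lra)).
exact: (param_in cp).
Qed.

(** If the arc about [p] had another radius, a rim arc in the tile could not meet it, and
    [sector_step] would turn that rim arc by [a] or [- a] within the boundary; the half discs at
    these two arcs then give the common interior point. *)
Lemma outer_arc : sqd e p = r ^+ 2.
Proof.
apply: contrapT => ne; have [s10 s12 s21 a0 a2] := sector_ineqs sp.
pose z0 : P := (p.1 + r, p.2).
have z0r : sqd z0 p = r ^+ 2 by rewrite /sqd /z0 /=; ring.
have zp : z0 <> p by move=> E; move: z0r; rewrite E sqdxx => /esym /eqP; rewrite expf_eq0 /= gt_eqF.
have cov (t : R) : exists j : nat, tile_set T (rot (- (j%:R * a)) p (rot t p z0)).
  have : disk p r (rot t p z0) by have := lexx (r ^+ 2); rewrite -{1}z0r -(sqd_rot_center t).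
  by rewrite -cover => -[j _ /image_iter_rot]; exists j.
have [w [d [wr d_in wK]]] := covered_arc (@tile_set_closed T) cov.
rewrite z0r in wr.
have wp : w <> p by move=> E; move: wr; rewrite E sqdxx => /esym /eqP; rewrite expf_eq0 /= gt_eqF.
have wg (s : R) : 0 <= s <= d -> tboundary T (rot s p w).
  by move=> sI; apply: rim_in_boundary; [rewrite sqd_rot_center|exact: wK].
have d0 : 0 < d by case/andP: d_in.
have [up [m ap]] := arc_path_exists cp wp d_in wg.
have [|pos [n [m' [ap' _]]]] := sector_step sp d0 wp ap.
  move=> t tI [t2 _ E]; apply: ne.
  by rewrite -(sqd_rot_center t2) E sqd_rot_center.
rewrite rot_center in ap'.
have ra : rim_arc d w by split.
have ra' : rim_arc d (rot (turn pos a) p w).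
  split=> //; first by move=> E; apply: wp; apply: (@rot_inj _ (turn pos a) p); rewrite rot_center.
    by rewrite sqd_rot_center.
  by move=> s sI; case: ap' => <- // _ _; exact: (param_in cp).
have dI : 0 < d / 2 < d by lra.
have [y [Uy Uy']] : exists y, region T y /\ region T (rot (- (1%:R * a)) p y).
  rewrite mul1r; case: pos ra' {ap'} => ra'.
    apply: (rotated_rim_arcs ra' ra dI dI); rewrite /turn.
    by rewrite rotC rotK.
  by apply: (rotated_rim_arcs ra ra' dI dI); rewrite rotC.
have inv := tile_overlap Uy Uy'.
have invj j z : tile_set T (rot (- (j%:R * a)) p z) -> tile_set T z.
  elim: j z => [|j IH] z; first by rewrite mul0r oppr0 rot0.
  move=> h1; apply: IH; apply: (inv _).2; move: h1; rewrite -rotD.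
  by rewrite (_ : - (j.+1%:R * a) = - (1%:R * a) + - (j%:R * a)) // -natr1; ring.
apply: (circle_not_in_curve cp (sector_c0 sp) zp) => t.
apply: rim_in_boundary; first by rewrite sqd_rot_center.
by have [j] := cov t; exact: invj.
Qed.

End Tile.

Theorem tiles_disk_angle (T : tile R) eta (p : P) (a : R) : radially_generated T eta p a ->
  tiles_disk T p a -> exists2 M : nat, (1 < M)%N & a = pi *+ 2 / M%:R.
Proof.
move=> gen [r [r0 cover disj]]; have [c [e [s1 [s2 [h [l sp]]]]]] := generator_sector gen.
have [_ _ _ a0 a2] := sector_ineqs sp.
(* [M] is the least number of turns by [a] exceeding a full turn; unless $2\pi/a$ is an integer, the
   excess is smaller than [a]. *)
pose M := (Num.truncn (pi *+ 2 / a)).+1.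
have pi0 := @pi_gt0 R; have p2 : pi *+ 2 != 0 :> R by rewrite mulrn_eq0 /= gt_eqF.
have q0 : 0 <= pi *+ 2 / a by rewrite divr_ge0 ?ltW // mulr2n; lra.
have := truncn_itv q0; rewrite -/M ler_pdivlMr // ltr_pdivrMr // => /andP[M1 M2].
have er := outer_arc sp r0 cover disj.
have [E|ne] := eqVneq (Num.truncn (pi *+ 2 / a))%:R (pi *+ 2 / a).
  exists (Num.truncn (pi *+ 2 / a)); last by rewrite E invf_div mulrCA divff ?mulr1.
  by rewrite -(ltr_nat R) E mulr1n ltr_pdivlMr // mul1r.
exfalso; apply: (outer_arc_angle sp r0 cover disj er (M := M)); apply/andP; split; first by rewrite subr_gt0.
have : (Num.truncn (pi *+ 2 / a))%:R * a < pi *+ 2.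
  rewrite lt_neqAle M1 andbT; apply/eqP => E; case/eqP: ne.
  by rewrite -[in RHS]E mulfK // gt_eqF.
have -> : M%:R * a = (Num.truncn (pi *+ 2 / a))%:R * a + a by rewrite /M mulrSr mulrDl mul1r.
by lra.
Qed.
End Tiling.

Theorem theorem3p3 (R : realType) (T : tile R)
    (eta nu : R -> R * R) (p q : R * R) (alpha beta : R)
    (hwedge : wedge T)
    (hp : radially_generated T eta p alpha)
    (hq : radially_generated T nu q beta)
    (hpq : p <> q)
    (htiles : tiles_disk T p alpha \/ tiles_disk T q beta) :
  exists n : nat,
    [/\ (3 <= n)%N, odd n, alpha = pi / n%:R & beta = pi / n%:R].
Proof.
have [ab [S [N [N1 oS oN cop run]]]] : alpha = beta /\ exists S N : int,
    [/\ 1 < N, odd `|S|%N, odd `|N|%N, coprimez S N & line_run (- expi alpha) S N 1 = 0].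
  (* The orbit has to start at the larger angle; exchanging the two generators covers the other
     case. *)
  have [ba|ab] := leP beta alpha; first exact: two_generators_equation hp hq hpq ba.
  by have [->] := two_generators_equation hq hp (nesym hpq) (ltW ab).
have [M M1 aM] : exists2 M : nat, (1 < M)%N & alpha = pi *+ 2 / M%:R.
  case: htiles; first exact: tiles_disk_angle hp.
  by rewrite ab; exact: tiles_disk_angle hq.
rewrite aM in run.
have [n Mn /andP[n3 on]] := line_run_root_of_unity M1 N1 oS oN cop run.
have E : alpha = pi / n%:R.
  have n0 : n%:R != 0 :> R by rewrite pnatr_eq0; case: (n) n3.
  by rewrite aM Mn -mul2n natrM -mulr_natl; field.
by exists n; rewrite -ab.
Qed.
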